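(* Let $\varepsilon>0$. For every $x\in\mathbb{T}$, $$T_{N,x}(u_\varepsilon)\xrightarrow[N\to\infty]{}\frac{3}{\pi}\,\varepsilon^{-1}(A_2-A_1)\qquad\text{almost surely}.$$
   Context: Fix $T>0$. $\mathbb{T}=\mathbb{R}/\mathbb{Z}$ is the one-dimensional flat torus, identified with $[0,1)$ with periodic boundary conditions. $p_t(x)=\sum_{k\in\mathbb{Z}}\frac{1}{\sqrt{4\pi t}}e^{-(x-k)^2/(4t)}$ is the periodic heat kernel. $W$ is a space-time Gaussian white noise on $[0,T]\times\mathbb{T}$, i.e. a centered Gaussian family with $\mathbf{E}[W(A)W(B)]=\lambda(A\cap B)$ for Borel $A,B\subset[0,T]\times\mathbb{T}$, $\lambda$ being Lebesgue measure. Let $f(u)=u-u^3$. For $\varepsilon>0$, $u_\varepsilon$ is the unique mild solution, with zero initial condition, of the stochastic Allen--Cahn equation $\partial_tu_\varepsilon=\varepsilon\,\partial_x^2u_\varepsilon+f(u_\varepsilon)+\dot W$ on $[0,T]\times\mathbb{T}$, i.e. $$u_\varepsilon(t,x)=\int_0^t\!\int_{\mathbb{T}}p_{\varepsilon(t-s)}(x-y)f(u_\varepsilon(s,y))\,dy\,ds+\int_0^t\!\int_{\mathbb{T}}p_{\varepsilon(t-s)}(x-y)\,W(ds,dy);$$ it satisfies $\sup_{t\in[0,T],x\in\mathbb{T}}\mathbf{E}|u_\varepsilon(t,x)|^q<\infty$ for all $q\ge2$. Let $0<A_1<A_2\le T$, and for $N\ge1$ let $t_i=A_1+i\frac{A_2-A_1}{N}$,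 $i=0,\dots,N$. The temporal quartic variation of a random field $Z$ at the point $x$ is $$T_{N,x}(Z)=\sum_{i=0}^{N-1}\bigl(Z(t_{i+1},x)-Z(t_i,x)\bigr)^4 .$$ *)

(* Defs.v *)
From HB Require Import structures.
From mathcomp Require Import all_boot all_order all_algebra.
From mathcomp Require Import all_classical all_reals all_analysis.

Set Implicit Arguments.
Unset Strict Implicit.
Unset Printing Implicit Defensive.

Import Order.TTheory GRing.Theory Num.Theory.
Import numFieldNormedType.Exports.
Import HBSimple.

Local Open Scope classical_set_scope.
Local Open Scope ring_scope.

(* The torus R/Z is represented by its fundamental domain [0, 1[. *)
Definition torus (R : realType) : set R := `[0, 1[%classic.
Arguments torus : clear implicits.

Definition space_time (R : realType) (T : R) : set (R * R) :=
  `[0, T]%classic `*` torus R.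

Notation lebesgue2 R := ((@lebesgue_measure R \x @lebesgue_measure R)%E).

(* Periodic heat kernel.  All the terms are nonnegative, so the unordered sum
   [esum] is the sum over Z; it is finite for [0 < t]. *)
Definition heat_kernel (R : realType) (t x : R) : R :=
  fine (\esum_(k in [set: int])
    ((Num.sqrt (4 * pi * t))^-1 *
     expR (- (x - k%:~R) ^+ 2 / (4 * t)))%:E)%E.

Section noise.
Context d (Omega : measurableType d) (R : realType) (P : probability Omega R).

(* [normal_prob 0 0] is by convention a uniform law in the library, so the
   degenerate Gaussian law has to be treated separately. *)
Definition centered_gaussian (X : Omega -> R) : Prop :=
  measurable_fun setT X /\
  exists sigma : R, forall B : set R, measurable B ->
    P (X @^-1` B) =
      if sigma == 0 then \d_(0 : R) B else normal_prob 0 sigma B.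

(* Only the values of [W] at Borel subsets of [0, T] x [0, 1[ matter. *)
Definition white_noise (T : R) (W : set (R * R) -> {RV P >-> R}) : Prop :=
  (forall (n : nat) (c : 'I_n -> R) (A : 'I_n -> set (R * R)),
     (forall i, measurable (A i) /\ A i `<=` space_time T) ->
     centered_gaussian (fun w => \sum_(i < n) c i * W (A i) w)) /\
  (forall A B : set (R * R),
     measurable A -> A `<=` space_time T ->
     measurable B -> B `<=` space_time T ->
     ('E_P[fun w => (W A w * W B w)%R] = lebesgue2 R (A `&` B))%E).

(* The sum ranges over the (finite) image of [h] and not over all of [R], since
   [W set0] vanishes only almost surely. *)
Definition wiener_sfun (T : R) (W : set (R * R) -> {RV P >-> R})
    (h : {sfun (R * R)%type >-> R}) (w : Omega) : R :=
  \sum_(c \in range h) c * W (space_time T `&` h @^-1` [set c]) w.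

(* [X] is a version of the integral of [g] over [0, T] x torus against [W]:
   the L^2(P)-limit of the integrals of simple functions converging to [g]
   in L^2([0, T] x torus). *)
Definition is_wiener_integral (T : R) (W : set (R * R) -> {RV P >-> R})
    (g : R * R -> R) (X : {RV P >-> R}) : Prop :=
  measurable_fun (space_time T) g /\
  exists h : nat -> {sfun (R * R)%type >-> R},
    (\int[lebesgue2 R]_(z in space_time T)
        (((h n z - g z) ^+ 2)%R)%:E @[n --> \oo] --> 0)%E /\
    ('E_P[fun w => ((X w - wiener_sfun T W (h n) w) ^+ 2)%R]
        @[n --> \oo] --> 0)%E.

(* Mild solutions, with zero initial condition, of
     du/dt = eps * d^2u/dx^2 + f(u) + dW/dt   on [0, T] x torus,
   in the class of jointly measurable random fields all of whose moments are
   bounded uniformly over space-time. *)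
Definition is_mild_solution (eps T : R) (f : R -> R)
    (W : set (R * R) -> {RV P >-> R}) (u : R -> R -> Omega -> R) : Prop :=
  [/\ measurable_fun (space_time T `*` [set: Omega])
        (fun z : (R * R) * Omega => u z.1.1 z.1.2 z.2),
      forall q : R, 2 <= q ->
        (ereal_sup [set 'E_P[fun w => (`|u z.1 z.2 w| `^ q)%R]
                   | z in space_time T] < +oo)%E
    & forall t x : R, t \in `[0, T] -> x \in torus R ->
        exists I : {RV P >-> R},
          is_wiener_integral T W
            (fun z => \1_(`[0, t]%classic) z.1 *
                      heat_kernel (eps * (t - z.1)) (x - z.2)) I /\
          {ae P, forall w,
             u t x w =
               \int[@lebesgue_measure R]_(s in `[0, t])
                 (\int[@lebesgue_measure R]_(y in torus R)
                    (heat_kernel (eps * (t - s)) (x - y) * f (u s y w)))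
               + I w}].

End noise.

Definition allen_cahn (R : realType) (v : R) : R := v - v ^+ 3.

Definition grid (R : realType) (A1 A2 : R) (N i : nat) : R :=
  A1 + i%:R * ((A2 - A1) / N%:R).

Definition quartic_variation (R : realType) (A1 A2 : R) (N : nat) (x : R)
    (Z : R -> R -> R) : R :=
  \sum_(i < N) (Z (grid A1 A2 N i.+1) x - Z (grid A1 A2 N i) x) ^+ 4.

(* Main.v *)
Require Import Defs.
From HB Require Import structures.
From mathcomp Require Import all_boot all_order all_algebra.
From mathcomp Require Import perm finmap.
From mathcomp Require Import all_classical all_reals all_analysis measurable_realfun.
From mathcomp Require Import ring lra zify.

(** At the fixed point [x] the solution is the sum of a drift and of a stochastic
    convolution.  Let [K_i] be the difference of the space-time heat kernels
    [conv_kernel] seen from [(t_(i+1), x)] and from [(t_i, x)].  The increment of the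
    convolution over the [i]-th subinterval is the Wiener integral of [K_i], and that
    of the drift is the inner product of [K_i] with [f(u)] in [L^2] of space-time.
    Hence everything is governed by the Gram matrix [inc_cov] of the [K_i].

    The Gram matrix.  The semigroup property ([torus_convolution]) reduces the
    covariance of the convolution at times [s <= t] to the time integral of the heat
    kernel at zero.  The term of index zero of the periodic sum contributes
    [k * (sqrt (t + s) - sqrt (t - s))] with [k = (4 pi eps)^(-1/2)], and the other
    terms contribute a function with a Lipschitz derivative
    ([conv_kernel_covariance]).  The entries of the Gram matrix are therefore second
    differences of square roots up to [O(mesh^2)].  As the square root is concave,
    these telescope along a row, so that the row sums are [O(sqrt mesh)]
    ([inc_cov_row_sum]), while the diagonal entries are
    [2 k sqrt mesh + O(mesh)] ([inc_cov_diag]).  Since the fourth moment of a centered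
    Gaussian variable is three times its squared variance, the expected quartic
    variation of the convolution tends to [12 k^2 (A2 - A1)], which is the announced
    limit ([cvg_sum_inc_cov]).

    Concentration.  For a Gaussian vector whose covariance has row sums at most [L] and
    diagonal at most [V], the fourth moment of the centered quartic sum is
    [O(L^2 N^2 V^6)] ([quartic_concentration]).  To see this, compare with an independent
    copy and rotate the pair by 45 degrees: the rotation preserves the joint moments,
    which polarization recovers from those of the linear combinations ([form_value]),
    and it turns [X^4 - Y^4] into [2 (U^3 V + U V^3)], where each of the two terms is
    conditionally Gaussian.  With [L] and [V] of order [sqrt mesh] the bound is [O(N^-2)]; it is
    summable, and the convergence of the noise part is almost sure
    ([noise_quartic_variation]).

    The drift.  Almost surely [f(u)] is square integrable over space-time, and Bessel's
    inequality for the [K_i] ([bessel]) bounds the sum of the squared increments of the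
    drift by [O(sqrt mesh)].  Its quartic variation thus vanishes
    ([drift_quartic_variation]), and does not alter the limit
    ([cvg_quartic_perturbation]). *)

Set Implicit Arguments.
Unset Strict Implicit.
Unset Printing Implicit Defensive.

Import Order.TTheory GRing.Theory Num.Theory.
Import numFieldNormedType.Exports.

Local Open Scope classical_set_scope.
Local Open Scope ring_scope.

(** * Integrals with a prescribed value *)

Section has_int.
Context d (T : measurableType d) (R : realType) (mu : {measure set T -> \bar R}).

Implicit Types (f g : T -> R) (v u : R).

(** Integrability is bundled with a real value, so that linear relations between
    integrals become identities in [R], away from extended arithmetic. *)
Definition has_int (f : T -> R) (v : R) : Prop :=
  mu.-integrable setT (EFin \o f) /\ (\int[mu]_x (f x)%:E = v%:E)%E.

Lemma has_int_unique f v v' : has_int f v -> has_int f v' -> v = v'.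
Proof. by move=> [_ h] [_]; rewrite h => -[]. Qed.

Lemma has_int0 : has_int (fun=> 0) 0.
Proof.
split; first exact: integrable0.
by rewrite integral0.
Qed.

Lemma has_intD f g v v' :
  has_int f v -> has_int g v' -> has_int (fun x => f x + g x) (v + v').
Proof.
move=> [intf fv] [intg gv]; split.
  by rewrite (_ : _ \o _ = (EFin \o f) \+ (EFin \o g)) //; exact: integrableD.
under eq_integral do rewrite EFinD.
by rewrite integralD_EFin// fv gv.
Qed.

Lemma has_intZ a f v : has_int f v -> has_int (fun x => a * f x) (a * v).
Proof.
move=> [intf fv]; split.
  rewrite (_ : _ \o _ = (fun x => a%:E * (EFin \o f) x)%E); first exact: integrableZl.
  by apply/funext => x /=; rewrite EFinM.
under eq_integral do rewrite EFinM.
by rewrite integralZl// fv.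
Qed.

Lemma has_int_sum (I : Type) (s : seq I) (Q : pred I) (f : I -> T -> R) (v : I -> R) :
  (forall i, Q i -> has_int (f i) (v i)) ->
  has_int (fun x => \sum_(i <- s | Q i) f i x) (\sum_(i <- s | Q i) v i).
Proof.
move=> h; elim: s => [|i s ih].
  under [X in has_int X _]funext do rewrite big_nil.
  by rewrite big_nil; exact: has_int0.
under [X in has_int X _]funext do rewrite big_cons.
rewrite big_cons; case: ifPn => // Qi.
by apply: has_intD => //; exact: h.
Qed.

Lemma has_int_measurable f v : has_int f v -> measurable_fun setT f.
Proof. by move=> [/integrableP[/measurable_EFinP]]. Qed.

Lemma has_int_ge0 f v : (forall x, 0 <= f x) -> has_int f v -> 0 <= v.
Proof.
by move=> f0 [_ fv]; rewrite -lee_fin -fv; apply: integral_ge0 => x _; rewrite lee_fin.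
Qed.

Lemma has_int_le f g v v' : (forall x, f x <= g x) ->
  has_int f v -> has_int g v' -> v <= v'.
Proof.
move=> fg hf hg; rewrite -subr_ge0.
apply: (@has_int_ge0 (fun x => g x - f x)); first by move=> x; rewrite subr_ge0.
rewrite -mulN1r; apply: has_intD => //.
under [X in has_int X _]funext do rewrite -mulN1r.
exact: has_intZ.
Qed.

Lemma ge0_has_int f v : measurable_fun setT f -> (forall x, 0 <= f x) ->
  (\int[mu]_x (f x)%:E = v%:E)%E -> has_int f v.
Proof.
move=> mf f0 fv; split=> //; apply/integrableP; split; first exact/measurable_EFinP.
under eq_integral do rewrite /= ger0_norm//.
by rewrite fv ltry.
Qed.

Lemma dominated_has_int f g v : measurable_fun setT f ->
  (forall x, `|f x| <= g x) -> has_int g v -> exists u, has_int f u.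
Proof.
move=> mf fg [ig gv].
have intf : mu.-integrable setT (EFin \o f).
  apply: (le_integrable measurableT _ _ ig); first exact/measurable_EFinP.
  move=> x _ /=; rewrite lee_fin; exact: le_trans (fg x) (ler_norm _).
exists (fine (\int[mu]_x (f x)%:E)); split => //.
by rewrite fineK//; exact: integrable_fin_num intf.
Qed.

End has_int.

(** * Moments of Gaussian variables *)

Section normal_density.
Context (R : realType).
Notation leb := (@lebesgue_measure R).
Import HBNNSimple.

(** Density formula, obtained from simple functions by monotone convergence. *)
Lemma integral_normal_prob (m s : R) (f : measurableTypeR R -> \bar R) :
  measurable_fun setT f -> (forall x, 0 <= f x)%E ->
  (\int[normal_prob m s]_x f x = \int[leb]_x (f x * (normal_pdf m s x)%:E))%E.
Proof.
move=> mf f0.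
have mpdf : measurable_fun setT (normal_pdf m s : measurableTypeR R -> R) := measurable_normal_pdf m s.
have pdf0 x : 0 <= normal_pdf m s x := normal_pdf_ge0 m s x.
pose f_ := nnsfun_approx measurableT mf.
transitivity (lim (\int[normal_prob m s]_x (f_ n x)%:E @[n --> \oo])%E).
  rewrite -monotone_convergence//=.
  - apply: eq_integral => ? /[!inE] xD; apply/esym/cvg_lim => //=.
    exact: cvg_nnsfun_approx.
  - by move=> n; exact/measurable_EFinP/measurable_funTS.
  - by move=> n ? _; rewrite lee_fin.
  - by move=> ? _ ? ? mn; rewrite lee_fin; exact/lefP/nd_nnsfun_approx.
rewrite [RHS](_ : _ = lim
    (\int[leb]_x ((f_ n x)%:E * (normal_pdf m s x)%:E) @[n --> \oo])%E); last first.
  rewrite -monotone_convergence//=.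
  - apply: eq_integral => x /[!inE] xD; apply/esym/cvg_lim => //.
    under eq_cvg do rewrite muleC.
    rewrite muleC; apply: cvgeZl => //; exact: cvg_nnsfun_approx.
  - by move=> n; apply: emeasurable_funM; apply/measurable_EFinP.
  - by move=> n x _; rewrite -EFinM lee_fin mulr_ge0.
  - move=> x _ ? ? mn; rewrite -!EFinM lee_fin ler_wpM2r//.
    exact/lefP/nd_nnsfun_approx.
apply: congr_lim; apply/funext => n.
under [LHS]eq_integral do rewrite fimfunE -fsumEFin//.
rewrite [LHS]ge0_integral_fsum//; last 2 first.
  - by move=> r; exact/measurable_EFinP/measurableT_comp.
  - by move=> k x _; rewrite EFinM nnfun_muleindic_ge0.
under [RHS]eq_integral.
  move=> x _; rewrite fimfunE -fsumEFin// muleC ge0_mule_fsumr; last first.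
    by move=> r; rewrite EFinM nnfun_muleindic_ge0.
  over.
rewrite [RHS]ge0_integral_fsum//; last 2 first.
  - by move=> r; apply: emeasurable_funM; apply/measurable_EFinP => //; exact: measurableT_comp.
  - by move=> k x _; apply: mule_ge0; [rewrite lee_fin|rewrite EFinM nnfun_muleindic_ge0].
apply: eq_fsbigr => r rf.
rewrite integralZl_indic_nnsfun//= integral_indic//= setIT.
under [RHS]eq_integral do rewrite EFinM muleCA.
have r0 : 0 <= r.
  by move: rf; rewrite inE => -[x _ <-].
rewrite ge0_integralZl//=; last 2 first.
  - by apply: emeasurable_funM; apply/measurable_EFinP.
  - by move=> x _; rewrite -EFinM lee_fin mulr_ge0.
congr (_ * _)%E; rewrite /normal_prob integral_mkcond/=.
apply: eq_integral => x _.
by rewrite patchE -EFinM indicE; case: ifPn => xA; rewrite ?mulr1 ?mulr0.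
Qed.

Lemma has_int_normal (s : R) (f : measurableTypeR R -> R) v :
  measurable_fun setT f ->
  has_int leb (fun x => f x * normal_pdf 0 s x) v ->
  has_int (normal_prob 0 s) f v.
Proof.
move=> mf [/integrableP[mfp intfp] fpv].
have pdf0 x : 0 <= normal_pdf 0 s x := normal_pdf_ge0 0 s x.
have mF : measurable_fun setT (EFin \o f) by exact/measurable_EFinP.
have mpdf : measurable_fun setT (normal_pdf 0 s : measurableTypeR R -> R).
  exact: measurable_normal_pdf.
split.
  apply/integrableP; split => //.
  rewrite integral_normal_prob//; last exact: measurableT_comp.
  rewrite (eq_integral (fun x => `|(f x * normal_pdf 0 s x)%:E|%E))// => x _.
  by rewrite /= -EFinM normrM (ger0_norm (pdf0 x)).
rewrite integralE !integral_normal_prob//; last 2 first.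
  - exact: measurable_funeneg.
  - exact: measurable_funepos.
rewrite -fpv [in RHS]integralE; congr (_ - _)%E; apply: eq_integral => x _ /=.
  by rewrite !funeposE/= -!EFin_max -EFinM maxr_pMl// mul0r.
by rewrite !funenegE/= -!EFin_max -EFinM maxr_pMl// mul0r mulNr.
Qed.

End normal_density.

Section integral_derive.
Context (R : realType).
Notation leb := (@lebesgue_measure R).

(** The fundamental theorem of calculus on [[- n, n]], then dominated convergence. *)
Lemma integral_derive_vanishing (F f : R -> R) v :
  has_int leb f v -> continuous f -> (forall x : R, is_derive x 1 F (f x)) ->
  (F n%:R @[n --> \oo] --> 0) -> (F (- n%:R) @[n --> \oo] --> 0) -> v = 0.
Proof.
move=> [intf fv] cf dF F1 F2.
pose fn n x := (f x * \1_(`[- n.+1%:R, n.+1%:R]%classic) x)%:E.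
have mf : measurable_fun setT (EFin \o f) by exact: measurable_int intf.
have ipn n : (\int[leb]_x (fn n x) = (F n.+1%:R - F (- n.+1%:R))%R%:E)%E.
  have <- : (\int[leb]_(x in `[(- n.+1%:R)%R, n.+1%:R%R]) (f x)%:E =
      (F n.+1%:R - F (- n.+1%:R))%R%:E)%E.
    have dr (x : R) : derivable F x 1 by have [] := dF x.
    have cF : continuous F by move=> x; apply: differentiable_continuous; exact/derivable1_diffP.
    rewrite EFinB; apply: continuous_FTC2.
    - by rewrite gtrN.
    - exact: continuous_subspaceT.
    - split => //; first exact: (cvg_at_right_filter (cF _)).
      exact: (cvg_at_left_filter (cF _)).
    - by move=> x _; rewrite derive1E; have [] := dF x.
  rewrite [RHS]integral_mkcond; apply: eq_integral => x _.
  by rewrite /fn patchE indicE; case: ifPn => _; rewrite ?mulr1 ?mulr0.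
have [|||||_ _] := @dominated_convergence _ _ _ leb setT measurableT fn
  (EFin \o f) (abse \o (EFin \o f)).
  - move=> n; apply/measurable_EFinP/measurable_funM; first exact/measurable_EFinP.
    exact: measurable_indic.
  - exact: mf.
  - apply: aeW => x _; apply/fine_cvgP; split; first by apply: nearW.
    rewrite -[X in _ --> X]/(f x); apply: cvg_near_cst.
    near=> n; rewrite /fn /= indicE mem_set ?mulr1//= in_itv/= -ler_norml.
    near: n; exists (Num.truncn `|x|).+1 => // n /= xn.
    rewrite (le_trans (ltW (truncnS_gt _)))// ler_nat; exact: leqW.
  - exact: integrable_abse.
  - apply: aeW => x n _ /=; rewrite lee_fin normrM indicE.
    by case: (_ \in _); rewrite ?normr1 ?mulr1// normr0 mulr0.
rewrite fv (_ : [sequence _]_n = (fun n => (F n.+1%:R - F (- n.+1%:R))%:E)).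
  move=> /fine_cvgP[_ /= cv].
  apply: (cvg_unique _ cv) => //=.
  rewrite -(subrr 0); apply: cvgB.
    by rewrite (cvg_shiftS (fun n => F n%:R)).
  by rewrite (cvg_shiftS (fun n => F (- n%:R))).
by apply/funext => n; exact: ipn.
Unshelve. all: by end_near. Qed.

End integral_derive.

(** Moments of the standard Gaussian law, defined by the recursion that
    integration by parts gives for them. *)
Fixpoint gauss_moment (R : pzRingType) (k : nat) : R :=
  match k with
  | 0 => 1
  | 1 => 0
  | (k'.+1 as k1).+1 => k1%:R * gauss_moment R k'
  end.

Lemma expR_ge_term (R : realType) (y : R) k : 0 <= y -> y ^+ k <= k`!%:R * expR y.
Proof.
move=> y0; rewrite -ler_pdivrMl ?ltr0n ?fact_gt0// mulrC.
case: k => [|k]; first by rewrite expr0 fact0 divr1 -expR0 ler_expR.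
by apply: le_trans (expR_ge1Dxn k y0); rewrite lerDr.
Qed.

Section normal_moments.
Context (R : realType) (s : R).
Hypothesis s0 : s != 0.
Notation leb := (@lebesgue_measure R).
Let w : R -> R := normal_fun 0 s.
Let w2 : R -> R := normal_fun 0 (s * Num.sqrt 2).

Let s2_gt0 : 0 < s ^+ 2.
Proof. by rewrite exprn_even_gt0. Qed.

(** A polynomial factor is absorbed by doubling the variance; this single bound
    yields both the integrability and the decay at infinity. *)
Lemma normal_fun_tail k : exists2 C, 0 <= C & forall x, `|x ^+ k * w x| <= C * w2 x.
Proof.
exists (1 + (4 * s ^+ 2) ^+ k * k`!%:R).
  by rewrite addr_ge0// mulr_ge0// exprn_ge0// mulr_ge0// ltW.
move=> x; rewrite /w /w2 /normal_fun subr0.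
set y := x ^+ 2 / (4 * s ^+ 2).
have y0 : 0 <= y by rewrite divr_ge0 ?sqr_ge0// mulr_ge0// ltW.
have xy : x ^+ 2 = (4 * s ^+ 2) * y.
  by rewrite /y mulrC divfK// mulf_neq0// ?lt0r_neq0// pnatr_eq0.
have -> : - x ^+ 2 / (s ^+ 2 *+ 2) = - y - y.
  by rewrite xy -[_ *+ 2]mulr_natr; field; rewrite s0.
have -> : - x ^+ 2 / ((s * Num.sqrt 2) ^+ 2 *+ 2) = - y.
  rewrite exprMn sqr_sqrtr// xy -[_ *+ 2]mulr_natr; field; by rewrite s0.
rewrite expRD normrM (ger0_norm (mulr_ge0 (expR_ge0 _) (expR_ge0 _))) mulrA.
apply: ler_wpM2r; first exact: expR_ge0.
rewrite -[X in _ <= X]mulr1 -[X in _ <= _ * X](expR0) -(subrr y) expRD mulrA.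
apply: ler_wpM2r; first exact: expR_ge0.
have xk : `|x ^+ k| <= 1 + (4 * s ^+ 2) ^+ k * y ^+ k.
  rewrite -exprMn -xy -exprM mulnC exprM.
  have : 0 <= (`|x ^+ k| - 1) ^+ 2 by exact: sqr_ge0.
  have : `|x ^+ k| ^+ 2 = (x ^+ k) ^+ 2 by rewrite real_normK// num_real.
  have : 0 <= `|x ^+ k| by [].
  nra.
apply: le_trans xk _; rewrite [leRHS]mulrDl mul1r; apply: lerD.
  by rewrite -expR0 ler_expR.
rewrite -mulrA ler_wpM2l//; last exact: expR_ge_term.
by rewrite exprn_ge0// mulr_ge0// ltW.
Qed.

Lemma normal_fun_moment_integrable k : exists v, has_int leb (fun x => x ^+ k * w x) v.
Proof.
have [C C0 hC] := normal_fun_tail k.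
have s20 : s * Num.sqrt 2 != 0 by rewrite mulf_neq0// sqrtr_eq0 -ltNge.
have h2 : has_int leb (normal_pdf 0 (s * Num.sqrt 2)) 1.
  apply: ge0_has_int; [exact: measurable_normal_pdf|exact: normal_pdf_ge0|].
  exact: integral_normal_pdf.
have := @dominated_has_int _ _ R leb (fun x => x ^+ k * w x) (fun x => C * w2 x)
  (C * ((normal_peak (s * Num.sqrt 2))^-1 * 1)).
apply.
- apply: measurable_funM; first exact: exprn_measurable.
  exact: measurable_normal_fun.
- exact: hC.
- apply: has_intZ; rewrite (_ : w2 = fun x => (normal_peak (s * Num.sqrt 2))^-1 *
    normal_pdf 0 (s * Num.sqrt 2) x); first exact: has_intZ.
  apply/funext => x; rewrite normal_pdfE// mulKf//.
  by rewrite gt_eqF// normal_peak_gt0.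
Qed.

Let w2_le1 x : w2 x <= 1.
Proof.
rewrite /w2 /normal_fun -[leRHS]expR0 ler_expR mulNr oppr_le0.
by rewrite divr_ge0 ?sqr_ge0// mulrn_wge0// sqr_ge0.
Qed.

Lemma normal_fun_moment_vanish k (e : R) : `|e| = 1 ->
  ((e * n%:R) ^+ k * w (e * n%:R)) @[n --> \oo] --> 0.
Proof.
move=> e1; have [C C0 hC] := normal_fun_tail k.+1.
rewrite -cvg_shiftS /=.
have c0 : C * n.+1%:R^-1 @[n --> \oo] --> 0.
  rewrite -[X in _ --> X](mulr0 C); apply: cvgM; first exact: cvg_cst.
  exact: cvg_harmonic.
apply: norm_cvg0; apply: (squeeze_cvgr _ (cvg_cst 0) c0).
apply: nearW => n /=; rewrite normr_ge0/= -ler_pdivrMr ?invr_gt0 ?ltr0n// invrK.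
have := hC (e * n.+1%:R); rewrite exprS -mulrA normrM normrM e1 mul1r.
rewrite (ger0_norm (ler0n _ _)) mulrC => /le_trans; apply.
by rewrite ler_piMr.
Qed.

Let dw (x : R) : is_derive x 1 w (- x / s ^+ 2 * w x).
Proof.
rewrite /w /normal_fun.
apply: is_derive_eq.
set E := expR _; rewrite scaler0 add0r subr0 /GRing.scale/= -[s ^+ 2 *+ 2]mulr_natr.
by field; rewrite s0.
Qed.

Let cw : continuous w.
Proof.
move=> x; apply: differentiable_continuous; apply/derivable1_diffP.
by have [] := dw x.
Qed.

Let cXw k : continuous (fun x : R => x ^+ k * w x).
Proof. by move=> x; apply: cvgM; [exact: exprn_continuous|exact: cw]. Qed.

Let moment_step k v : has_int leb (fun x => x ^+ k * w x) v ->
  has_int leb (fun x => x ^+ k.+2 * w x) (k.+1%:R * s ^+ 2 * v).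
Proof.
move=> hk; have [u hu] := normal_fun_moment_integrable k.+2.
suff -> : k.+1%:R * s ^+ 2 * v = u by [].
have h := has_intD (has_intZ (k.+1%:R) hk) (has_intZ (- (s ^+ 2)^-1) hu).
have s2n0 : s ^+ 2 != 0 by rewrite gt_eqF.
suff : k.+1%:R * v + - (s ^+ 2)^-1 * u = 0.
  move=> /eqP; rewrite mulNr subr_eq0 => /eqP e; apply: (mulfI (invr_neq0 s2n0)).
  by rewrite -e mulrAC mulrCA mulVf// mulr1.
apply: (integral_derive_vanishing (F := fun x => x ^+ k.+1 * w x) h).
- move=> x; apply: cvgD; apply: cvgM; by [exact: cvg_cst|exact: cXw].
- move=> x; have dX : is_derive x 1 (fun y : R => y ^+ k.+1) (k.+1%:R * x ^+ k).
    by split; [exact: exprn_derivable|rewrite exp_derive /GRing.scale/= mulr1].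
  apply: (is_derive_eq (is_deriveM dX (dw x))).
  by rewrite /GRing.scale/= !exprS; field; rewrite s0.
- have := normal_fun_moment_vanish k.+1 (normr1 _).
  by under eq_fun do rewrite mul1r.
- have := normal_fun_moment_vanish k.+1 (normrN1 _).
  by under eq_fun do rewrite mulN1r.
Qed.

(** The function [x ^+ k.+1 * w x] vanishes at infinity and has derivative
    [k.+1 * x ^+ k * w x - x ^+ k.+2 * w x / s ^+ 2], whose integral is thus zero. *)
Lemma has_int_normal_pdf_moment k :
  has_int leb (fun x => x ^+ k * normal_pdf 0 s x) (gauss_moment R k * s ^+ k).
Proof.
set c := normal_peak s.
have cn0 : c != 0 by rewrite gt_eqF// normal_peak_gt0.
have pdfE : normal_pdf 0 s = fun x => c * w x.
  by rewrite normal_pdfE.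
have toc m v : has_int leb (fun x => x ^+ m * w x) v ->
    has_int leb (fun x => x ^+ m * normal_pdf 0 s x) (c * v).
  move=> /(has_intZ c); rewrite pdfE.
  by under eq_fun do rewrite mulrCA.
suff [h _] : has_int leb (fun x => x ^+ k * w x) (c^-1 * (gauss_moment R k * s ^+ k)) /\
    has_int leb (fun x => x ^+ k.+1 * w x) (c^-1 * (gauss_moment R k.+1 * s ^+ k.+1)).
  by rewrite -[X in has_int _ _ X](mulVKf cn0); exact: toc.
elim: k => [|k [ih1 ih2]].
  split.
    rewrite /= mul1r expr0 mulr1.
    under eq_fun do rewrite expr0 mul1r.
    rewrite -[c^-1]mulr1 (_ : w = fun x => c^-1 * normal_pdf 0 s x).
      apply: has_intZ; apply: ge0_has_int.
      - exact: measurable_normal_pdf.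
      - exact: normal_pdf_ge0.
      - exact: integral_normal_pdf.
    by apply/funext => x; rewrite pdfE mulKf.
  rewrite /= mul0r mulr0.
  have [u hu] := normal_fun_moment_integrable 1.
  suff <- : u = 0 by [].
  apply: (integral_derive_vanishing (F := fun x => - s ^+ 2 * w x) hu).
  - exact: cXw.
  - move=> x; apply: (is_derive_eq (is_deriveZ _ (dw x))).
    by rewrite /GRing.scale/= expr1; field; rewrite s0.
  - rewrite -(mulr0 (- s ^+ 2)); apply: cvgM; first exact: cvg_cst.
    have := normal_fun_moment_vanish 0 (normr1 _).
    by under eq_fun do rewrite !mul1r.
  - rewrite -(mulr0 (- s ^+ 2)); apply: cvgM; first exact: cvg_cst.
    have := normal_fun_moment_vanish 0 (normrN1 _).
    by under eq_fun do rewrite mulN1r mul1r.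
split => //; have := moment_step ih1.
have -> : k.+1%:R * s ^+ 2 * (c^-1 * (gauss_moment R k * s ^+ k)) =
    c^-1 * (gauss_moment R k.+2 * s ^+ k.+2).
  have -> : gauss_moment R k.+2 = k.+1%:R * gauss_moment R k by [].
  by rewrite [s ^+ k.+2]exprS [s ^+ k.+1]exprS; ring.
by [].
Qed.

End normal_moments.

Section has_int_law.
Context d (Omega : measurableType d) (R : realType) (P : {measure set Omega -> \bar R}).
Context (X : Omega -> measurableTypeR R) (mX : measurable_fun setT X).
Let mX_mixin := isMeasurableFun.Build _ _ _ _ _ mX.
Let X' : {mfun _ >-> _} := HB.pack X mX_mixin.

Lemma has_int_law (nu : {measure set (measurableTypeR R) -> \bar R})
    (f : measurableTypeR R -> R) v :
  (forall B : set R, measurable B -> P (X @^-1` B) = nu B) ->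
  measurable_fun setT f -> has_int nu f v -> has_int P (fun w => f (X w)) v.
Proof.
move=> h mf [/integrableP[_ fi] fv].
have mF : measurable_fun setT (EFin \o f) by exact/measurable_EFinP.
have ge0_law (g : measurableTypeR R -> \bar R) : measurable_fun setT g ->
    (forall x, 0 <= g x)%E -> (\int[P]_w (g (X w)) = \int[nu]_x g x)%E.
  move=> mg g0; rewrite -(preimage_setT X) -(ge0_integral_pushforward mX)//.
  rewrite -/(pushforward P X'); apply: eq_measure_integral => A mA _.
  exact: h.
split.
  apply/integrableP; split.
    by apply/measurable_EFinP; exact: (measurableT_comp mf mX).
  rewrite (ge0_law (abse \o EFin \o f))//.
    exact: (measurableT_comp (@abse_measurable R setT) mF).
  by move=> x; exact: abse_ge0.
rewrite -fv integralE [RHS]integralE; congr (_ - _)%E.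
- under eq_integral do rewrite -[X in X^\+%E]/((EFin \o f) \o X) funepos_comp.
  apply: (ge0_law ((EFin \o f)^\+)%E); first exact: measurable_funepos.
  by move=> x; exact: funepos_ge0.
- under eq_integral do rewrite -[X in X^\-%E]/((EFin \o f) \o X) funeneg_comp.
  apply: (ge0_law ((EFin \o f)^\-)%E); first exact: measurable_funeneg.
  by move=> x; exact: funeneg_ge0.
Qed.

End has_int_law.

(** The formula also covers the Dirac mass at zero, with [s = 0].  From here on
    Gaussian variables only enter through their moments, which removes the
    distinction between degenerate and non-degenerate laws. *)
Lemma centered_gaussian_moments d (Omega : measurableType d) (R : realType)
    (P : probability Omega R) (X : Omega -> R) : centered_gaussian P X ->
  exists s, forall k, has_int P (fun w => X w ^+ k) (gauss_moment R k * s ^+ k).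
Proof.
move=> [mX [s hs]]; exists s => k.
have mk : measurable_fun setT (fun x : measurableTypeR R => x ^+ k : R).
  exact: exprn_measurable.
have [s0|s0] := eqVneq s 0.
  have := @has_int_law _ _ R P X mX (@dirac _ (measurableTypeR R) 0 R)
    (fun x => x ^+ k) (gauss_moment R k * s ^+ k) _ mk.
  apply; first by move=> B mB; apply: etrans (hs B mB) _; rewrite s0 eqxx.
  split.
    apply/integrableP; split; first exact/measurable_EFinP.
    by rewrite integral_dirac//=; [rewrite diracT mul1e ltry|
      apply/measurable_EFinP; exact: measurableT_comp].
  rewrite integral_dirac//=; last exact/measurable_EFinP.
  rewrite diracT mul1e s0; case: k {mk} => [|k]; first by rewrite /= mul1r.
  by rewrite expr0n/= mulr0.
have := @has_int_law _ _ R P X mX (normal_prob 0 s) (fun x => x ^+ k) (gauss_moment R k * s ^+ k) _ mk.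
apply.
  by move=> B mB; apply: etrans (hs B mB) _; rewrite (negbTE s0).
apply: has_int_normal => //.
exact: has_int_normal_pdf_moment.
Qed.

(** * Polarization *)

Section polarization.
Context (R : numDomainType) (n : nat).
Implicit Types (z : 'I_n -> R) (f : {ffun 'I_n -> 'I_n}).

(** Toggling the membership of a point outside [B] is a sign-reversing involution. *)
Lemma sum_sign_superset (B : {set 'I_n}) :
  \sum_(S : {set 'I_n} | B \subset S) (-1) ^+ #|S| = (-1) ^+ n *+ (B == [set: 'I_n]%SET) :> R.
Proof.
have [->|/eqP BT] := eqVneq.
  rewrite (big_pred1 [set: 'I_n]%SET) ?mulr1n ?cardsT ?card_ord// => S.
  by rewrite finset.subTset.
have [a aB] : exists a, a \notin B.
  apply: contra_notP BT => h; apply/finset.setP => a; rewrite inE; apply: contra_notT h => aB.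
  by exists a.
pose h (S : {set 'I_n}) := if a \in S then S :\ a else a |: S.
have hK : involutive h.
  move=> S; rewrite /h; have [aS|aS] := boolP (a \in S).
    by rewrite setD11 finset.setD1K.
  by rewrite setU11 setU1K.
have hB S : (B \subset h S) = (B \subset S).
  rewrite /h; case: ifPn => aS; first by rewrite subsetD1 aB andbT.
  apply/idP/idP => [BS|/fintype.subset_trans]; last by apply; exact: finset.subsetUr.
  apply/fintype.subsetP => b bB; have := fintype.subsetP BS b bB.
  by rewrite !inE => /predU1P[ba|//]; rewrite -ba bB in aB.
have hs S : (-1) ^+ #|h S| = - (-1) ^+ #|S| :> R.
  rewrite /h; case: ifPn => aS.
    by rewrite [in RHS](cardsD1 a S) aS add1n exprS mulN1r opprK.
  by rewrite cardsU1 aS add1n exprS mulN1r.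
have : \sum_(S : {set 'I_n} | B \subset S) (-1) ^+ #|S| =
    - \sum_(S : {set 'I_n} | B \subset S) (-1) ^+ #|S| :> R.
  rewrite {1}(reindex_inj (inv_inj hK))/= -sumrN.
  by apply: eq_big => S; [exact: hB|rewrite hs].
by move=> /eqP; rewrite -addr_eq0 -mulr2n mulrn_eq0/= => /eqP.
Qed.

(** After expanding the powers, the alternating sum only keeps the choices of
    indices that are onto, that is, the permutations. *)
Lemma polarization z :
  \sum_(S : {set 'I_n}) (-1) ^+ #|S| * (\sum_(i in S) z i) ^+ n =
  (-1) ^+ n * n`!%:R * \prod_i z i.
Proof.
have powE (S : {set 'I_n}) : (\sum_(i in S) z i) ^+ n =
    \sum_(f : {ffun 'I_n -> 'I_n} | f @: 'I_n \subset S) \prod_i z (f i).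
  have -> : (\sum_(i in S) z i) ^+ n = \prod_(k < n) \sum_(i in S) z i.
    by rewrite prodr_const card_ord.
  rewrite (bigA_distr_big _ (fun _ j => z j)).
  apply: eq_bigl => f; apply/ffun_onP/fintype.subsetP.
    by move=> h _ /imsetP[i _ ->].
  by move=> h i; apply: h; exact: imset_f.
under [LHS]eq_bigr => S _ do rewrite powE mulr_sumr.
rewrite (exchange_big_dep xpredT)//=.
under eq_bigr do rewrite -mulr_suml sum_sign_superset mulrnAl -mulrnAr.
rewrite -mulr_sumr -mulrA; congr (_ * _).
transitivity (\sum_(f : {ffun 'I_n -> 'I_n} | injectiveb f) \prod_i z (f i)).
  rewrite [RHS]big_mkcond/=; apply: eq_bigr => f _.
  have -> : (f @: 'I_n == [set: 'I_n]%SET) = injectiveb f.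
    apply/eqP/injectiveP => [fT|finj].
      have : {in 'I_n &, injective f}.
        by apply/imset_injP; rewrite fT cardsT.
      by move=> h x y; apply: h.
    by apply/eqP; rewrite eqEcard finset.subsetT/= card_imset// cardsT.
  by case: injectiveb.
rewrite (reindex (fun s : 'S_n => pval s))/=; last first.
  pose g (f : {ffun 'I_n -> 'I_n}) : 'S_n := insubd (perm (@inj_id 'I_n)) f.
  exists g => [s _|f]; first by rewrite /g valKd.
  by move=> fi; rewrite /g insubdK.
rewrite (eq_bigl xpredT); last by move=> s; exact: (valP s).
rewrite (eq_bigr (fun=> \prod_i z i)); last first.
  move=> s _; rewrite [RHS](reindex_inj (@perm_inj _ s)).
  by apply: eq_bigr => i _; rewrite -pvalE.
rewrite sumr_const mulr_natl; congr (_ *+ _).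
by rewrite -(card_Sn n); exact: eq_card.
Qed.

End polarization.

Section forms.
Context (R : realType) (J : finType).
Implicit Types (p q : (J -> R) -> R).

(** [form n p] says that [p] is a homogeneous polynomial of degree [n] in
    variables indexed by [J], given by a list of monomials. *)
Definition form n p : Prop := exists s : seq (R * ('I_n -> J)),
  forall z, p z = \sum_(m <- s) m.1 * \prod_k z (m.2 k).

Lemma form_var j : form 1 (fun z => z j).
Proof.
by exists [:: (1, fun=> j)] => z; rewrite big_seq1 big_ord1 mul1r.
Qed.

Lemma formD n p q : form n p -> form n q -> form n (fun z => p z + q z).
Proof.
by move=> [s ps] [t qt]; exists (s ++ t) => z; rewrite big_cat/= ps qt.
Qed.

Lemma formZ n a p : form n p -> form n (fun z => a * p z).
Proof.
move=> [s ps]; exists [seq (a * m.1, m.2) | m <- s] => z.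
by rewrite ps big_map mulr_sumr; apply: eq_bigr => m _; rewrite mulrA.
Qed.

Lemma form_sum n (I : Type) (r : seq I) (p : I -> (J -> R) -> R) :
  (forall i, form n (p i)) -> form n (fun z => \sum_(i <- r) p i z).
Proof.
move=> h; elim: r => [|i r ih].
  by exists [::] => z; rewrite !big_nil.
have [s hs] := formD (h i) ih; exists s => z.
by rewrite big_cons hs.
Qed.

Lemma formM n m p q : form n p -> form m q -> form (n + m) (fun z => p z * q z).
Proof.
move=> [s ps] [t qt].
exists [seq (a.1 * b.1, fun k => match fintype.split k with inl i => a.2 i | inr i => b.2 i end)
  | a <- s, b <- t] => z.
rewrite ps qt big_allpairs_dep/= mulr_suml; apply: eq_bigr => a _.
rewrite mulr_sumr; apply: eq_bigr => b _ /=.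
rewrite big_split_ord/= mulrACA; congr (_ * (_ * _)); apply: eq_bigr => i _.
  by rewrite (unsplitK (inl i)).
by rewrite (unsplitK (inr i)).
Qed.

Lemma formX4 n p : form n p -> form ((n + n) + (n + n)) (fun z => p z ^+ 4).
Proof.
move=> fp; have [s hs] := formM (formM fp fp) (formM fp fp).
by exists s => z; rewrite -hs; ring.
Qed.

Lemma form_product n (f : 'I_n -> J) (z : J -> R) :
  \prod_k z (f k) = ((-1) ^+ n * n`!%:R)^-1 *
    \sum_(S : {set 'I_n}) (-1) ^+ #|S| *
      (\sum_j (\sum_(k in S) (f k == j)%:R) * z j) ^+ n.
Proof.
have -> : \sum_(S : {set 'I_n}) (-1) ^+ #|S| *
      (\sum_j (\sum_(k in S) (f k == j)%:R) * z j) ^+ n =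
    \sum_(S : {set 'I_n}) (-1) ^+ #|S| * (\sum_(k in S) z (f k)) ^+ n.
  apply: eq_bigr => S _; congr (_ * _ ^+ n).
  under eq_bigr do rewrite mulr_suml.
  rewrite exchange_big/=; apply: eq_bigr => k _.
  rewrite (bigD1 (f k))//= eqxx mul1r big1 ?addr0// => j jk.
  by rewrite eq_sym (negbTE jk) mul0r.
rewrite (polarization (fun k => z (f k))) mulKf//.
by rewrite mulf_neq0 ?signr_eq0// pnatr_eq0 -lt0n fact_gt0.
Qed.

End forms.

(** A partial linear functional on real functions, as a relation between a
    function and its value. *)
Definition linear_functional (R : realType) (T : Type) (D : (T -> R) -> R -> Prop) :=
  [/\ D (fun=> 0) 0,
      forall f g v v', D f v -> D g v' -> D (fun x => f x + g x) (v + v') &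
      forall a f v, D f v -> D (fun x => a * f x) (a * v)].

Lemma linear_functional_sum (R : realType) (T : Type) (D : (T -> R) -> R -> Prop)
    (I : Type) (s : seq I) (f : I -> T -> R) (v : I -> R) :
  linear_functional D -> (forall i, D (f i) (v i)) ->
  D (fun x => \sum_(i <- s) f i x) (\sum_(i <- s) v i).
Proof.
move=> [D0 DD _] h; elim: s => [|i s ih].
  by under [X in D X _]funext do rewrite big_nil; rewrite big_nil.
by under [X in D X _]funext do rewrite big_cons; rewrite big_cons; exact: DD.
Qed.

(** By polarization, the values of a linear functional on the [n]-th powers of
    the linear combinations of a family determine its values on all the
    homogeneous polynomials of degree [n] in this family. *)
Lemma form_value (R : realType) (J : finType) n (p : (J -> R) -> R)
    (Phi : (J -> R) -> R) : form n p ->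
  exists v, forall (T : Type) (D : (T -> R) -> R -> Prop), linear_functional D ->
    forall z : J -> T -> R,
    (forall a : J -> R, D (fun w => (\sum_j a j * z j w) ^+ n) (Phi a)) ->
    D (fun w => p (fun j => z j w)) v.
Proof.
move=> [s ps].
exists (\sum_(m <- s) m.1 * (((-1) ^+ n * n`!%:R)^-1 *
   \sum_(S : {set 'I_n}) (-1) ^+ #|S| * Phi (fun j => \sum_(k in S) (m.2 k == j)%:R))).
move=> T D linD z hz; have [_ _ DZ] := linD.
under [X in D X _]funext do rewrite ps.
apply: linear_functional_sum => // m; apply: (DZ).
under [X in D X _]funext => w do rewrite (form_product m.2 (z^~ w)).
by apply: (DZ); apply: linear_functional_sum => // S; exact: DZ.
Qed.

(** * Fourth moment of the quartic variation of a Gaussian vector *)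

Section iterated_integral.
Context d (Omega : measurableType d) (R : realType) (P : {measure set Omega -> \bar R}).
Implicit Types (f g : Omega * Omega -> R).

(** Expectation with respect to two independent copies of [Omega].  It is
    an iterated integral, so that it composes with conditional computations in
    the second variable for a frozen first one. *)
Definition has_int2 f (v : R) : Prop :=
  exists2 I, forall x, has_int P (fun y => f (x, y)) (I x) & has_int P I v.

Lemma has_int2_linear : linear_functional has_int2.
Proof.
split.
- exists (fun=> 0) => [x|]; exact: has_int0.
- move=> f g v v' [I fI Iv] [I' gI' Iv']; exists (fun x => I x + I' x).
    by move=> x; exact: has_intD.
  exact: has_intD.
- move=> a f v [I fI Iv]; exists (fun x => a * I x); last exact: has_intZ.
  by move=> x; exact: has_intZ.
Qed.

Lemma has_int2_le f g v v' : (forall z, f z <= g z) ->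
  has_int2 f v -> has_int2 g v' -> v <= v'.
Proof.
move=> fg [I fI Iv] [I' gI' Iv']; apply: has_int_le Iv Iv' => x.
by apply: has_int_le (fI x) (gI' x).
Qed.

Lemma has_int2_tensor (f g : Omega -> R) v v' : has_int P f v -> has_int P g v' ->
  has_int2 (fun z => f z.1 * g z.2) (v * v').
Proof.
move=> fv gv'; exists (fun x => f x * v').
  by move=> x /=; exact: has_intZ.
by under [X in has_int _ X _]funext do rewrite mulrC; rewrite mulrC; exact: has_intZ.
Qed.

End iterated_integral.

Lemma gauss_moment_odd (R : pzRingType) k : gauss_moment R k.*2.+1 = 0.
Proof. by elim: k => //= k ->; rewrite mulr0. Qed.

(** The sixteenth moment of the sum of two independent centered Gaussian
    variables of variances [s ^+ 2] and [t ^+ 2]. *)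
Lemma binomial_gauss_moment (R : realType) (s t : R) :
  gauss_moment R 16 * (s ^+ 2 + t ^+ 2) ^+ 8 =
  \sum_(k < 17) 'C(16, k)%:R *
    ((gauss_moment R (16 - k) * s ^+ (16 - k)) * (gauss_moment R k * t ^+ k)).
Proof.
pose F k := 'C(16, k)%:R *
    ((gauss_moment R (16 - k) * s ^+ (16 - k)) * (gauss_moment R k * t ^+ k)).
have Fodd k : F k.*2.+1 = 0.
  by rewrite /F gauss_moment_odd mul0r !mulr0.
have -> : \sum_(k < 17) 'C(16, k)%:R * ((gauss_moment R (16 - k) * s ^+ (16 - k)) *
    (gauss_moment R k * t ^+ k)) =
    F 0%N + F 2%N + F 4%N + F 6%N + F 8%N + F 10%N + F 12%N + F 14%N + F 16%N.
  rewrite (_ : \sum_(k < 17) _ = \sum_(k < 17) F k)//.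
  rewrite !big_ord_recr big_ord0/= add0r.
  rewrite (Fodd 0%N) (Fodd 1%N) (Fodd 2%N) (Fodd 3%N) (Fodd 4%N) (Fodd 5%N).
  by rewrite (Fodd 6%N) (Fodd 7%N) !addr0.
have b2 : 'C(16, 2)%:R = 120 :> R by congr (_%:R).
have b4 : 'C(16, 4)%:R = 20 * 91 :> R by rewrite -natrM; congr (_%:R).
have b6 : 'C(16, 6)%:R = 88 * 91 :> R by rewrite -natrM; congr (_%:R).
have b8 : 'C(16, 8)%:R = 90 * 143 :> R by rewrite -natrM; congr (_%:R).
have b10 : 'C(16, 10)%:R = 88 * 91 :> R by rewrite -natrM; congr (_%:R).
have b12 : 'C(16, 12)%:R = 20 * 91 :> R by rewrite -natrM; congr (_%:R).
have b14 : 'C(16, 14)%:R = 120 :> R by congr (_%:R).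
have m0 : gauss_moment R 0 = 1 by [].
have m2 : gauss_moment R 2 = 1 by rewrite /= mulr1.
have m4 : gauss_moment R 4 = 3 by rewrite /= !mulr1.
have m6 : gauss_moment R 6 = 5 * 3 by rewrite /= !mulr1.
have m8 : gauss_moment R 8 = 7 * (5 * 3) by rewrite /= !mulr1.
have m10 : gauss_moment R 10 = 9 * (7 * (5 * 3)) by rewrite /= !mulr1.
have m12 : gauss_moment R 12 = 11 * (9 * (7 * (5 * 3))) by rewrite /= !mulr1.
have m14 : gauss_moment R 14 = 13 * (11 * (9 * (7 * (5 * 3)))) by rewrite /= !mulr1.
have m16 : gauss_moment R 16 = 15 * (13 * (11 * (9 * (7 * (5 * 3))))).
  by rewrite /= !mulr1.
(* the factorizations keep the unary numerals small for [ring] *)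
rewrite /F bin0 binn !(b2, b4, b6, b8, b10, b12, b14).
rewrite !subSS !subn0.
rewrite !(m0, m2, m4, m6, m8, m10, m12, m14, m16); ring.
Qed.

Definition qform (R : pzRingType) N (c : 'I_N -> 'I_N -> R) (a : 'I_N -> R) : R :=
  \sum_i \sum_j a i * a j * c i j.

(** Schur's test: [2 * `|b i * b j| <= b i ^+ 2 + b j ^+ 2], and the rows and the
    columns have the same sums. *)
Lemma schur_test (R : realFieldType) N (c : 'I_N -> 'I_N -> R) (L : R) :
  (forall i j, c i j = c j i) -> (forall i, \sum_j `|c i j| <= L) ->
  forall b, qform c b <= L * \sum_i b i ^+ 2.
Proof.
move=> cC row_sum b.
have h i j : b i * b j * c i j <= 2^-1 * (`|c i j| * b i ^+ 2) + 2^-1 * (`|c i j| * b j ^+ 2).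
  rewrite -mulrDr -mulrDr mulrC (le_trans (ler_norm _))// normrM mulrCA.
  rewrite ler_wpM2l// normrM -[b i ^+ 2]real_normK ?num_real// -[b j ^+ 2]real_normK ?num_real//.
  have := sqr_ge0 (`|b i| - `|b j|); lra.
have S1 : \sum_i \sum_j `|c i j| * b i ^+ 2 <= L * \sum_i b i ^+ 2.
  rewrite mulr_sumr; apply: ler_sum => i _.
  by rewrite -mulr_suml ler_wpM2r ?sqr_ge0.
have S2 : \sum_i \sum_j `|c i j| * b j ^+ 2 <= L * \sum_i b i ^+ 2.
  rewrite exchange_big/= (le_trans _ S1)//; apply: ler_sum => i _.
  by apply: ler_sum => j _; rewrite cC.
apply: (@le_trans _ _ (\sum_i \sum_j
    (2^-1 * (`|c i j| * b i ^+ 2) + 2^-1 * (`|c i j| * b j ^+ 2)))).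
  by apply: ler_sum => i _; apply: ler_sum => j _; exact: h.
under eq_bigr do rewrite big_split/= -!mulr_sumr.
rewrite big_split/= -!mulr_sumr; lra.
Qed.

Section gaussian_vector.
Context d (Omega : measurableType d) (R : realType) (P : probability Omega R).
Context (N : nat) (xi : 'I_N -> Omega -> R) (c : 'I_N -> 'I_N -> R).
Hypothesis gaussian_xi : forall a : 'I_N -> R, exists s, forall k,
  has_int P (fun w => (\sum_i a i * xi i w) ^+ k) (gauss_moment R k * s ^+ k).
Hypothesis cov_xi : forall i j, has_int P (fun w => xi i w * xi j w) (c i j).

Local Notation qform := (qform c).

Let moments (a : 'I_N -> R) : exists s, s ^+ 2 = qform a /\ forall k,
  has_int P (fun w => (\sum_i a i * xi i w) ^+ k) (gauss_moment R k * s ^+ k).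
Proof.
have [s hs] := gaussian_xi a; exists s; split => //.
have h2 : has_int P (fun w => (\sum_i a i * xi i w) ^+ 2) (qform a).
  rewrite /qform; under [X in has_int _ X _]funext do rewrite expr2 mulr_suml.
  apply: has_int_sum => i _; under [X in has_int _ X _]funext do rewrite mulr_sumr.
  apply: has_int_sum => j _; under [X in has_int _ X _]funext do rewrite mulrACA.
  exact: has_intZ.
by have := has_int_unique (hs 2%N) h2; rewrite /= mulr1 mul1r.
Qed.

Lemma gaussian_even_moment (a : 'I_N -> R) k :
  has_int P (fun w => (\sum_i a i * xi i w) ^+ k.*2)
    (gauss_moment R k.*2 * qform a ^+ k).
Proof. by have [s [<- hs]] := moments a; rewrite -exprM mul2n; exact: hs. Qed.

Lemma gaussian_coord_moment i k :
  has_int P (fun w => xi i w ^+ k.*2) (gauss_moment R k.*2 * c i i ^+ k).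
Proof.
have e (f : 'I_N -> R) : \sum_j (j == i)%:R * f j = f i.
  rewrite (bigD1 i)//= eqxx mul1r big1 ?addr0// => j /negbTE ->.
  by rewrite mul0r.
have := gaussian_even_moment (fun j => (j == i)%:R) k.
under [X in has_int _ X _ -> _]funext do rewrite e.
rewrite /qform; under eq_bigr do under eq_bigr do rewrite -mulrA.
by under eq_bigr do rewrite -mulr_sumr e; rewrite e.
Qed.

(** Two independent copies of the vector, the boolean telling which one. *)
Definition copies (b : bool * 'I_N) (w : Omega * Omega) : R :=
  xi b.2 (if b.1 then w.1 else w.2).

(** Each coordinate and its copy undergo a rotation by 45 degrees, up to a sign. *)
Definition rotated (z : bool * 'I_N -> R) (b : bool * 'I_N) : R :=
  (Num.sqrt 2)^-1 * (z (true, b.2) + (-1) ^+ (~~ b.1) * z (false, b.2)).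

Let sum_bool_pair (F : bool * 'I_N -> R) :
  \sum_b F b = \sum_i F (true, i) + \sum_i F (false, i).
Proof.
transitivity (\sum_(p : bool * 'I_N) F (p.1, p.2)); first by apply: eq_bigr => -[].
by rewrite -(pair_bigA _ (fun b i => F (b, i)))/= big_bool.
Qed.

Let form_moment (a : bool * 'I_N -> R) : R :=
  gauss_moment R 16 *
    (qform (fun i => a (true, i)) + qform (fun i => a (false, i))) ^+ 8.

(** Degree 16 is that of the fourth power of a difference of quartic sums. *)
Lemma copies_moment a :
  has_int2 P (fun w => (\sum_b a b * copies b w) ^+ 16) (form_moment a).
Proof.
have [s [sq hs]] := moments (fun i => a (true, i)).
have [t [tq ht]] := moments (fun i => a (false, i)).
have -> : form_moment a = \sum_(k < 17) 'C(16, k)%:R *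
    ((gauss_moment R (16 - k) * s ^+ (16 - k)) * (gauss_moment R k * t ^+ k)).
  by rewrite /form_moment -sq -tq binomial_gauss_moment.
have -> : (fun w => (\sum_b a b * copies b w) ^+ 16) = (fun w =>
    \sum_(k < 17) 'C(16, k)%:R * ((\sum_i a (true, i) * xi i w.1) ^+ (16 - k) *
      (\sum_i a (false, i) * xi i w.2) ^+ k)).
  apply/funext => w; rewrite sum_bool_pair exprDn.
  by apply: eq_bigr => k _; rewrite mulr_natl.
have := linear_functional_sum (I := 'I_17)
  (f := fun k w => 'C(16, k)%:R * ((\sum_i a (true, i) * xi i w.1) ^+ (16 - k) *
      (\sum_i a (false, i) * xi i w.2) ^+ k))
  (v := fun k => 'C(16, k)%:R * ((gauss_moment R (16 - k) * s ^+ (16 - k)) *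
      (gauss_moment R k * t ^+ k))) (index_enum _) (has_int2_linear P).
apply => k; have [_ _ DZ] := has_int2_linear P; apply: DZ.
exact: (has_int2_tensor (hs _) (ht _)).
Qed.

(** The sum of the two quadratic forms is invariant under rotation: the rotated
    pair has the same moments as the original one. *)
Lemma rotated_moment a :
  has_int2 P (fun w => (\sum_b a b * rotated (copies^~ w) b) ^+ 16) (form_moment a).
Proof.
have r2 : (Num.sqrt 2 : R)^-1 ^+ 2 = 2^-1 by rewrite exprVn sqr_sqrtr.
pose a' (b : bool * 'I_N) := rotated a b.
have -> : form_moment a = form_moment a'.
  rewrite /form_moment; congr (_ * _ ^+ 8); rewrite /qform -!big_split/=.
  apply: eq_bigr => i _; rewrite -!big_split/=; apply: eq_bigr => j _.
  rewrite /a' /rotated/= expr0 expr1.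
  transitivity ((Num.sqrt 2)^-1 ^+ 2 * 2 * (a (true, i) * a (true, j) * c i j +
    a (false, i) * a (false, j) * c i j)); last by ring.
  by rewrite r2 mulVf ?mul1r.
have -> : (fun w => (\sum_b a b * rotated (copies^~ w) b) ^+ 16) =
    (fun w => (\sum_b a' b * copies b w) ^+ 16).
  apply/funext => w; congr (_ ^+ _); rewrite !sum_bool_pair -!big_split/=.
  by apply: eq_bigr => i _; rewrite /a' /rotated/= expr0 expr1; ring.
exact: copies_moment.
Qed.

Lemma swapped_moment a :
  has_int2 P (fun w => (\sum_b a b * copies (~~ b.1, b.2) w) ^+ 16) (form_moment a).
Proof.
have -> : form_moment a = form_moment (fun b => a (~~ b.1, b.2)).
  by rewrite /form_moment/= addrC.
have -> : (fun w => (\sum_b a b * copies (~~ b.1, b.2) w) ^+ 16) =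
    (fun w => (\sum_b a (~~ b.1, b.2) * copies b w) ^+ 16).
  by apply/funext => w; congr (_ ^+ _); rewrite !sum_bool_pair/= addrC.
exact: copies_moment.
Qed.

Context (L V : R).
Hypothesis row_sum : forall i, \sum_j `|c i j| <= L.
Hypothesis var_le : forall i, c i i <= V.

Let cC i j : c i j = c j i.
Proof.
apply: has_int_unique (cov_xi i j) _.
by under [X in has_int _ X _]funext do rewrite mulrC; exact: cov_xi.
Qed.

Let c_ge0 i : 0 <= c i i.
Proof. by apply: has_int_ge0 (cov_xi i i) => w; rewrite -expr2 sqr_ge0. Qed.

Lemma qform_ge0 (b : 'I_N -> R) : 0 <= qform b.
Proof. by have [s [<- _]] := moments b; exact: sqr_ge0. Qed.

Lemma sqr_sum_le (b : 'I_N -> R) : (\sum_i b i) ^+ 2 <= N%:R * \sum_i b i ^+ 2.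
Proof.
have h i j : b i * b j <= 2^-1 * (b i ^+ 2 + b j ^+ 2).
  have := sqr_ge0 (b i - b j); nra.
rewrite expr2 mulr_suml.
under eq_bigr do rewrite mulr_sumr.
apply: (@le_trans _ _ (\sum_i \sum_j 2^-1 * (b i ^+ 2 + b j ^+ 2))).
  by apply: ler_sum => i _; apply: ler_sum => j _; exact: h.
under eq_bigr do rewrite -mulr_sumr big_split/= sumr_const card_ord.
rewrite -mulr_sumr big_split/= sumr_const card_ord.
under eq_bigr do rewrite -mulr_natl.
rewrite -mulr_sumr -mulr_natl; lra.
Qed.

Let quartic (z : bool * 'I_N -> R) : R :=
  (\sum_i z (true, i) ^+ 4 - \sum_i z (false, i) ^+ 4) ^+ 4.

Let mixed (z : bool * 'I_N -> R) : R :=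
  (\sum_i z (true, i) ^+ 3 * z (false, i)) ^+ 4.

Let form_quartic : form 16 quartic.
Proof.
apply: (formX4 (n := 4)).
have f4 (b : bool) : form 4 (fun z : bool * 'I_N -> R => \sum_i z (b, i) ^+ 4).
  by apply: form_sum => i; exact: (formX4 (form_var _ _)).
have [s hs] := formD (f4 true) (formZ (- 1) (f4 false)).
by exists s => z; rewrite -hs mulN1r.
Qed.

Let form_mixed : form 16 mixed.
Proof.
apply: (formX4 (n := 4)); apply: form_sum => i.
have v (b : bool) : form 1 (fun z : bool * 'I_N -> R => z (b, i)) by exact: form_var.
have [s hs] := formM (formM (v true) (v true)) (formM (v true) (v false)).
by exists s => z; rewrite -hs; ring.
Qed.

(** Rotating by 45 degrees turns [X ^+ 4 - Y ^+ 4] into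
    [2 * (U ^+ 3 * V + U * V ^+ 3)]. *)
Let quartic_rotated z : quartic (rotated z) <=
  128 * (mixed z + mixed (fun b => z (~~ b.1, b.2))).
Proof.
have r4 : (Num.sqrt 2 : R)^-1 ^+ 4 = 4^-1.
  by rewrite exprVn (exprM _ 2 2) sqr_sqrtr//; congr (_^-1); ring.
rewrite /quartic /mixed/=.
have -> : \sum_i rotated z (true, i) ^+ 4 - \sum_i rotated z (false, i) ^+ 4 =
  2 * (\sum_i z (true, i) ^+ 3 * z (false, i) + \sum_i z (false, i) ^+ 3 * z (true, i)).
  rewrite -sumrB -big_split/= mulr_sumr; apply: eq_bigr => i _.
  by rewrite /rotated/= expr0 expr1 !exprMn r4; field.
move: (\sum_i z (true, i) ^+ 3 * z (false, i))
  (\sum_i z (false, i) ^+ 3 * z (true, i)) => a b.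
suff : (a + b) ^+ 4 <= 8 * (a ^+ 4 + b ^+ 4) by rewrite exprMn; lra.
have := sqr_ge0 (a ^+ 2 - b ^+ 2); have := sqr_ge0 (a - b).
have := sqr_ge0 (a + b); have := mulr_ge0 (sqr_ge0 (a-b)) (sqr_ge0 (a+b)).
nra.
Qed.

(** By Jensen's inequality the centering [\sum_i 3 * c i i ^+ 2] can be replaced
    with the quartic sum of an independent copy.  Rotating the pair turns the
    difference into sums of [U i ^+ 3 * V i] which, given [U], are Gaussian with
    variance the quadratic form of [c] at the cubes [U i ^+ 3]; Schur's test
    bounds it by [L * \sum_i U i ^+ 6]. *)
Lemma quartic_concentration : exists u,
  has_int P (fun w => (\sum_i xi i w ^+ 4 - \sum_i 3 * c i i ^+ 2) ^+ 4) u /\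
  u <= 768 * gauss_moment R 12 * (L ^+ 2 * N%:R ^+ 2 * V ^+ 6).
Proof.
have [v hv] := form_value form_moment form_quartic.
have [v1 hv1] := form_value form_moment form_mixed.
have linD := has_int2_linear P.
have qv : has_int2 P (fun w => quartic (copies^~ w)) v.
  exact: (hv _ _ linD _ copies_moment).
have qv' : has_int2 P (fun w => quartic (rotated (copies^~ w))) v.
  exact: (hv _ _ linD _ rotated_moment).
have mv : has_int2 P (fun w => mixed (copies^~ w)) v1.
  exact: (hv1 _ _ linD _ copies_moment).
have mv' : has_int2 P (fun w => mixed (fun b => copies (~~ b.1, b.2) w)) v1.
  exact: (hv1 _ _ linD _ swapped_moment).
have vv1 : v <= 128 * (v1 + v1).
  have [_ DD DZ] := linD.
  by apply: has_int2_le qv' (DZ _ _ _ (DD _ _ _ _ mv mv')) => z; exact: quartic_rotated.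
(* conditionally on the first copy, the mixed sum is Gaussian in the second one *)
have v1le : v1 <= 3 * (L ^+ 2 * N%:R ^+ 2 * (gauss_moment R 12 * V ^+ 6)).
  have [I hI Iv1] := mv.
  have IE x : I x = 3 * qform (fun i => xi i x ^+ 3) ^+ 2.
    apply: has_int_unique (hI x) _.
    have := gaussian_even_moment (fun i => xi i x ^+ 3) 2.
    by rewrite /= !mulr1.
  have h12 : has_int P (fun x => 3 * (L ^+ 2 * (N%:R * \sum_i xi i x ^+ 12)))
     (3 * (L ^+ 2 * (N%:R * \sum_i gauss_moment R 12 * c i i ^+ 6))).
    do 3 apply: has_intZ; apply: has_int_sum => i _.
    exact: (gaussian_coord_moment i 6).
  have M12 : 0 <= gauss_moment R 12 by rewrite /= !mulr_ge0.
  apply: le_trans (has_int_le _ Iv1 h12) _.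
    move=> x; rewrite IE ler_wpM2l//.
    have h : 0 <= qform (fun i => xi i x ^+ 3) <= L * \sum_i xi i x ^+ 6.
      have -> : \sum_i xi i x ^+ 6 = \sum_i (xi i x ^+ 3) ^+ 2.
        by under [RHS]eq_bigr do rewrite -exprM.
      by rewrite qform_ge0/=; exact: schur_test.
    have -> : \sum_i xi i x ^+ 12 = \sum_i (xi i x ^+ 6) ^+ 2.
      by under [RHS]eq_bigr do rewrite -exprM.
    have /andP[h0 h1] := h.
    apply: (@le_trans _ _ ((L * \sum_i xi i x ^+ 6) ^+ 2)).
      by rewrite lerXn2r// nnegrE// (le_trans h0).
    by rewrite exprMn ler_wpM2l ?sqr_ge0//; exact: sqr_sum_le.
  rewrite ler_wpM2l// -mulrA ler_wpM2l ?sqr_ge0// expr2 -mulrA ler_wpM2l//.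
  rewrite -mulr_sumr mulrCA ler_wpM2l// (le_trans (ler_sum _ (fun i _ =>
    lerXn2r 6 (c_ge0 i) (le_trans (c_ge0 i) (var_le i)) (var_le i))))//.
  by rewrite sumr_const card_ord mulr_natl.
set F := fun w => \sum_i xi i w ^+ 4; set m := \sum_i 3 * c i i ^+ 2.
have Fm : has_int P F m.
  by apply: has_int_sum => i _; have := gaussian_coord_moment i 2; rewrite /= !mulr1.
have mF := has_int_measurable Fm.
have [I hI Iv] := qv.
(* Jensen: the fourth power lies above its tangent at [F x - m] *)
have h x : (F x - m) ^+ 4 <= I x.
  have p1 : has_int P (fun=> 1) 1.
    by apply: ge0_has_int => //; rewrite integral_cst//= mul1e probability_setT.
  pose A := (F x - m) ^+ 4; pose B := 4 * (F x - m) ^+ 3.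
  have := has_intD (has_intZ (A + B * m) p1) (has_intZ (- B) Fm).
  move=> /has_int_le /(_ (hI x)); rewrite mulr1 mulNr addrK; apply => y.
  rewrite /quartic/= -/(F x) -/(F y) /A /B.
  move: (F x) (F y) => a b.
  rewrite -subr_ge0.
  have -> : (a - b) ^+ 4 - ((a - m) ^+ 4 + 4 * (a - m) ^+ 3 * m +
      - (4 * (a - m) ^+ 3) * b) =
     (m - b) ^+ 2 * ((m - b + 2 * (a - m)) ^+ 2 + 2 * (a - m) ^+ 2) by ring.
  apply: mulr_ge0; first exact: sqr_ge0.
  apply: addr_ge0; first exact: sqr_ge0.
  by apply: mulr_ge0 => //; exact: sqr_ge0.
have [u hu] : exists u, has_int P (fun w => (F w - m) ^+ 4) u.
  apply: dominated_has_int Iv.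
    apply: measurable_funX; apply: measurable_funB; [exact: mF|exact: measurable_cst].
  by move=> x; rewrite ger0_norm// exprn_even_ge0.
exists u; split => //; apply: le_trans (has_int_le h hu Iv) _.
lra.
Qed.

End gaussian_vector.

(** * Almost sure convergence and Fatou's lemma *)

Section almost_sure.
Context d (T : measurableType d) (R : realType) (mu : {measure set T -> \bar R}).

Lemma ae_imply (A B : T -> Prop) : {ae mu, forall x, A x} ->
  (forall x, A x -> B x) -> {ae mu, forall x, B x}.
Proof. by move=> hA AB; apply: filterS hA. Qed.

Lemma ae_imply2 (A B C : T -> Prop) : {ae mu, forall x, A x} ->
  {ae mu, forall x, B x} -> (forall x, A x -> B x -> C x) -> {ae mu, forall x, C x}.
Proof. by move=> hA hB ABC; apply: filterS2 hA hB. Qed.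

(** Borel-Cantelli in integral form: summable expectations force almost sure
    convergence to zero, because the series has a finite integral. *)
Lemma ae_cvg0_summable (X : nat -> T -> R) (v : nat -> R) (M : R) :
  (forall n w, 0 <= X n w) -> (forall n, has_int mu (X n) (v n)) ->
  (forall n, \sum_(k < n) v k <= M) ->
  {ae mu, forall w, X n w @[n --> \oo] --> 0}.
Proof.
move=> X0 Xv vM.
have mX n : measurable_fun setT (EFin \o X n).
  by apply/measurable_EFinP; exact: has_int_measurable (Xv n).
have intX : (\int[mu]_w (\sum_(n <oo) (X n w)%:E) <= M%:E)%E.
  rewrite integral_nneseries//; last by move=> *; rewrite lee_fin.
  apply: lime_le.
    by apply: is_cvg_nneseries => n _ _; apply: integral_ge0 => x _; rewrite lee_fin.
  apply: nearW => n; rewrite big_mkord.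
  under eq_bigr do rewrite (Xv _).2.
  by rewrite sumEFin lee_fin.
have intb : mu.-integrable setT (fun w => \sum_(n <oo) (X n w)%:E)%E.
  apply/integrableP; split.
    apply: (@ge0_emeasurable_sum _ _ _ setT (fun n w => (X n w)%:E) xpredT).
      by move=> n x _ _; rewrite lee_fin.
    by move=> n _; exact: mX.
  rewrite (eq_integral (fun w => \sum_(n <oo) (X n w)%:E)%E).
    by apply: le_lt_trans intX _; rewrite ltry.
  by move=> w _; rewrite gee0_abs// nneseries_ge0// => n _ _; rewrite lee_fin.
have := integrable_ae measurableT intb.
apply: filterS => w /(_ I) finw.
have X0w n : (0 <= (X n w)%:E)%E by rewrite lee_fin.
apply/cvg_series_cvg_0; apply: nondecreasing_is_cvgn.
  by apply/nondecreasing_seqP => n; rewrite !seriesEnat/= big_nat_recr//= lerDl.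
exists (fine (\sum_(n <oo) (X n w)%:E)) => _ [n _ <-].
rewrite -lee_fin fineK// seriesEnat/= -sumEFin.
exact: nneseries_lim_ge.
Qed.

(** Fatou's lemma, which transfers a uniform bound on integrals to an almost sure
    limit together with the integrability of the latter. *)
Lemma fatou_has_int (f : nat -> T -> R) (g : T -> R) (v : nat -> R) (B : R) :
  (forall n w, 0 <= f n w) -> (forall n, has_int mu (f n) (v n)) ->
  (forall n, v n <= B) -> measurable_fun setT g ->
  {ae mu, forall w, f n w @[n --> \oo] --> g w} ->
  (forall w, 0 <= g w) ->
  exists2 u, has_int mu g u & u <= B.
Proof.
move=> f0 fv vB mg fg g0.
have mf n : measurable_fun setT (EFin \o f n).
  by apply/measurable_EFinP; exact: has_int_measurable (fv n).
have ig : (\int[mu]_w (g w)%:E <= B%:E)%E.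
  have -> : (\int[mu]_w (g w)%:E = \int[mu]_w limn_einf (fun n => (f n w)%:E))%E.
    apply: ge0_ae_eq_integral => //.
    - exact/measurable_EFinP.
    - apply: (@emeasurable_fun_cvg _ _ _ setT
        (fun n w => einfs (fun k => (f k w)%:E) n)) => [|x _].
        exact: (@measurable_fun_einfs _ _ _ setT (fun k w => (f k w)%:E) mf).
      by rewrite limn_einf_lim; exact: is_cvg_einfs.
    - by move=> w _; rewrite lee_fin.
    - move=> w _; rewrite limn_einf_lim; apply: lime_ge; first exact: is_cvg_einfs.
      by apply: nearW => n; apply: le_ereal_inf_tmp => _ [m /= nm <-]; rewrite lee_fin.
    - apply: filterS fg => w fgw _.
      have /cvg_limn_einf_sup[->//] : (f n w)%:E @[n --> \oo] --> (g w)%:E.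
      by apply/fine_cvgP; split; [exact: nearW|exact: fgw].
  apply: le_trans (@fatou _ _ _ mu setT _ (fun k w => (f k w)%:E) _ _) _ => //.
    by move=> n x _; rewrite lee_fin.
  rewrite limn_einf_lim; apply: lime_le; first exact: is_cvg_einfs.
  apply: nearW => n; apply: (@le_trans _ _ (\int[mu]_x (f n x)%:E)%E).
    by apply: ereal_inf_lbound; exists n => /=.
  by rewrite (fv n).2 lee_fin.
have ige0 : (0 <= \int[mu]_w (g w)%:E)%E.
  by apply: integral_ge0 => w _; rewrite lee_fin.
have fin : (\int[mu]_w (g w)%:E)%E \is a fin_num.
  by rewrite ge0_fin_numE// (le_lt_trans ig)// ltry.
exists (fine (\int[mu]_w (g w)%:E)); last by rewrite -lee_fin fineK.
by apply: ge0_has_int => //; rewrite fineK.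
Qed.

(** The quadratic [a - 2 * l * c + l ^+ 2 * b] is nonnegative in [l]. *)
Lemma has_int_cauchy_schwarz (f g : T -> R) a b c :
  has_int mu (fun x => f x ^+ 2) a -> has_int mu (fun x => g x ^+ 2) b ->
  has_int mu (fun x => f x * g x) c -> c ^+ 2 <= a * b.
Proof.
move=> fa gb fgc.
have q l : 0 <= a + (- 2 * l) * c + l ^+ 2 * b.
  apply: (@has_int_ge0 _ _ _ mu (fun x => f x ^+ 2 + (- 2 * l) * (f x * g x) + l ^+ 2 * g x ^+ 2)).
    move=> x; rewrite (_ : _ + _ = (f x - l * g x) ^+ 2) ?sqr_ge0//; ring.
  apply: has_intD; last exact: has_intZ.
  by apply: has_intD => //; exact: has_intZ.
have b0 : 0 <= b by apply: has_int_ge0 gb => x; exact: sqr_ge0.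
have [b0'|bn0] := eqVneq b 0; last first.
  have bgt0 : 0 < b by rewrite lt_neqAle eq_sym bn0.
  have := q (c / b).
  have -> : a + - 2 * (c / b) * c + (c / b) ^+ 2 * b = (a * b - c ^+ 2) / b by field.
  by rewrite pmulr_lge0 ?invr_gt0// subr_ge0.
have [->|cn0] := eqVneq c 0; first by rewrite expr0n/= b0' mulr0.
(* the linear function of [l] left when [b = 0] takes the value -1 here *)
have := q ((a + 1) / (2 * c)); rewrite b0' !mulr0 addr0.
have -> : a + - 2 * ((a + 1) / (2 * c)) * c = -1 by field.
by rewrite oppr_ge0 ler10.
Qed.

Lemma has_int_mul (f g : T -> R) a b :
  measurable_fun setT f -> measurable_fun setT g ->
  has_int mu (fun x => f x ^+ 2) a -> has_int mu (fun x => g x ^+ 2) b ->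
  exists c, has_int mu (fun x => f x * g x) c.
Proof.
move=> mf mg fa gb; apply: dominated_has_int (has_intD fa gb).
  exact: measurable_funM.
move=> x; rewrite normrM -[f x ^+ 2]real_normK ?num_real//.
rewrite -[g x ^+ 2]real_normK ?num_real//.
have := sqr_ge0 (`|f x| - `|g x|); have := sqr_ge0 (`|f x|); have := sqr_ge0 (`|g x|).
nra.
Qed.

(** Continuity of the inner product of [L^2]. *)
Lemma has_int_cvg (f g : nat -> T -> R) (f0 g0 : T -> R) (u v c : nat -> R) a b c0 :
  (forall n, measurable_fun setT (f n)) -> (forall n, measurable_fun setT (g n)) ->
  measurable_fun setT f0 -> measurable_fun setT g0 ->
  has_int mu (fun x => f0 x ^+ 2) a -> has_int mu (fun x => g0 x ^+ 2) b ->
  (forall n, has_int mu (fun x => (f n x - f0 x) ^+ 2) (u n)) ->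
  (forall n, has_int mu (fun x => (g n x - g0 x) ^+ 2) (v n)) ->
  u n @[n --> \oo] --> 0 -> v n @[n --> \oo] --> 0 ->
  (forall n, has_int mu (fun x => f n x * g n x) (c n)) ->
  has_int mu (fun x => f0 x * g0 x) c0 ->
  c n @[n --> \oo] --> c0.
Proof.
move=> mf mg mf0 mg0 fa gb fu gv u0 v0 fgc fgc0.
have mfd n : measurable_fun setT (fun x => f n x - f0 x) by exact: measurable_funB.
have mgd n : measurable_fun setT (fun x => g n x - g0 x) by exact: measurable_funB.
have CS (a1 b1 c1 : R) : c1 ^+ 2 <= a1 * b1 -> `|c1| <= Num.sqrt (a1 * b1).
  by move=> h; rewrite -sqrtr_sqr ler_wsqrtr.
have bound n : `|c n - c0| <=
    Num.sqrt (u n * v n) + (Num.sqrt (u n * b) + Num.sqrt (a * v n)).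
  have [c1 h1] := has_int_mul (mfd n) (mgd n) (fu n) (gv n).
  have [c2 h2] := has_int_mul (mfd n) mg0 (fu n) gb.
  have [c3 h3] := has_int_mul mf0 (mgd n) fa (gv n).
  have -> : c n - c0 = c1 + (c2 + c3).
    apply: has_int_unique (has_intD h1 (has_intD h2 h3)).
    have := has_intD (fgc n) (has_intZ (-1) fgc0); rewrite mulN1r.
    by congr (has_int _ _ _); apply/funext => x; ring.
  apply: le_trans (ler_normD _ _) _; apply: lerD.
    exact: CS (has_int_cauchy_schwarz (fu n) (gv n) h1).
  apply: le_trans (ler_normD _ _) _; apply: lerD.
    exact: CS (has_int_cauchy_schwarz (fu n) gb h2).
  exact: CS (has_int_cauchy_schwarz fa (gv n) h3).
have cs (h : nat -> R) : h n @[n --> \oo] --> 0 -> Num.sqrt (h n) @[n --> \oo] --> 0.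
  by move=> h0; rewrite -(sqrtr0 R); apply: (cvg_comp _ _ h0); exact: sqrt_continuous.
have bnd0 : Num.sqrt (u n * v n) + (Num.sqrt (u n * b) + Num.sqrt (a * v n))
    @[n --> \oo] --> 0.
  rewrite -[X in _ --> X]addr0; apply: cvgD.
    by apply: cs; rewrite -[X in _ --> X](mulr0 0); exact: cvgM.
  rewrite -[X in _ --> X]addr0; apply: cvgD; apply: cs.
    by rewrite -[X in _ --> X](mul0r b); apply: cvgM => //; exact: cvg_cst.
  by rewrite -[X in _ --> X](mulr0 a); apply: cvgM => //; exact: cvg_cst.
apply/subr_cvg0; apply: norm_cvg0.
apply: (squeeze_cvgr _ (cvg_cst 0) bnd0).
by apply: nearW => n /=; rewrite normr_ge0/=; exact: bound.
Qed.

End almost_sure.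

(** * Wiener integrals as limits of elementary integrals *)

Section wiener.
Context d (Omega : measurableType d) (R : realType) (P : probability Omega R).
Context (T : R) (W : set (R * R) -> {RV P >-> R}).
Hypothesis hW : white_noise T W.
Import HBSimple.
Local Notation S := (space_time T).
Local Notation leb2 := (lebesgue2 R).
Implicit Types (s t : seq (R * set (R * R))).

Lemma measurable_space_time : measurable S.
Proof. by apply: measurableX; exact: measurable_itv. Qed.

(** Simple integrands are kept as lists of coefficients and sets.  Concatenation
    and scaling of lists then act exactly on the noise, whereas the additivity of
    [W] over sets only holds almost surely. *)
Definition elementary s : Prop :=
  forall k, measurable (nth (0, set0) s k).2 /\ (nth (0, set0) s k).2 `<=` S.

Let elementary_default : measurable (0 : R, @set0 (R * R)).2 /\
  (0 : R, @set0 (R * R)).2 `<=` S.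
Proof. by split => //; exact: measurable0. Qed.

Definition elem_noise s (w : Omega) : R := \sum_(p <- s) p.1 * W p.2 w.

Definition elem_fun s (z : R * R) : R := \sum_(p <- s) p.1 * \1_(p.2) z.

Definition scale_seq (a : R) s := [seq (a * p.1, p.2) | p <- s].

Lemma elementary_cat s t : elementary s -> elementary t -> elementary (s ++ t).
Proof. by move=> es et k; rewrite nth_cat; case: ifP. Qed.

Lemma elementary_scale a s : elementary s -> elementary (scale_seq a s).
Proof.
move=> es k; have [ks|ks] := ltnP k (size s).
  by rewrite (nth_map (0, set0))//=; exact: es.
by rewrite nth_default ?size_map//; exact: elementary_default.
Qed.

Lemma elementary_cons p s : elementary (p :: s) ->
  [/\ measurable p.2, p.2 `<=` S & elementary s].
Proof. by move=> es; have [? ?] := es 0%N; split => // k; exact: (es k.+1). Qed.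

Lemma elementary_flatten (I : Type) (r : seq I) (f : I -> seq (R * set (R * R))) :
  (forall i, elementary (f i)) -> elementary (flatten (map f r)).
Proof.
move=> ef; elim: r => [|i r ih] /=; last exact: elementary_cat.
by move=> k; rewrite nth_nil; exact: elementary_default.
Qed.

Lemma elem_noise_cat s t w : elem_noise (s ++ t) w = elem_noise s w + elem_noise t w.
Proof. by rewrite /elem_noise big_cat. Qed.

Lemma elem_fun_cat s t w : elem_fun (s ++ t) w = elem_fun s w + elem_fun t w.
Proof. by rewrite /elem_fun big_cat. Qed.

Lemma elem_noise_scale a s w : elem_noise (scale_seq a s) w = a * elem_noise s w.
Proof.
rewrite /elem_noise big_map mulr_sumr; apply: eq_bigr => p _ /=.
by rewrite mulrA.
Qed.

Lemma elem_fun_scale a s w : elem_fun (scale_seq a s) w = a * elem_fun s w.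
Proof.
rewrite /elem_fun big_map mulr_sumr; apply: eq_bigr => p _ /=.
by rewrite mulrA.
Qed.

Lemma elem_noise_gaussian s : elementary s -> centered_gaussian P (elem_noise s).
Proof.
move=> es; have [+ _] := hW.
move=> /(_ (size s) (fun i => (nth (0, set0) s i).1) (fun i => (nth (0, set0) s i).2)).
move=> /(_ (fun i => es i)); congr centered_gaussian.
apply/funext => w; rewrite /elem_noise (big_nth (0, set0)) big_mkord.
by [].
Qed.

Lemma measurable_elem_fun s : elementary s -> measurable_fun setT (elem_fun s).
Proof.
elim: s => [|p s ih] es.
  rewrite (_ : elem_fun _ = cst 0); first exact: measurable_cst.
  by apply/funext => z; rewrite /elem_fun big_nil.
have [mp _ es'] := elementary_cons es.
rewrite (_ : elem_fun _ = fun z => p.1 * \1_(p.2) z + elem_fun s z); last first.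
  by apply/funext => z; rewrite /elem_fun big_cons.
apply: measurable_funD; last exact: ih.
by apply: measurable_funM; [exact: measurable_cst|exact: measurable_indic].
Qed.

Lemma noise_covariance (A B : set (R * R)) : measurable A -> A `<=` S ->
  measurable B -> B `<=` S -> exists v,
  has_int P (fun w => W A w * W B w) v /\
  has_int leb2 (fun z => \1_A z * \1_B z) v.
Proof.
move=> mA AS mB BS.
have sq (C : set (R * R)) : measurable C -> C `<=` S ->
    exists v, has_int P (fun w => W C w ^+ 2) v.
  move=> mC CS.
  have /centered_gaussian_moments[s /(_ 2%N) hs] : centered_gaussian P (W C).
    have [h _] := hW.
    have := h 1%N (fun=> 1) (fun=> C) (fun=> conj mC CS).
    by under [X in centered_gaussian _ X -> _]funext do rewrite big_ord1 mul1r.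
  by eexists; exact: hs.
have [a ha] := sq A mA AS; have [b hb] := sq B mB BS.
have [v hv] := has_int_mul (measurable_funPT (W A)) (measurable_funPT (W B)) ha hb.
exists v; split => //.
have [_ /(_ A B mA AS mB BS)] := hW; rewrite unlock hv.2 => vE.
have -> : (fun z => \1_A z * \1_B z) = (\1_(A `&` B) : R * R -> R).
  by apply/funext => z; rewrite indicI.
apply: ge0_has_int.
- by apply: measurable_indic; exact: measurableI.
- by move=> z; rewrite indicE.
- by rewrite integral_indic ?setIT//; exact: measurableI.
Qed.

(** The Wiener isometry, in bilinear form. *)
Lemma elem_isometry s t : elementary s -> elementary t -> exists v,
  has_int P (fun w => elem_noise s w * elem_noise t w) v /\
  has_int leb2 (fun z => elem_fun s z * elem_fun t z) v.
Proof.
elim: s => [|p s ih] es et.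
  exists 0; split.
    under [X in has_int _ X _]funext do rewrite /elem_noise big_nil mul0r.
    exact: has_int0.
  under [X in has_int _ X _]funext do rewrite /elem_fun big_nil mul0r.
  exact: has_int0.
have [mp pS es'] := elementary_cons es.
have [v [v1 v2]] := ih es' et.
suff [u [u1 u2]] : exists u,
    has_int P (fun w => W p.2 w * elem_noise t w) u /\
    has_int leb2 (fun z => \1_(p.2) z * elem_fun t z) u.
  exists (p.1 * u + v); split.
    under [X in has_int _ X _]funext do
      rewrite /elem_noise big_cons mulrDl -mulrA -/(elem_noise s _) -/(elem_noise t _).
    by apply: has_intD => //; exact: has_intZ.
  under [X in has_int _ X _]funext do
    rewrite /elem_fun big_cons mulrDl -mulrA -/(elem_fun s _) -/(elem_fun t _).
  by apply: has_intD => //; exact: has_intZ.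
elim: t et {v v1 v2 ih} => [|q t ih] et.
  exists 0; split.
    under [X in has_int _ X _]funext do rewrite /elem_noise big_nil mulr0.
    exact: has_int0.
  under [X in has_int _ X _]funext do rewrite /elem_fun big_nil mulr0.
  exact: has_int0.
have [mq qS et'] := elementary_cons et.
have [u [u1 u2]] := ih et'.
have [v [v1 v2]] := noise_covariance mp pS mq qS.
exists (q.1 * v + u); split.
  under [X in has_int _ X _]funext do
    rewrite /elem_noise big_cons mulrDr mulrCA -/(elem_noise t _).
  by apply: has_intD => //; exact: has_intZ.
under [X in has_int _ X _]funext do
  rewrite /elem_fun big_cons mulrDr mulrCA -/(elem_fun t _).
by apply: has_intD => //; exact: has_intZ.
Qed.

(** [X] is a Wiener integral of [g], in a form stable under linear
    combinations. *)
Definition wiener (X : Omega -> R) (g : R * R -> R) : Prop :=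
  [/\ measurable_fun setT X, measurable_fun setT g &
    forall e, 0 < e -> exists s u v,
      [/\ elementary s, u < e, v < e,
        has_int leb2 (fun z => (elem_fun s z - g z) ^+ 2) u &
        has_int P (fun w => (elem_noise s w - X w) ^+ 2) v]].

Lemma wienerB X X' g g' : wiener X g -> wiener X' g' ->
  wiener (fun w => X w - X' w) (fun z => g z - g' z).
Proof.
move=> [mX mg h] [mX' mg' h']; split; [exact: measurable_funB|exact: measurable_funB|].
move=> e e0; have e4 : 0 < e / 4 by rewrite divr_gt0.
have [s [u [v [es ue ve hu hv]]]] := h _ e4.
have [s' [u' [v' [es' ue' ve' hu' hv']]]] := h' _ e4.
have sqD (a b : R) : (a - b) ^+ 2 <= 2 * a ^+ 2 + 2 * b ^+ 2.
  by have := sqr_ge0 (a + b); nra.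
have est := elementary_cat es (elementary_scale (-1) es').
have mN t : elementary t -> measurable_fun setT (elem_noise t).
  by move=> et; have [] := elem_noise_gaussian et.
pose t := s ++ scale_seq (-1) s'.
have [u2 hu2] : exists u2, has_int leb2 (fun z => (elem_fun t z - (g z - g' z)) ^+ 2) u2.
  apply: dominated_has_int (has_intD (has_intZ 2 hu) (has_intZ 2 hu')).
    apply: measurable_funX; apply: measurable_funB; first exact: measurable_elem_fun.
    exact: measurable_funB.
  move=> z; rewrite ger0_norm ?sqr_ge0// /t elem_fun_cat elem_fun_scale.
  rewrite (_ : _ - (_ - _) = (elem_fun s z - g z) - (elem_fun s' z - g' z)); last by ring.
  exact: sqD.
have [v2 hv2] : exists v2, has_int P (fun z => (elem_noise t z - (X z - X' z)) ^+ 2) v2.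
  apply: dominated_has_int (has_intD (has_intZ 2 hv) (has_intZ 2 hv')).
    apply: measurable_funX; apply: measurable_funB; first exact: mN.
    exact: measurable_funB.
  move=> z; rewrite ger0_norm ?sqr_ge0// /t elem_noise_cat elem_noise_scale.
  rewrite (_ : _ - (_ - _) = (elem_noise s z - X z) - (elem_noise s' z - X' z)); last by ring.
  exact: sqD.
exists t, u2, v2; split => //.
- apply: (@le_lt_trans _ _ (2 * u + 2 * u')); last by lra.
  apply: has_int_le hu2 (has_intD (has_intZ 2 hu) (has_intZ 2 hu')) => z.
  rewrite /t elem_fun_cat elem_fun_scale.
  rewrite (_ : _ - (_ - _) = (elem_fun s z - g z) - (elem_fun s' z - g' z)); last by ring.
  exact: sqD.
- apply: (@le_lt_trans _ _ (2 * v + 2 * v')); last by lra.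
  apply: has_int_le hv2 (has_intD (has_intZ 2 hv) (has_intZ 2 hv')) => z.
  rewrite /t elem_noise_cat elem_noise_scale.
  rewrite (_ : _ - (_ - _) = (elem_noise s z - X z) - (elem_noise s' z - X' z)); last by ring.
  exact: sqD.
Qed.

Lemma wiener_integral_wiener (X : {RV P >-> R}) g :
  is_wiener_integral T W g X -> wiener X (g \_ S).
Proof.
move=> [mg [h [gh Xh]]].
have mS := measurable_space_time.
have mgS : measurable_fun setT (g \_ S) by apply/(measurable_restrictT _ mS).
split => // e e0.
pose s n : seq (R * set (R * R)) :=
  [seq (c, S `&` h n @^-1` [set c]) | c <- fset_set (range (h n))].
have es n : elementary (s n).
  move=> k; have [ks|ks] := ltnP k (size (s n)); last by rewrite nth_default//; exact: elementary_default.
  rewrite size_map in ks; rewrite (nth_map 0 _ _ ks); split; last exact: subIsetl.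
  by apply: measurableI => //; exact: measurable_funPTI.
have noiseE n w : elem_noise (s n) w = wiener_sfun T W (h n) w.
  rewrite /elem_noise /wiener_sfun big_map fsbig_finite//=.
have funE n z : elem_fun (s n) z = (h n \_ S) z.
  rewrite /elem_fun big_map patchE; case: ifPn => zS.
    rewrite [RHS]fimfunE fsbig_finite//=; apply: eq_bigr => c _.
    by rewrite indicI/= indicE zS mul1r.
  rewrite big1// => c _; by rewrite indicI/= indicE (negbTE zS) mul0r mulr0.
have /fine_cvgP[fin1 cv1] := gh; have /fine_cvgP[fin2 cv2] := Xh.
have near1 : \forall n \near \oo, fine (\int[leb2]_(z in S) (((h n z - g z) ^+ 2)%R)%:E)%E < e.
  by apply: cvgr_lt cv1 _ _.
have near2 : \forall n \near \oo,
    fine ('E_P[fun w => ((X w - wiener_sfun T W (h n) w) ^+ 2)%R])%E < e.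
  by apply: cvgr_lt cv2 _ _.
near \oo => n.
exists (s n), (fine (\int[leb2]_(z in S) (((h n z - g z) ^+ 2)%R)%:E)%E),
  (fine ('E_P[fun w => ((X w - wiener_sfun T W (h n) w) ^+ 2)%R])%E).
split => //.
- by near: n.
- by near: n.
- apply: ge0_has_int.
  + apply: measurable_funX; apply: measurable_funB => //; exact: measurable_elem_fun.
  + by move=> z; exact: sqr_ge0.
  + rewrite fineK; last by near: n.
    rewrite [RHS]integral_mkcond; apply: eq_integral => z _.
    by rewrite funE !patchE; case: ifPn; rewrite // subrr expr0n.
- apply: ge0_has_int.
  + apply: measurable_funX; apply: measurable_funB => //.
    by have [] := elem_noise_gaussian (es n).
  + by move=> z; exact: sqr_ge0.
  + rewrite fineK; last by near: n.
    rewrite unlock; apply: eq_integral => w _.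
    by rewrite noiseE -sqrrN opprB.
Unshelve. all: by end_near. Qed.

End wiener.

Lemma cvg_sumr (R : realType) (I : Type) (r : seq I) (f : I -> nat -> R) (l : I -> R) :
  (forall i, f i n @[n --> \oo] --> l i) ->
  \sum_(i <- r) f i n @[n --> \oo] --> \sum_(i <- r) l i.
Proof.
move=> fl; elim: r => [|i r ih].
  by under eq_fun do rewrite big_nil; rewrite big_nil; exact: cvg_cst.
by under eq_fun do rewrite big_cons; rewrite big_cons; apply: cvgD.
Qed.

Section wiener_concentration.
Context d (Omega : measurableType d) (R : realType) (P : probability Omega R).
Context (T : R) (W : set (R * R) -> {RV P >-> R}).
Hypothesis hW : white_noise T W.
Local Notation leb2 := (lebesgue2 R).

Lemma elem_noise_gaussian_vector N (s : 'I_N -> seq (R * set (R * R))) (a : 'I_N -> R) :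
  (forall i, elementary T (s i)) -> exists sigma, forall k,
  has_int P (fun w => (\sum_i a i * elem_noise W (s i) w) ^+ k) (gauss_moment R k * sigma ^+ k).
Proof.
move=> es.
pose t := flatten [seq scale_seq (a i) (s i) | i <- enum 'I_N].
have et : elementary T t.
  by apply: elementary_flatten => i; exact: elementary_scale.
have [sigma hs] := centered_gaussian_moments (elem_noise_gaussian hW et).
exists sigma => k; have := hs k; congr (has_int P _ _).
apply/funext => w; congr (_ ^+ _); rewrite /t /elem_noise big_flatten big_map/= big_enum/=.
by apply: eq_bigr => i _; exact: elem_noise_scale.
Qed.

Lemma sum_half_le (m : nat) : \sum_(k < m) (2^-1 : R) ^+ k.+1 <= 1.
Proof.
suff -> : \sum_(k < m) (2^-1 : R) ^+ k.+1 = 1 - 2^-1 ^+ m.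
  by rewrite gerBl exprn_ge0.
elim: m => [|m ih]; first by rewrite big_ord0 expr0 subrr.
by rewrite big_ord_recr/= ih !exprS; field.
Qed.

(** The concentration bound for elementary integrals passes to the limit by
    Fatou's lemma along an almost surely convergent approximation.  The factors 2
    leave room for the covariances of the approximations, which only converge to
    [c]. *)
Lemma wiener_concentration N (X : 'I_N -> Omega -> R) (g : 'I_N -> R * R -> R)
    (c : 'I_N -> 'I_N -> R) (L V : R) :
  0 < L -> 0 < V -> (forall i, wiener T W (X i) (g i)) ->
  (forall i j, has_int leb2 (fun z => g i z * g j z) (c i j)) ->
  (forall i, \sum_j `|c i j| <= L) -> (forall i, c i i <= V) ->
  exists2 u, has_int P (fun w => (\sum_i X i w ^+ 4 - \sum_i 3 * c i i ^+ 2) ^+ 4) u &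
    u <= 768 * gauss_moment R 12 * ((2 * L) ^+ 2 * N%:R ^+ 2 * (2 * V) ^+ 6).
Proof.
move=> L0 V0 hX hc cL cV.
have mX i : measurable_fun setT (X i) by have [] := hX i.
have mg i : measurable_fun setT (g i) by have [] := hX i.
have : forall p : 'I_N * nat, exists q : seq (R * set (R * R)) * (R * R),
    [/\ elementary T q.1, q.2.1 < 2^-1 ^+ p.2.+1, q.2.2 < 2^-1 ^+ p.2.+1,
     has_int leb2 (fun z => (elem_fun q.1 z - g p.1 z) ^+ 2) q.2.1 &
     has_int P (fun w => (elem_noise W q.1 w - X p.1 w) ^+ 2) q.2.2].
  move=> [i n] /=; have [_ _] := hX i.
  have e0 : 0 < (2^-1 : R) ^+ n.+1 by rewrite exprn_gt0.
  by move=> /(_ _ e0)[s [u [v h]]]; exists (s, (u, v)).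
move=> /choice[q hq].
pose s n i := (q (i, n)).1; pose u n i := (q (i, n)).2.1; pose v n i := (q (i, n)).2.2.
have es n i : elementary T (s n i) by have [] := hq (i, n).
have hu n i : has_int leb2 (fun z => (elem_fun (s n i) z - g i z) ^+ 2) (u n i).
  by have [] := hq (i, n).
have hv n i : has_int P (fun w => (elem_noise W (s n i) w - X i w) ^+ 2) (v n i).
  by have [] := hq (i, n).
have ule n i : u n i <= 2^-1 ^+ n.+1 by have [_ /ltW] := hq (i, n).
have vle n i : v n i <= 2^-1 ^+ n.+1 by have [_ _ /ltW] := hq (i, n).
have u0 i : u n i @[n --> \oo] --> 0.
  have half0 : (2^-1 : R) ^+ n.+1 @[n --> \oo] --> 0.
    by rewrite (cvg_shiftS (fun n => (2^-1 : R) ^+ n)); apply: cvg_expr; rewrite ger0_norm ?invf_lt1 ?ltr1n.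
  apply: (squeeze_cvgr _ (cvg_cst 0) half0); apply: nearW => n /=.
  by rewrite ule andbT; apply: has_int_ge0 (hu n i) => z; exact: sqr_ge0.
have : forall p : nat * ('I_N * 'I_N), exists cn : R,
   has_int P (fun w => elem_noise W (s p.1 p.2.1) w * elem_noise W (s p.1 p.2.2) w) cn /\
   has_int leb2 (fun z => elem_fun (s p.1 p.2.1) z * elem_fun (s p.1 p.2.2) z) cn.
  by move=> [n [i j]]; apply: (elem_isometry hW).
move=> /choice[C hC].
pose cn n i j := C (n, (i, j)).
have hcc i : has_int leb2 (fun z => g i z ^+ 2) (c i i).
  by under [X in has_int _ X _]funext do rewrite expr2; exact: hc.
have cnc i j : cn n i j @[n --> \oo] --> c i j.
  apply: (@has_int_cvg _ _ _ leb2 (fun n => elem_fun (s n i)) (fun n => elem_fun (s n j))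
    (g i) (g j) (u^~ i) (u^~ j) (fun n => cn n i j) (c i i) (c j j)) => //.
  - by move=> n; exact: measurable_elem_fun.
  - by move=> n; exact: measurable_elem_fun.
  - exact: mg.
  - exact: mg.
  - by move=> n; have [] := hC (n, (i, j)).
have sumc i : \sum_j `|cn n i j| @[n --> \oo] --> \sum_j `|c i j|.
  by apply: cvg_sumr => j; apply: cvg_norm; exact: cnc.
have near_ok : \forall n \near \oo, forall i,
    \sum_j `|cn n i j| <= 2 * L /\ cn n i i <= 2 * V.
  apply: filter_forall => i.
  have h1 : \forall n \near \oo, \sum_j `|cn n i j| <= 2 * L.
    by apply: cvgr_le (sumc i) _ _; have := cL i; lra.
  have h2 : \forall n \near \oo, cn n i i <= 2 * V.
    by apply: cvgr_le (cnc i i) _ _; have := cV i; lra.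
  by near=> n; split; near: n.
have [n0 _ n0ok] := near_ok.
pose m n := (n + n0)%N.
have ok n i : \sum_j `|cn (m n) i j| <= 2 * L /\ cn (m n) i i <= 2 * V.
  by apply: n0ok; rewrite /m/= leq_addl.
pose F n w := (\sum_i elem_noise W (s (m n) i) w ^+ 4 - \sum_i 3 * cn (m n) i i ^+ 2) ^+ 4.
have hF n : exists y, has_int P (F n) y /\
    y <= 768 * gauss_moment R 12 * ((2 * L) ^+ 2 * N%:R ^+ 2 * (2 * V) ^+ 6).
  apply: (@quartic_concentration _ _ _ P N (fun i => elem_noise W (s (m n) i)) (cn (m n))).
  - by move=> a; exact: elem_noise_gaussian_vector.
  - by move=> i j; have [] := hC (m n, (i, j)).
  - by move=> i; have [] := ok n i.
  - by move=> i; have [] := ok n i.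
have /choice[y hy] := hF.
apply: (@fatou_has_int _ _ _ P F _ y).
- by move=> n w; rewrite exprn_even_ge0.
- by move=> n; have [] := hy n.
- by move=> n; have [] := hy n.
- apply: measurable_funX; apply: measurable_funB; last exact: measurable_cst.
  by apply: measurable_sum => i; exact: measurable_funX.
- have aeX i : {ae P, forall w, (elem_noise W (s n i) w - X i w) ^+ 2 @[n --> \oo] --> 0}.
    apply: (@ae_cvg0_summable _ _ _ P _ (v^~ i) 1) => [n w|n|n].
    + exact: sqr_ge0.
    + exact: hv.
    + apply: le_trans (sum_half_le n); apply: ler_sum => k _; exact: vle.
  have : {ae P, forall w, forall i, (elem_noise W (s n i) w - X i w) ^+ 2 @[n --> \oo] --> 0}.
    exact: filter_forall.
  apply: filterS => w hw.
  have cw i : elem_noise W (s (m n) i) w @[n --> \oo] --> X i w.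
    rewrite (cvg_shiftn n0 (fun n => elem_noise W (s n i) w)).
    apply/subr_cvg0; apply: norm_cvg0.
    under eq_fun do rewrite -sqrtr_sqr.
    rewrite -(sqrtr0 R); apply: (cvg_comp _ _ (hw i)); exact: sqrt_continuous.
  have cX (f : nat -> R) (l : R) k : f n @[n --> \oo] --> l -> f n ^+ k @[n --> \oo] --> l ^+ k.
    by move=> fl; apply: (@cvg_comp _ _ _ f (fun x => x ^+ k) _ _ _ fl); exact: exprn_continuous.
  apply: (cX); apply: cvgB; apply: cvg_sumr => i; first exact: (cX).
  apply: cvgM; first exact: cvg_cst.
  by apply: (cX); rewrite (cvg_shiftn n0 (fun n => cn n i i)).
- by move=> w; rewrite exprn_even_ge0.
Unshelve. all: by end_near. Qed.

End wiener_concentration.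

(** * The periodic heat kernel *)

Section integer_series.
Context (R : realType).

(** The enumeration 0, 1, -1, 2, -2, ... *)
Definition int_enum (n : nat) : int :=
  if odd n then Posz n./2.+1 else - (Posz n./2).

Let int_rank (k : int) : nat :=
  match k with Posz 0 => 0 | Posz n.+1 => n.*2.+1 | Negz n => n.+1.*2 end%N.

Let int_enumK : cancel int_enum int_rank.
Proof.
move=> n; rewrite /int_enum; case: ifPn => on /=.
  by rewrite -[RHS](odd_double_half n) on.
rewrite -[RHS](odd_double_half n) (negbTE on) add0n.
by case: (n./2).
Qed.

Let int_rankK : cancel int_rank int_enum.
Proof.
case=> [[|n]|n]; rewrite /int_rank /int_enum//=.
  by rewrite odd_double/= uphalf_double.
by rewrite odd_double/= half_double NegzE.
Qed.

Lemma int_enum_bij : bijective int_enum.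
Proof. by exists int_rank; [exact: int_enumK|exact: int_rankK]. Qed.

Lemma esum_int (f : int -> \bar R) : (forall k, 0 <= f k)%E ->
  (\esum_(k in [set: int]) f k = \sum_(n <oo) f (int_enum n))%E.
Proof.
move=> f0; rewrite nneseries_esumT//.
apply: (reindex_esum [set: nat] [set: int] int_enum) => //.
by rewrite setTT_bijective; exact: int_enum_bij.
Qed.

Lemma int_series_shift (f : int -> \bar R) (k : int) : (forall k, 0 <= f k)%E ->
  (\sum_(n <oo) f (int_enum n + k)%R = \sum_(n <oo) f (int_enum n))%E.
Proof.
move=> f0; rewrite -(esum_int (f := fun j => f (j + k)%R))// -esum_int//.
apply/esym/(reindex_esum [set: int] [set: int] (fun j => j + k)) => //.
rewrite setTT_bijective; exists (fun j => j - k) => j.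
  by rewrite addrK.
by rewrite subrK.
Qed.

Lemma int_enum_norm n : (n.+1%:R / 2 : R) <= `|(int_enum n.+1)%:~R|.
Proof.
rewrite /int_enum ler_pdivrMr//; case: ifPn => on.
  rewrite -pmulrn ger0_norm// -natrM ler_nat; lia.
rewrite mulrNz normrN -pmulrn ger0_norm// -natrM ler_nat; lia.
Qed.

Lemma int_enum_norm_ge1 n : (1 : R) <= `|(int_enum n.+1)%:~R|.
Proof.
rewrite /int_enum; case: ifPn => on.
  rewrite -pmulrn ger0_norm// ler1n; lia.
rewrite mulrNz normrN -pmulrn ger0_norm// ler1n; lia.
Qed.

End integer_series.

Section heat_kernel.
Context (R : realType).
Notation leb := (@lebesgue_measure R).
Implicit Types (t x y z u v : R).

Definition gauss_kernel t z : R :=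
  (Num.sqrt (4 * pi * t))^-1 * expR (- z ^+ 2 / (4 * t)).

Lemma heat_kernelE t x :
  heat_kernel t x = fine (\sum_(n <oo) (gauss_kernel t (x - (int_enum n)%:~R))%:E)%E.
Proof.
rewrite /heat_kernel (esum_int (f := fun k => (gauss_kernel t (x - k%:~R))%:E))//.
by move=> k; rewrite lee_fin mulr_ge0 ?expR_ge0// invr_ge0.
Qed.

Lemma gauss_kernel_ge0 t z : 0 <= gauss_kernel t z.
Proof. by rewrite mulr_ge0 ?expR_ge0// invr_ge0. Qed.

Lemma gauss_kernelN t z : gauss_kernel t (- z) = gauss_kernel t z.
Proof. by rewrite /gauss_kernel sqrrN. Qed.

Lemma continuous_gauss_kernel t : continuous (gauss_kernel t).
Proof.
move=> z; apply: cvgM; first exact: cvg_cst.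
apply: (cvg_comp _ expR); last exact: continuous_expR.
apply: cvgM; last exact: cvg_cst.
by apply: cvgN; exact: exprn_continuous.
Qed.

(** Completing the square. *)
Lemma gauss_kernelM a b z u v : 0 < a -> 0 < b ->
  gauss_kernel a (z - u) * gauss_kernel b (z - v) =
  gauss_kernel (a + b) (u - v) *
    normal_pdf ((u * b + v * a) / (a + b)) (Num.sqrt (2 * a * b / (a + b))) z.
Proof.
move=> a0 b0; have ab0 : 0 < a + b by rewrite addr_gt0.
have s20 : 0 < 2 * a * b / (a + b) by rewrite divr_gt0// !mulr_gt0.
have an0 : a != 0 by rewrite gt_eqF.
have bn0 : b != 0 by rewrite gt_eqF.
have abn0 : a + b != 0 by rewrite gt_eqF.
rewrite normal_pdfE; last by rewrite gt_eqF// sqrtr_gt0.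
rewrite /gauss_kernel /normal_peak /normal_fun sqr_sqrtr; last exact: ltW.
rewrite mulrACA -expRD [RHS]mulrACA -expRD; congr (_ * expR _).
  rewrite -!invfM; congr (_^-1); rewrite -!sqrtrM ?mulr_ge0 ?pi_ge0 ?ltW//.
  congr Num.sqrt; rewrite -mulr_natr; field; exact: abn0.
by rewrite -mulr_natr; field; rewrite an0 bn0 abn0.
Qed.

Lemma integral_gauss_kernelM a b u v : 0 < a -> 0 < b ->
  (\int[leb]_z (gauss_kernel a (z - u) * gauss_kernel b (z - v))%:E =
   (gauss_kernel (a + b) (u - v))%:E)%E.
Proof.
move=> a0 b0; under eq_integral do rewrite gauss_kernelM// EFinM.
rewrite integralZl//; last exact: integrable_normal_pdf.
by rewrite integral_normal_pdf mule1.
Qed.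

Lemma integral_gauss_kernel a u : 0 < a ->
  (\int[leb]_z (gauss_kernel a (z - u))%:E = 1)%E.
Proof.
move=> a0; have s0 : 0 < Num.sqrt (2 * a) by rewrite sqrtr_gt0 mulr_gt0.
rewrite -(integral_normal_pdf u (Num.sqrt (2 * a))).
apply: eq_integral => z _; rewrite normal_pdfE ?gt_eqF//.
rewrite /gauss_kernel /normal_peak /normal_fun sqr_sqrtr ?mulr_ge0 ?ltW//.
congr (_ * expR _)%:E; first by congr (Num.sqrt _)^-1; rewrite -mulr_natr; ring.
by rewrite -mulr_natr; congr (_ / _); ring.
Qed.

Lemma integral_translate (F : R -> R) (k : R) : continuous F ->
  (\int[leb]_(z in `[k, (k + 1)%R[) (F z)%:E = \int[leb]_(y in `[0%R, 1%R[) (F (y + k)%R)%:E)%E.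
Proof.
move=> cF.
have cFk : continuous (fun y => F (y + k)).
  move=> y; apply: (@cvg_comp _ _ _ (fun y => y + k) F); last exact: cF.
  by apply: cvgD; [exact: cvg_id|exact: cvg_cst].
rewrite !integral_itv_bndo_bndc; last 2 first.
- apply/measurable_EFinP/measurable_funTS; exact: continuous_measurable_fun.
- apply/measurable_EFinP/measurable_funTS; exact: continuous_measurable_fun.
pose S (y : R) := y + k.
have dS (y : R) : is_derive y 1 S 1.
  by apply: is_derive_eq; rewrite addr0.
have S'E : derive1 S = cst 1 by apply/funext => y; rewrite derive1E; have [] := dS y.
have cS : continuous S.
  by move=> y; apply: cvgD; [exact: cvg_id|exact: cvg_cst].
have dLR : derivable_oo_LRcontinuous S 0 1.
  split; last 2 first.
  - by apply: cvg_at_right_filter; exact: cS.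
  - by apply: cvg_at_left_filter; exact: cS.
  by move=> y _; have [] := dS y.
have S0 : S 0 = k by rewrite /S add0r.
have S1 : S 1 = k + 1 by rewrite /S addrC.
have := @integration_by_substitution_increasing R S F 0 1 ler01.
rewrite S'E S0 S1 => ->.
- by apply: eq_integral => y _; rewrite /= /S mulr1.
- by move=> x y _ _ xy; rewrite ltrD2r.
- by move=> x _; exact: cvg_cst.
- exact: is_cvg_cst.
- exact: is_cvg_cst.
- exact: dLR.
- exact: continuous_subspaceT.
Qed.

(** The line is the disjoint union of the integer translates of the torus. *)
Lemma integral_unfold (F : R -> R) : continuous F -> (forall z, 0 <= F z) ->
  (\int[leb]_z (F z)%:E =
   \sum_(n <oo) \int[leb]_(y in `[0%R, 1%R[) (F (y + (int_enum n)%:~R)%R)%:E)%E.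
Proof.
move=> cF F0; pose I n : set R := `[(int_enum n)%:~R, (int_enum n)%:~R + 1[%classic.
have IT : [set: R] = \bigcup_n I n.
  apply/esym; rewrite -subTset => z _.
  have [rk _ rkK] := int_enum_bij; have nE := rkK (Num.floor z).
  exists (rk (Num.floor z)) => //; rewrite /I nE /= in_itv/= floor_le/=.
  by have := floorD1_gt z; rewrite intrD.
rewrite IT ge0_integral_bigcup//.
- by apply: eq_eseriesr => n _; exact: integral_translate.
- by move=> n; exact: measurable_itv.
- apply/measurable_EFinP; rewrite -IT; exact: continuous_measurable_fun.
- by move=> x _; rewrite lee_fin.
- apply/trivIsetP => i j _ _ ij; apply/seteqP; split => // z [].
  rewrite /I /= !in_itv/= => /andP[a b] /andP[c e].
  have : int_enum i = int_enum j.
    have h k : k%:~R <= z -> z < k%:~R + 1 -> k = Num.floor z.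
      move=> h1 h2; apply/esym/floor_def; rewrite h1/= intrD; exact: h2.
    by rewrite (h (int_enum i))// (h (int_enum j)).
  by move=> /(bij_inj int_enum_bij) /eqP; rewrite (negbTE ij).
Qed.

End heat_kernel.

Section torus.
Context (R : realType).
Notation leb := (@lebesgue_measure R).
Local Open Scope ereal_scope.
Implicit Types (a b x y z : R).

Lemma measurable_torus : measurable (torus R : set (measurableTypeR R)).
Proof. exact: measurable_itv. Qed.

(** The periodic heat kernel before truncation to the reals, a form in which sums
    and integrals commute unconditionally. *)
Definition periodic_kernel a z : \bar R :=
  \sum_(n <oo) (gauss_kernel a (z - (int_enum n)%:~R))%:E.

Let gk0 a z : 0 <= (gauss_kernel a z)%:E.
Proof. by rewrite lee_fin gauss_kernel_ge0. Qed.

Lemma periodic_kernel_ge0 a z : 0 <= periodic_kernel a z.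
Proof. by apply: nneseries_ge0 => n _ _; exact: gk0. Qed.

Let cgk a x k : continuous (fun y => gauss_kernel a (x - y - k)%R).
Proof.
move=> y; apply: (@cvg_comp _ _ _ (fun y => x - y - k)%R (gauss_kernel a)).
  by apply: cvgB; [apply: cvgB; [exact: cvg_cst|exact: cvg_id]|exact: cvg_cst].
exact: continuous_gauss_kernel.
Qed.

Let mgk a x k (D : set R) : measurable_fun D (fun y => (gauss_kernel a (x - y - k)%R)%:E).
Proof.
apply/measurable_EFinP/measurable_funTS; apply: continuous_measurable_fun.
exact: cgk.
Qed.

Lemma measurable_periodic_kernel a x (D : set R) :
  measurable_fun D (fun y => periodic_kernel a (x - y)).
Proof.
apply: (@ge0_emeasurable_sum _ _ _ D
  (fun n y => (gauss_kernel a (x - y - (int_enum n)%:~R)%R)%:E) xpredT).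
  by move=> n y _ _; exact: gk0.
by move=> n _; exact: mgk.
Qed.

Lemma integral_periodic_kernel a x : (0 < a)%R ->
  \int[leb]_(y in torus R) periodic_kernel a (x - y) = 1.
Proof.
move=> a0; have mtor := measurable_torus.
rewrite integral_nneseries//; last by move=> n; exact: mgk.
transitivity (\int[leb]_z (gauss_kernel a (x - z - 0)%R)%:E); last first.
  rewrite -(integral_gauss_kernel x a0); apply: eq_integral => z _.
  by rewrite subr0 -gauss_kernelN opprB.
rewrite (@integral_unfold _ (fun z => gauss_kernel a (x - z - 0)%R)); last 2 first.
- exact: cgk.
- by move=> z; exact: gauss_kernel_ge0.
apply: eq_eseriesr => n _; apply: eq_integral => y _.
by rewrite subr0 opprD addrA.
Qed.

(** The sum has integral one over the torus, hence is finite almost everywhere. *)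
Lemma heat_kernel_ae a x : (0 < a)%R ->
  {ae leb, forall y, torus R y -> (heat_kernel a (x - y))%:E = periodic_kernel a (x - y)}.
Proof.
move=> a0.
have mtor := measurable_torus.
have ip : leb.-integrable (torus R) (fun y => periodic_kernel a (x - y)).
  apply/integrableP; split; first exact: measurable_periodic_kernel.
  under eq_integral do rewrite gee0_abs ?periodic_kernel_ge0//.
  by rewrite integral_periodic_kernel// ltry.
have := integrable_ae mtor ip; apply: filterS => y fy ty.
by rewrite heat_kernelE fineK//; exact: fy.
Qed.

(** Semigroup property on the diagonal of the torus: the double sum is regrouped
    by the difference of the two indices, and the sum over the remaining index
    unfolds the torus into the line, where Gaussian kernels convolve. *)
Lemma torus_convolution a b x : (0 < a)%R -> (0 < b)%R ->
  \int[leb]_(y in torus R) (heat_kernel a (x - y) * heat_kernel b (x - y))%:E =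
  \sum_(n <oo) (gauss_kernel (a + b) (int_enum n)%:~R)%:E.
Proof.
move=> a0 b0.
have mtor := measurable_torus.
pose A m n y := (gauss_kernel a (x - y - (int_enum n)%:~R)%R *
  gauss_kernel b (x - y - (int_enum n)%:~R - (int_enum m)%:~R)%R)%:E.
have A0 m n y : 0 <= A m n y by rewrite lee_fin mulr_ge0 ?gauss_kernel_ge0.
have mA m n D : measurable_fun D (A m n).
  apply/measurable_EFinP/measurable_funM; first by apply/measurable_EFinP; exact: mgk.
  apply/measurable_funTS; apply: continuous_measurable_fun => y.
  rewrite (_ : (fun y => _) = (fun y => gauss_kernel b
    (x - y - ((int_enum n)%:~R + (int_enum m)%:~R))))%R; first exact: cgk.
  by apply/funext => z; rewrite opprD addrA.
have mSA m D : measurable_fun D (fun y => \sum_(n <oo) A m n y).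
  by apply: (@ge0_emeasurable_sum _ _ _ D (A m) xpredT).
rewrite (@ge0_ae_eq_integral _ _ _ leb (torus R) _
    (fun y => \sum_(m <oo) \sum_(n <oo) A m n y)) //; last 5 first.
- have mhk c : (0 < c)%R -> measurable_fun (torus R) (fun y => heat_kernel c (x - y)).
    move=> c0; under eq_fun do rewrite heat_kernelE -/(periodic_kernel _ _).
    apply: (@measurableT_comp _ _ _ _ _ _ fine); first exact: fine_measurable.
    exact: measurable_periodic_kernel.
  by apply/measurable_EFinP/measurable_funM; exact: mhk.
- by apply: (@ge0_emeasurable_sum _ _ _ _ (fun m y => \sum_(n <oo) A m n y) xpredT) => // m y _ _;
    apply: nneseries_ge0 => n _ _; exact: A0.
- move=> y _; rewrite lee_fin !heat_kernelE mulr_ge0// fine_ge0//; exact: (periodic_kernel_ge0 _ (x - y)).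
- by move=> y _; apply: nneseries_ge0 => m _ _; apply: nneseries_ge0 => n _ _; exact: A0.
- apply: ae_imply2 (heat_kernel_ae x a0) (heat_kernel_ae x b0) _ => y ha hb ty.
  rewrite nneseries_interchange//.
  rewrite EFinM ha// muleC {1}/periodic_kernel -nneseriesZl//.
  apply: eq_eseriesr => n _; rewrite hb// /periodic_kernel.
  rewrite -(@int_series_shift _ (fun k => (gauss_kernel b (x - y - k%:~R))%:E) (int_enum n))//.
  rewrite muleC -nneseriesZl//; apply: eq_eseriesr => m _.
  by rewrite /A EFinM intrD opprD addrA (addrAC _ (- (int_enum m)%:~R)%R).
rewrite integral_nneseries//; last first.
  by move=> m y _; apply: nneseries_ge0 => n _ _; exact: A0.
  by move=> m; exact: mSA.
apply: eq_eseriesr => m _; rewrite integral_nneseries//; last by move=> n; exact: mA.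
pose F z := (gauss_kernel a (x - z - 0)%R * gauss_kernel b (x - z - (int_enum m)%:~R)%R)%R.
have -> : \sum_(n <oo) \int[leb]_(y in torus R) A m n y =
    \sum_(n <oo) \int[leb]_(y in `[0%R, 1%R[) (F (y + (int_enum n)%:~R)%R)%:E.
  apply: eq_eseriesr => n _; apply: eq_integral => y _.
  by rewrite /F /A subr0 opprD !addrA.
rewrite -integral_unfold; last 2 first.
- by move=> z; apply: cvgM; exact: cgk.
- by move=> z; rewrite mulr_ge0 ?gauss_kernel_ge0.
have mE : (int_enum m)%:~R = (x - (x - (int_enum m)%:~R))%R :> R by ring.
transitivity (gauss_kernel (a + b) (x - (x - (int_enum m)%:~R)))%:E; last by rewrite -mE.
rewrite -integral_gauss_kernelM//; apply: eq_integral => z _.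
rewrite /F subr0 -(gauss_kernelN a) -(gauss_kernelN b).
by congr ((gauss_kernel a _ * gauss_kernel b _)%R%:E); ring.
Qed.

End torus.

(** * The heat kernel on the diagonal: singular part and Lipschitz remainder *)

Section diagonal.
Context (R : realType).
Implicit Types (w z : R).

Lemma lipschitz_derive (f df : R -> R) (a b C : R) : a <= b ->
  (forall x, a <= x <= b -> is_derive x 1 f (df x)) ->
  (forall x, a <= x <= b -> `|df x| <= C) -> `|f b - f a| <= C * (b - a).
Proof.
move=> ab dfd dfC.
have cf : {within `[a, b], continuous f}.
  apply: derivable_within_continuous => x; rewrite in_itv/= => xab.
  by have [] := dfd x xab.
have [|c] := @MVT_segment R f df a b ab _ cf.
  move=> x; rewrite in_itv/= => /andP[ax xb]; apply: dfd.
  by rewrite !ltW.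
rewrite in_itv/= => cab ->; rewrite normrM (ger0_norm (_ : 0 <= b - a)) ?subr_ge0//.
by rewrite ler_wpM2r ?subr_ge0// dfC.
Qed.

Lemma expRN_le_term (q : R) k : 0 <= q -> q ^+ k * expR (- q) <= k`!%:R.
Proof.
by move=> q0; rewrite expRN ler_pdivrMr ?expR_gt0//; exact: expR_ge_term.
Qed.

Lemma gauss_kernel_neg w z : w <= 0 -> gauss_kernel w z = 0.
Proof.
move=> w0; rewrite /gauss_kernel ler0_sqrtr ?invr0 ?mul0r//.
by rewrite mulr_ge0_le0// mulr_ge0// pi_ge0.
Qed.

Let q_ z w := z ^+ 2 / (4 * w).

(** The scaling variable [q = z ^+ 2 / (4 * w)] bounds the kernel and its time
    derivative uniformly down to time zero, away from the origin. *)
Lemma gauss_kernel_le w z : 0 < w -> z != 0 ->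
  gauss_kernel w z <= (1 + q_ z w) * expR (- q_ z w) / `|z|.
Proof.
move=> w0 z0; rewrite /gauss_kernel mulNr -/(q_ z w) [leRHS]mulrAC.
rewrite ler_wpM2r ?expR_ge0//.
have q0 : 0 <= q_ z w by rewrite divr_ge0 ?sqr_ge0// mulr_ge0 ?ltW.
have zn : 0 < `|z| by rewrite normr_gt0.
rewrite ler_pdivlMr//.
have pw : 0 < 4 * pi * w by rewrite !mulr_gt0// pi_gt0.
have -> : (Num.sqrt (4 * pi * w))^-1 * `|z| = Num.sqrt (q_ z w / pi).
  rewrite -sqrtr_sqr -sqrtrV ?ltW// -sqrtrM ?invr_ge0 ?ltW//; congr Num.sqrt.
  have pn0 : (pi : R) != 0 by rewrite gt_eqF// pi_gt0.
  have wn0 : w != 0 by rewrite gt_eqF.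
  rewrite /q_; move: (pi : R) pn0 => p pn0.
  by field; rewrite pn0 wn0.
have pi1 : 1 <= (pi : R) by have := pi_ge2 R; lra.
rewrite -[leRHS]ger0_norm; last by rewrite addr_ge0.
rewrite -sqrtr_sqr ler_wsqrtr//.
apply: (@le_trans _ _ (q_ z w)); first by rewrite ler_pdivrMr ?pi_gt0// ler_peMr.
nra.
Qed.

(** The time derivative of the Gaussian kernel. *)
Let dgk w z := gauss_kernel w z * (q_ z w / w - (2 * w)^-1).

Lemma is_derive_gauss_kernel w z : 0 < w ->
  is_derive w 1 (fun v => gauss_kernel v z) (dgk w z).
Proof.
move=> w0.
have pw : 0 < 4 * pi * w by rewrite !mulr_gt0// pi_gt0.
have spw : Num.sqrt (4 * pi * w) != 0 by rewrite gt_eqF// sqrtr_gt0.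
have wn0 : w != 0 by rewrite gt_eqF.
have pn0 : (pi : R) != 0 by rewrite gt_eqF// pi_gt0.
have d1 : is_derive w 1 (fun v => Num.sqrt (4 * pi * v)) ((2 * Num.sqrt (4 * pi * w))^-1 * (4 * pi)).
  have h := is_derive1_sqrt pw.
  have g : is_derive w 1 (fun v => 4 * pi * v) (4 * pi).
    by apply: is_derive_eq; rewrite /GRing.scale/= mulr1.
  exact: (is_derive1_comp (f := Num.sqrt) (g := fun v => 4 * pi * v)).
have d2 := is_deriveV (f := fun v => Num.sqrt (4 * pi * v)) spw d1.
have d3 : is_derive w 1 (fun v => - z ^+ 2 / (4 * v)) (q_ z w / w).
  have g : is_derive w 1 (fun v => 4 * v) 4.
    by apply: is_derive_eq; rewrite /GRing.scale/= mulr1.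
  have h4 : 4 * w != 0 by rewrite mulf_neq0.
  have gV := is_deriveV (f := fun v => 4 * v) h4 g.
  apply: (is_derive_eq (is_deriveZ (- z ^+ 2) gV)).
  by rewrite /GRing.scale/= /q_; field.
have d4 : is_derive w 1 (fun v => expR (- z ^+ 2 / (4 * v)))
    (expR (- z ^+ 2 / (4 * w)) * (q_ z w / w)).
  exact: (is_derive1_comp (f := expR) (g := fun v => - z ^+ 2 / (4 * v))).
apply: (is_derive_eq (is_deriveM d2 d4)).
rewrite /dgk /gauss_kernel /GRing.scale/= invfM.
set E := expR _; set r := Num.sqrt _.
have r2 : r ^- 2 = (4 * pi * w)^-1 by rewrite -exprVn exprVn sqr_sqrtr ?ltW.
have rn0 : r != 0 := spw.
rewrite r2; move: E r rn0 {r2} (pi : R) pn0 => E r rn0 p pn0.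
by field; rewrite wn0 rn0 pn0.
Qed.

(** The constant is [2 * 1`! + 6 * 2`! + 4 * 3`!], from the bounds
    [q ^+ k * expR (- q) <= k`!]. *)
Lemma dgk_le w z : 0 < w -> 1 <= `|z| -> `|dgk w z| <= 38 / z ^+ 2.
Proof.
move=> w0 z1; have z0 : z != 0 by rewrite -normr_gt0 (lt_le_trans _ z1).
have zz : 0 < z ^+ 2 by rewrite exprn_even_gt0.
set q := q_ z w.
have q0 : 0 < q by rewrite divr_gt0// mulr_gt0.
have wE : w = z ^+ 2 / (4 * q).
  rewrite /q /q_; field; by rewrite z0 gt_eqF.
have nrm : `|q / w - (2 * w)^-1| <= (4 * q ^+ 2 + 2 * q) / z ^+ 2.
  have -> : q / w - (2 * w)^-1 = (4 * q ^+ 2 - 2 * q) / z ^+ 2.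
    by rewrite {1 2}wE; field; rewrite z0 gt_eqF.
  have zi : 0 <= (z ^+ 2)^-1 by rewrite invr_ge0 ltW.
  rewrite normrM (ger0_norm zi); apply: ler_wpM2r => //.
  by rewrite ler_norml; apply/andP; split; nra.
rewrite /dgk normrM ger0_norm ?gauss_kernel_ge0//.
apply: (@le_trans _ _ ((1 + q) * expR (- q) * ((4 * q ^+ 2 + 2 * q) / z ^+ 2))).
  apply: ler_pM => //; first exact: gauss_kernel_ge0.
  apply: le_trans (gauss_kernel_le w0 z0) _; rewrite -/q.
  by rewrite ler_pdivrMr ?normr_gt0// ler_peMr// mulr_ge0 ?expR_ge0// addr_ge0 ?ltW.
rewrite mulrA; apply: ler_wpM2r; first by rewrite invr_ge0 ltW.
have e1 := expRN_le_term 1 (ltW q0); have e2 := expRN_le_term 2 (ltW q0).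
have e3 := expRN_le_term 3 (ltW q0).
rewrite expr1 in e1.
have -> : (1 + q) * expR (- q) * (4 * q ^+ 2 + 2 * q) =
  2 * (q * expR (- q)) + 6 * (q ^+ 2 * expR (- q)) + 4 * (q ^+ 3 * expR (- q)) by ring.
have f1 : (1`!%:R : R) = 1 by [].
have f2 : (2`!%:R : R) = 2 by [].
have f3 : (3`!%:R : R) = 6 by congr (_%:R).
rewrite f1 in e1; rewrite f2 in e2; rewrite f3 in e3; lra.
Qed.

Lemma gauss_kernel_le_time w z : 0 <= w -> 1 <= `|z| ->
  gauss_kernel w z <= 38 / z ^+ 2 * w.
Proof.
rewrite le_eqVlt => /predU1P[<- z1|w0 z1]; first by rewrite gauss_kernel_neg// mulr0.
have z0 : z != 0 by rewrite -normr_gt0 (lt_le_trans _ z1).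
have zz : 0 < z ^+ 2 by rewrite exprn_even_gt0.
set q := q_ z w.
have q0 : 0 < q by rewrite divr_gt0// mulr_gt0.
have wE : w = z ^+ 2 / (4 * q).
  rewrite /q /q_; field; by rewrite z0 gt_eqF.
apply: (@le_trans _ _ ((1 + q) * expR (- q))).
  apply: le_trans (gauss_kernel_le w0 z0) _; rewrite -/q.
  by rewrite ler_pdivrMr ?normr_gt0// ler_peMr// mulr_ge0 ?expR_ge0// addr_ge0 ?ltW.
have -> : 38 / z ^+ 2 * w = 38 / 4 / q by rewrite wE; field; rewrite z0 gt_eqF.
rewrite ler_pdivlMr//.
have e1 := expRN_le_term 1 (ltW q0); have e2 := expRN_le_term 2 (ltW q0).
rewrite expr1 in e1.
have -> : (1 + q) * expR (- q) * q = q * expR (- q) + q ^+ 2 * expR (- q) by ring.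
have f1 : (1`!%:R : R) = 1 by [].
have f2 : (2`!%:R : R) = 2 by [].
rewrite f1 in e1; rewrite f2 in e2; lra.
Qed.

(** The kernel vanishes at nonpositive times, so that the bound holds across time
    zero; its constant is summable over the non-zero integers. *)
Lemma gauss_kernel_lipschitz w v z : 1 <= `|z| ->
  `|gauss_kernel w z - gauss_kernel v z| <= 38 / z ^+ 2 * `|w - v|.
Proof.
move=> z1; have C0 : 0 <= 38 / z ^+ 2 by rewrite divr_ge0// sqr_ge0.
wlog vw : v w / v <= w.
  move=> h; have [|/ltW] := leP v w; first exact: h.
  by rewrite distrC [ `|w - v|]distrC; exact: h.
rewrite (ger0_norm (_ : 0 <= w - v)) ?subr_ge0//.
have [v0|v0] := leP v 0.
  rewrite (gauss_kernel_neg z v0) subr0 ger0_norm ?gauss_kernel_ge0//.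
  have [w0|w0] := leP w 0.
    by rewrite gauss_kernel_neg// mulr_ge0// subr_ge0.
  by apply: le_trans (gauss_kernel_le_time (ltW w0) z1) _; rewrite ler_wpM2l//; lra.
apply: (@lipschitz_derive (fun w => gauss_kernel w z) (fun w => dgk w z)) => //.
  by move=> x /andP[vx _]; apply: is_derive_gauss_kernel; exact: lt_le_trans vx.
by move=> x /andP[vx _]; apply: dgk_le => //; exact: lt_le_trans vx.
Qed.

End diagonal.

Section remainder.
Context (R : realType).
Notation leb := (@lebesgue_measure R).
Implicit Types (v w : R).

(** The part of the heat kernel on the diagonal carried by the non-zero
    integers: unlike the term of index zero, it stays Lipschitz down to time
    zero. *)
Definition diag_remainder w : R :=
  fine (\sum_(n <oo) (gauss_kernel w (int_enum n.+1)%:~R)%:E)%E.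

Let z n : R := (int_enum n.+1)%:~R.
Let c n : R := 38 / z n ^+ 2.

Let z1 n : 1 <= `|z n|. Proof. exact: int_enum_norm_ge1. Qed.

Let c0 n : 0 <= c n. Proof. by rewrite divr_ge0// sqr_ge0. Qed.

(* 152 is [4 * 38], as [`|z n|] is at least [n.+1 / 2] *)
Let c_le n : c n <= 152 * (n.+1%:R ^+ 2)^-1.
Proof.
rewrite /c -[z n ^+ 2]real_normK ?num_real//.
have h : n.+1%:R / 2 <= `|z n| by exact: int_enum_norm.
have n0 : 0 < n.+1%:R :> R by rewrite ltr0n.
have z0 : 0 < `|z n| by rewrite (lt_le_trans _ (z1 n)).
rewrite ler_pdivrMr ?exprn_gt0// mulrAC ler_pdivlMr ?exprn_gt0//.
have := ler_pM (ltW (divr_gt0 n0 (ltr0n _ 2))) (ltW (divr_gt0 n0 (ltr0n _ 2))) h h.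
by rewrite -!expr2; lra.
Qed.

Let sum_c n : \sum_(k < n) c k <= 304.
Proof.
case: n => [|n]; first by rewrite big_ord0.
apply: (@le_trans _ _ (152 * (2 - n.+1%:R^-1))); last first.
  have : 0 <= n.+1%:R^-1 :> R by rewrite invr_ge0.
  by move: (_^-1) => y y0; lra.
apply: (@le_trans _ _ (\sum_(k < n.+1) 152 * (k.+1%:R ^+ 2)^-1)).
  by apply: ler_sum => k _; exact: c_le.
rewrite -mulr_sumr ler_wpM2l//; elim: n => [|n ih].
  by rewrite big_ord1 expr1n invr1; lra.
rewrite big_ord_recr/=; set S := \sum_(i < n.+1) _ in ih *.
have n0 : 0 < n.+1%:R :> R by rewrite ltr0n.
have n1 : n.+2%:R = n.+1%:R + 1 :> R by rewrite -natr1.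
have h : (n.+2%:R ^+ 2)^-1 <= n.+1%:R^-1 - n.+2%:R^-1 :> R.
  rewrite n1; move: (n.+1%:R) n0 => a a0.
  have -> : a^-1 - (a + 1)^-1 = (a * (a + 1))^-1.
    by field; rewrite !gt_eqF// addr_gt0.
  by rewrite lef_pV2 ?posrE ?exprn_gt0 ?mulr_gt0 ?addr_gt0//; nra.
by move: (_^-1) (_^-1) (_^-1) S ih h => *; lra.
Qed.

Let series_c : (\sum_(n <oo) (c n)%:E <= 304%:E)%E.
Proof.
apply: lime_le; first by apply: is_cvg_nneseries => n _ _; rewrite lee_fin.
by apply: nearW => n; rewrite big_mkord sumEFin lee_fin.
Qed.

Let gk0 w y : (0 <= (gauss_kernel w y)%:E)%E.
Proof. by rewrite lee_fin gauss_kernel_ge0. Qed.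

Let remainder_sub v w : (\sum_(n <oo) (gauss_kernel w (z n))%:E <=
  \sum_(n <oo) (gauss_kernel v (z n))%:E + (304 * `|w - v|)%:E)%E.
Proof.
apply: (@le_trans _ _ (\sum_(n <oo) ((gauss_kernel v (z n))%:E +
    (`|w - v|%:E * (c n)%:E)))%E).
  apply: lee_nneseries => [n _ _|n _]; first exact: gk0.
  rewrite -EFinM -EFinD lee_fin addrC -lerBlDr.
  rewrite (le_trans (ler_norm _))// mulrC; exact: gauss_kernel_lipschitz.
rewrite nneseriesD//; last by move=> n _ _; rewrite -EFinM lee_fin mulr_ge0.
rewrite leeD2l// nneseriesZl; last by move=> n _; rewrite lee_fin.
by rewrite mulrC EFinM lee_wpmul2l ?lee_fin.
Qed.

Lemma diag_remainderE w :
  (\sum_(n <oo) (gauss_kernel w (z n))%:E = (diag_remainder w)%:E)%E.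
Proof.
rewrite /diag_remainder fineK// ge0_fin_numE; last by apply: nneseries_ge0 => n _ _.
apply: le_lt_trans (remainder_sub 0 w) _.
rewrite eseries0 ?add0e ?ltry// => n _ _.
by rewrite gauss_kernel_neg.
Qed.

Lemma diag_remainder_lipschitz v w :
  `|diag_remainder w - diag_remainder v| <= 304 * `|w - v|.
Proof.
have h v' w' : diag_remainder w' <= diag_remainder v' + 304 * `|w' - v'|.
  by rewrite -lee_fin EFinD -!diag_remainderE; exact: remainder_sub.
have := h v w; have := h w v; rewrite distrC.
by rewrite ler_norml => h1 h2; apply/andP; split; lra.
Qed.

Lemma diag_remainder0 w : w <= 0 -> diag_remainder w = 0.
Proof.
move=> w0; rewrite /diag_remainder eseries0// => n _ _.
by rewrite gauss_kernel_neg.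
Qed.

Lemma diag_remainder_ge0 w : 0 <= diag_remainder w.
Proof. by rewrite fine_ge0//; apply: nneseries_ge0 => n _ _; exact: gk0. Qed.

(** The term of index zero carries the singularity [(4 * pi * w)^-1/2]. *)
Lemma diagonal_kernel w :
  (\sum_(n <oo) (gauss_kernel w (int_enum n)%:~R)%:E =
   (gauss_kernel w 0)%:E + (diag_remainder w)%:E)%E.
Proof.
rewrite nneseries_recl//; congr (_ + _)%E.
rewrite -diag_remainderE -(nneseries_addn (f := fun n => (gauss_kernel w (int_enum n)%:~R)%:E))//.
by apply: eq_eseriesr => n _; rewrite addn1.
Qed.

Lemma lipschitz_continuous (f : R -> R) (L : R) :
  (forall v w, `|f w - f v| <= L * `|w - v|) -> continuous f.
Proof.
move=> fL v; apply/cvgrPdist_lt => e e0.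
have L1 : 0 < `|L| + 1 by rewrite ltr_wpDl.
near=> w; rewrite (le_lt_trans (fL w v))//.
apply: (@le_lt_trans _ _ ((`|L| + 1) * `|v - w|)).
  by rewrite ler_wpM2r// (le_trans (ler_norm _))// lerDl.
rewrite -ltr_pdivlMl// mulrC; near: w.
by apply: cvgr_dist_lt; rewrite // divr_gt0.
Unshelve. all: by end_near. Qed.

(** Starting the primitive to the left of zero makes zero an interior point. *)
Lemma antiderivative (f : R -> R) : continuous f ->
  exists F : R -> R, forall v : R, -1 < v -> is_derive v 1 F (f v).
Proof.
move=> cf; exists (fun v => \int[leb]_(t in `[-1, v]) f t)%R => v v1.
have vv : v < v + 1 by rewrite ltrDl.
have fi : leb.-integrable `[-1, v + 1] (EFin \o f).
  apply: continuous_compact_integrable; first exact: segment_compact.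
  exact: continuous_subspaceT.
have [dF F'] := continuous_FTC1_closed vv fi v1 (cf v).
by split; [exact: dF|rewrite -derive1E F'].
Qed.

End remainder.

(** * Covariance of the stochastic convolution at a fixed point *)

Section covariance.
Context (R : realType) (eps T : R).
Hypothesis eps_gt0 : 0 < eps.
Notation leb := (@lebesgue_measure R).
Local Notation S := (space_time T).
Local Notation leb2 := (lebesgue2 R).

(** The Gaussian kernel at time [eps * t] takes the value [kappa / sqrt t] at zero. *)
Definition kappa : R := (Num.sqrt (4 * pi * eps))^-1.

Let diag (s t r : R) : R := gauss_kernel (eps * (s - r) + eps * (t - r)) 0.

Let diagE s t r : diag s t r = kappa / Num.sqrt (s + t - 2 * r).
Proof.
rewrite /diag /gauss_kernel expr0n/= oppr0 mul0r expR0 mulr1 /kappa -invfM.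
rewrite -sqrtrM ?mulr_ge0 ?pi_ge0 ?ltW//; congr (Num.sqrt _)^-1; ring.
Qed.

Let continuous_diag (s t r : R) : s <= t -> r < s -> {for r, continuous (diag s t)}.
Proof.
move=> st rs; have pos : 0 < s + t - 2 * r by lra.
rewrite (_ : diag s t = fun r => kappa / Num.sqrt (s + t - 2 * r)); last first.
  by apply/funext => y; exact: diagE.
apply: cvgM; first exact: cvg_cst.
apply: cvgV; first by rewrite gt_eqF// sqrtr_gt0.
apply: (@cvg_comp _ _ _ (fun r => s + t - 2 * r) Num.sqrt); last exact: sqrt_continuous.
by apply: cvgB; [exact: cvg_cst|apply: cvgM; [exact: cvg_cst|exact: cvg_id]].
Qed.

(** When [s = t] the integrand blows up at [r = s]; the intervals [[0, b n]]
    exhaust [[0, s[]. *)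
Lemma integral_diag_singular (s t : R) : 0 < s -> s <= t ->
  (\int[leb]_(r in `[0%R, s[) (diag s t r)%:E =
   (kappa * (Num.sqrt (t + s) - Num.sqrt (t - s)))%:E)%E.
Proof.
move=> s0 st.
pose H (r : R) : R := - kappa * Num.sqrt (s + t - 2 * r).
pose b (n : nat) : R := s - s / n.+2%:R.
have b0 n : 0 < b n.
  by rewrite /b subr_gt0 ltr_pdivrMr// ltr_pMr// ltr1n.
have bs n : b n < s by rewrite /b gtrBl divr_gt0.
have pos r : r < s -> 0 < s + t - 2 * r by move=> rs; lra.
have dS (r : R) : r < s -> is_derive r 1 H (diag s t r).
  move=> rs; have p := pos r rs.
  have d1 := is_derive1_sqrt p.
  have d2 : is_derive r 1 (fun r => s + t - 2 * r) (- 2).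
    by apply: is_derive_eq; rewrite /GRing.scale/=; ring.
  have d3 := is_derive1_comp (f := Num.sqrt) (g := fun r => s + t - 2 * r).
  have d4 := d3 _ _ _ d1 d2.
  apply: (is_derive_eq (is_deriveZ (- kappa) d4)).
  rewrite diagE /GRing.scale/=.
  have : Num.sqrt (s + t - 2 * r) != 0 by rewrite gt_eqF// sqrtr_gt0.
  by move: (Num.sqrt _) => y y0; field; rewrite y0.
have cH : continuous H.
  move=> r; apply: cvgM; first exact: cvg_cst.
  apply: (@cvg_comp _ _ _ (fun r => s + t - 2 * r) Num.sqrt); last exact: sqrt_continuous.
  by apply: cvgB; [exact: cvg_cst|apply: cvgM; [exact: cvg_cst|exact: cvg_id]].
have cdiag r := @continuous_diag s t r st.
have part n : (\int[leb]_(r in `[0%R, b n]) (diag s t r)%:E = (H (b n) - H 0)%:E)%E.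
  rewrite EFinB; apply: continuous_FTC2 => //.
  - apply: continuous_in_subspaceT => r /set_mem /=; rewrite in_itv/= => /andP[_ rb].
    by apply: cdiag; exact: le_lt_trans (bs n).
  - split.
    + move=> r; rewrite in_itv/= => /andP[_ rb].
      by have [] := dS r (lt_trans rb (bs n)).
    + by apply: cvg_at_right_filter; exact: cH.
    + by apply: cvg_at_left_filter; exact: cH.
  - move=> r; rewrite in_itv/= => /andP[_ rb].
    by rewrite derive1E; have [] := dS r (lt_trans rb (bs n)).
have mono : nondecreasing_seq (fun n => `[0%R, b n]%classic : set (measurableTypeR R)).
  move=> m n mn; rewrite subsetEset => r /=; rewrite !in_itv/= => /andP[-> /=] /le_trans; apply.
  rewrite /b lerD2l lerN2; apply: ler_wpM2l; first exact: ltW.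
  by rewrite lef_pV2 ?posrE ?ltr0n// ler_nat !ltnS.
have cup : \bigcup_n `[0%R, b n]%classic = `[0%R, s[%classic :> set R.
  apply/seteqP; split => [r [n _] /=|r /=]; rewrite !in_itv/= => /andP[r0 rs].
    by rewrite r0 (le_lt_trans rs).
  have sr : 0 < s - r by rewrite subr_gt0.
  exists (Num.truncn (s / (s - r))) => //=; rewrite in_itv/= r0/= /b lerBrDr.
  rewrite -lerBrDl ler_pdivrMr// mulrC -ler_pdivrMr//.
  by apply: le_trans (ltW (truncnS_gt _)) _; rewrite ler_nat.
have := @ge0_nondecreasing_set_cvg_integral _ (measurableTypeR R) R _ (fun r => (diag s t r)%:E) leb mono.
rewrite cup => h.
have lim1 : (\int[leb]_(r in `[0%R, b n]) (diag s t r)%:E @[n --> \oo] -->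
   \int[leb]_(r in `[0%R, s[) (diag s t r)%:E)%E.
  apply: h => //.
  - move=> n; apply/measurable_EFinP; apply: subspace_continuous_measurable_fun => //.
    apply: continuous_in_subspaceT => r /set_mem /=; rewrite in_itv/= => /andP[_ rb].
    by apply: cdiag; exact: le_lt_trans (bs n).
  - by move=> n r _; rewrite lee_fin gauss_kernel_ge0.
have lim2 : ((H (b n) - H 0)%:E @[n --> \oo] --> (H s - H 0)%:E)%E.
  apply/fine_cvgP; split; first exact: nearW.
  apply: cvgB; last exact: cvg_cst.
  apply: (@cvg_comp _ _ _ b H); last exact: cH.
  suff : b n @[n --> \oo] --> s - s * 0 by rewrite mulr0 subr0.
  apply: cvgB; first exact: cvg_cst.
  apply: cvgM; first exact: cvg_cst.
  by rewrite (cvg_shiftS (fun n => n.+1%:R^-1 : R)); exact: cvg_harmonic.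
move: lim1; under eq_fun do rewrite part.
move=> lim1; rewrite -(cvg_lim _ lim1)//; apply/cvg_lim => //.
apply: cvg_trans lim2 _; rewrite /H mulr0 subr0.
rewrite (_ : _ - _ = kappa * (Num.sqrt (t + s) - Num.sqrt (t - s))); first exact: cvg_id.
by rewrite (_ : s + t - 2 * s = t - s) 1?[s + t]addrC; ring.
Qed.

Context (Gam : R -> R).
Hypothesis dGam : forall v : R, -1 < v -> is_derive v 1 Gam (diag_remainder (eps * v)).

Let remd (s t r : R) : R := diag_remainder (eps * (s - r) + eps * (t - r)).

Lemma continuous_diag_remainder : continuous (@diag_remainder R).
Proof. by apply: (@lipschitz_continuous _ _ 304) => v w; exact: diag_remainder_lipschitz. Qed.

Let continuous_remd s t : continuous (remd s t).
Proof.
move=> r; apply: (@cvg_comp _ _ _ (fun r => eps * (s - r) + eps * (t - r)) (@diag_remainder R));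
  last exact: continuous_diag_remainder.
by apply: cvgD; (apply: cvgM; [exact: cvg_cst|apply: cvgB; [exact: cvg_cst|exact: cvg_id]]).
Qed.

Lemma integral_diag_regular (s t : R) : 0 < s -> s <= t ->
  (\int[leb]_(r in `[0%R, s[) (remd s t r)%:E =
   (2^-1 * (Gam (t + s) - Gam (t - s)))%:E)%E.
Proof.
move=> s0 st.
have mremd (D : set R) : measurable_fun D (remd s t).
  by apply: measurable_funTS; apply: continuous_measurable_fun; exact: continuous_remd.
rewrite integral_itv_bndo_bndc; last exact/measurable_EFinP.
pose H (r : R) : R := - 2^-1 * Gam (s + t - 2 * r).
have dH (r : R) : r <= s -> is_derive r 1 H (remd s t r).
  move=> rs; have p : -1 < s + t - 2 * r by lra.
  have d1 := dGam p.
  have d2 : is_derive r 1 (fun r => s + t - 2 * r) (- 2).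
    by apply: is_derive_eq; rewrite /GRing.scale/=; ring.
  have d3 := is_derive1_comp (f := Gam) (g := fun r => s + t - 2 * r).
  have d4 := d3 _ _ _ d1 d2.
  apply: (is_derive_eq (is_deriveZ (- 2^-1) d4)).
  rewrite /remd (_ : eps * (s - r) + eps * (t - r) = eps * (s + t - 2 * r)); last by ring.
  by rewrite /GRing.scale/=; field.
have cH (r : R) : r <= s -> {for r, continuous H}.
  by move=> rs; apply: differentiable_continuous; apply/derivable1_diffP; have [] := dH r rs.
rewrite (_ : 2^-1 * _ = H s - H 0); last first.
  by rewrite /H mulr0 subr0 (_ : s + t - 2 * s = t - s) 1?[s + t]addrC; ring.
rewrite EFinB; apply: continuous_FTC2 => //.
- by apply: continuous_subspaceT; exact: continuous_remd.
- split.
  + by move=> r; rewrite in_itv/= => /andP[_ /ltW rs]; have [] := dH r rs.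
  + by apply: cvg_at_right_filter; apply: cH; exact: ltW.
  + by apply: cvg_at_left_filter; exact: cH.
- move=> r; rewrite in_itv/= => /andP[_ /ltW rs].
  by rewrite derive1E; have [] := dH r rs.
Qed.

(** Primitive of the heat kernel on the diagonal, in the time variable. *)
Definition diag_primitive (v : R) : R := 2 * kappa * Num.sqrt v + Gam v.

Context (x : R).

Definition conv_kernel (t : R) (z : R * R) : R :=
  \1_(`[0, t]%classic) z.1 * heat_kernel (eps * (t - z.1)) (x - z.2).

Lemma heat_kernel_ge0 t y : 0 <= heat_kernel t y :> R.
Proof.
rewrite heat_kernelE fine_ge0//; apply: nneseries_ge0 => n _ _.
by rewrite lee_fin gauss_kernel_ge0.
Qed.

Lemma conv_kernel_ge0 t z : 0 <= conv_kernel t z.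
Proof. by rewrite mulr_ge0 ?heat_kernel_ge0// indicE. Qed.

Lemma heat_kernel_time0 y : heat_kernel 0 y = 0 :> R.
Proof.
by rewrite heat_kernelE eseries0// => n _ _; rewrite gauss_kernel_neg.
Qed.

(** In the space variable the semigroup property leaves the heat kernel at zero at
    time [eps * (s + t - 2 * r)]; integrating in [r] gives the increment of its
    primitive, halved. *)
Lemma conv_kernel_covariance (s t : R) : 0 < s -> s <= t -> t <= T ->
  measurable_fun S (conv_kernel s) -> measurable_fun S (conv_kernel t) ->
  has_int leb2 (fun z => (conv_kernel s \_ S) z * (conv_kernel t \_ S) z)
    (2^-1 * (diag_primitive (t + s) - diag_primitive (t - s))).
Proof.
move=> s0 st tT ms mt.
have mS : measurable S by exact: measurable_space_time.
have ms' : measurable_fun setT (conv_kernel s \_ S) by apply/(measurable_restrictT _ mS).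
have mt' : measurable_fun setT (conv_kernel t \_ S) by apply/(measurable_restrictT _ mS).
have mst : measurable_fun setT (fun z => (conv_kernel s \_ S) z * (conv_kernel t \_ S) z).
  exact: measurable_funM.
have ge0 (u : R) z : 0 <= (conv_kernel u \_ S) z.
  by rewrite patchE; case: ifPn => // _; exact: conv_kernel_ge0.
have st0 z : 0 <= (conv_kernel s \_ S) z * (conv_kernel t \_ S) z.
  by rewrite mulr_ge0.
apply: ge0_has_int => //.
rewrite (@fubini_tonelli1 _ _ _ _ _ leb leb); last 2 first.
- exact/measurable_EFinP.
- by move=> z; rewrite lee_fin.
rewrite /fubini_F.
have inner r : (\int[leb]_y ((conv_kernel s \_ S) (r, y) * (conv_kernel t \_ S) (r, y))%:E =
    ((fun r => (diag s t r)%:E + (remd s t r)%:E) \_ `[0%R, s[) r)%E.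
  rewrite patchE; case: ifPn => [/set_mem/=|/negP rs].
    rewrite in_itv/= => /andP[r0 rs].
    have a0 : 0 < eps * (s - r) by rewrite mulr_gt0// subr_gt0.
    have b0 : 0 < eps * (t - r) by rewrite mulr_gt0// subr_gt0 (lt_le_trans rs).
    rewrite -diagonal_kernel -(torus_convolution x a0 b0) [RHS]integral_mkcond.
    apply: eq_integral => y _; rewrite !patchE.
    have -> : ((r, y) \in S) = (y \in torus R).
      apply/idP/idP => /set_mem h; apply/mem_set; first by case: h.
      split => //=; rewrite in_itv/= r0/=.
      by rewrite (le_trans (ltW rs))// (le_trans st).
    case: ifPn => _; last by rewrite mul0r.
    rewrite /conv_kernel/= !indicE !mem_set ?mul1r//= in_itv/= r0/= ?(ltW rs)//.
    by rewrite (le_trans (ltW rs)).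
  rewrite integral0_eq// => y _; rewrite !patchE; case: ifPn => [/set_mem[/= rT _]|_].
    suff -> : conv_kernel s (r, y) = 0 by rewrite mul0r.
    rewrite /conv_kernel/= indicE; have [/set_mem/=|] := boolP (r \in _); last by rewrite mul0r.
    rewrite in_itv/= => /andP[r0]; rewrite le_eqVlt => /predU1P[->|rs'].
      by rewrite subrr mulr0 heat_kernel_time0 mulr0.
    by exfalso; apply: rs; apply/mem_set => /=; rewrite in_itv/= r0.
  by rewrite mul0r.
under eq_integral do rewrite inner.
rewrite -integral_mkcond ge0_integralD//; last 4 first.
- by move=> r _; rewrite lee_fin gauss_kernel_ge0.
- apply/measurable_EFinP; apply: subspace_continuous_measurable_fun => //.
  apply: continuous_in_subspaceT => r /set_mem /=; rewrite in_itv/= => /andP[_ rs].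
  exact: continuous_diag.
- by move=> r _; rewrite lee_fin diag_remainder_ge0.
- apply/measurable_EFinP/measurable_funTS; apply: continuous_measurable_fun.
  exact: continuous_remd.
rewrite integral_diag_singular// integral_diag_regular// -EFinD; congr (_%:E).
by rewrite /diag_primitive; field.
Qed.

End covariance.

(** * Covariances of the time increments *)

Section increments.
Context (R : realType) (eps : R).
Hypothesis eps_gt0 : 0 < eps.
Context (Gam : R -> R).
Hypothesis dGam : forall v : R, -1 < v -> is_derive v 1 Gam (diag_remainder (eps * v)).
Local Notation G := (diag_primitive eps Gam).
Local Notation k := (kappa eps).

(** Lipschitz constant of the derivative of [Gam]. *)
Definition lipG : R := 304 * eps.

Lemma lipG_ge0 : 0 <= lipG.
Proof. by apply: mulr_ge0; [exact: ler0n|exact: ltW]. Qed.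

Lemma kappa_ge0 : 0 <= k. Proof. by rewrite invr_ge0. Qed.

Context (dl : R).
Hypothesis dl_gt0 : 0 < dl.

Definition diff2 (f : R -> R) (v : R) : R := f (v + dl) - 2 * f v + f (v - dl).

Definition sqrt_inc (v : R) : R := Num.sqrt v - Num.sqrt (v - dl).

Lemma sqrt_inc_ge0 v : 0 <= sqrt_inc v.
Proof. by rewrite subr_ge0 ler_wsqrtr// gerBl ltW. Qed.

Let sqrt_incE v : dl <= v ->
  sqrt_inc v * (Num.sqrt v + Num.sqrt (v - dl)) = dl.
Proof.
move=> dv; rewrite /sqrt_inc -subr_sqr !sqr_sqrtr; first by ring.
  by rewrite subr_ge0.
by rewrite (le_trans (ltW dl_gt0)).
Qed.

Lemma sqrt_inc_le v : dl <= v -> sqrt_inc v <= Num.sqrt dl.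
Proof.
move=> dv; have h := sqrt_incE dv; have p := sqrt_inc_ge0 v.
have q : 0 <= Num.sqrt (v - dl) by exact: sqrtr_ge0.
have vE : sqrt_inc v + 2 * Num.sqrt (v - dl) = Num.sqrt v + Num.sqrt (v - dl).
  by rewrite /sqrt_inc; ring.
rewrite -[sqrt_inc v]ger0_norm// -sqrtr_sqr ler_wsqrtr//.
rewrite -vE in h; nra.
Qed.

(** Concavity of the square root. *)
Lemma sqrt_inc_decr v : dl <= v -> sqrt_inc (v + dl) <= sqrt_inc v.
Proof.
move=> dv; have dv' : dl <= v + dl by rewrite lerDr (le_trans (ltW dl_gt0)).
have h := sqrt_incE dv; have h' := sqrt_incE dv'.
have s0 : 0 < Num.sqrt v by rewrite sqrtr_gt0 (lt_le_trans dl_gt0).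
have ss : 0 < Num.sqrt v + Num.sqrt (v - dl) by rewrite ltr_pwDl.
have le1 : Num.sqrt v + Num.sqrt (v - dl) <= Num.sqrt (v + dl) + Num.sqrt (v + dl - dl).
  by apply: lerD; apply: ler_wsqrtr; move: dl_gt0 dv; lra.
rewrite -(ler_pM2r ss) h -[leRHS]h'.
by rewrite ler_wpM2l// sqrt_inc_ge0.
Qed.

Lemma diff2_sqrt v : diff2 Num.sqrt v = sqrt_inc (v + dl) - sqrt_inc v.
Proof. by rewrite /diff2 /sqrt_inc addrK; ring. Qed.

(** By concavity the second differences all have the same sign, so that the sum of
    their absolute values telescopes: this is what makes the rows of the Gram
    matrix summable uniformly in the number of points. *)
Lemma sum_diff2_sqrt v n : dl <= v ->
  \sum_(j < n) `|diff2 Num.sqrt (v + j%:R * dl)| <= Num.sqrt dl.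
Proof.
move=> dv; apply: le_trans (sqrt_inc_le dv).
suff -> : \sum_(j < n) `|diff2 Num.sqrt (v + j%:R * dl)| = sqrt_inc v - sqrt_inc (v + n%:R * dl).
  by rewrite gerBl sqrt_inc_ge0.
elim: n => [|n ih]; first by rewrite big_ord0 mul0r addr0 subrr.
rewrite big_ord_recr/= ih diff2_sqrt.
have -> : v + n%:R * dl + dl = v + n.+1%:R * dl by rewrite -natr1; ring.
rewrite ler0_norm; first by ring.
have -> : v + n.+1%:R * dl = v + n%:R * dl + dl by rewrite -natr1; ring.
have nd : 0 <= n%:R * dl by rewrite mulr_ge0// ltW.
by rewrite subr_le0; apply: sqrt_inc_decr; lra.
Qed.

(** The mean value theorem applied to the increment of [Gam], whose derivative is
    Lipschitz. *)
Lemma diff2_Gam v : dl <= v -> `|diff2 Gam v| <= lipG * dl ^+ 2.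
Proof.
move=> dv.
have -> : diff2 Gam v = (Gam (v + dl) - Gam v) - (Gam (v - dl + dl) - Gam (v - dl)).
  by rewrite subrK /diff2; ring.
have := @lipschitz_derive R (fun y => Gam (y + dl) - Gam y)
  (fun y => diag_remainder (eps * (y + dl)) - diag_remainder (eps * y)) (v - dl) v (lipG * dl).
rewrite (_ : v - (v - dl) = dl); last by ring.
rewrite (_ : lipG * dl * dl = lipG * dl ^+ 2); last by ring.
apply.
- by rewrite gerBl ltW.
- move=> y /andP[y1 y2].
  have d1 : -1 < y + dl by lra.
  have d2 : -1 < y by lra.
  have d3 : is_derive y 1 (fun y => y + dl) 1 by apply: is_derive_eq; rewrite addr0.
  have d4 := is_derive1_comp (f := Gam) (g := fun y => y + dl).
  have d5 := d4 _ _ _ (dGam d1) d3.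
  apply: (is_derive_eq (is_deriveB d5 (dGam d2))).
  by rewrite mulr1.
- move=> y _; apply: le_trans (diag_remainder_lipschitz _ _) _.
  rewrite /lipG -mulrA; apply: ler_wpM2l; first exact: ler0n.
  rewrite -mulrBr addrAC subrr add0r.
  by rewrite normrM !ger0_norm// ltW.
Qed.

Lemma Gam_inc0 : `|Gam dl - Gam 0| <= lipG * dl ^+ 2.
Proof.
have := @lipschitz_derive R Gam (fun y => diag_remainder (eps * y)) 0 dl (lipG * dl).
rewrite subr0 (_ : lipG * dl * dl = lipG * dl ^+ 2); last by ring.
apply; first exact: ltW.
- by move=> y /andP[y1 y2]; apply: dGam; lra.
- move=> y /andP[y1 y2]; have := diag_remainder_lipschitz 0 (eps * y).
  rewrite (diag_remainder0 (lexx 0)) !subr0 => /le_trans; apply.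
  rewrite /lipG -mulrA; apply: ler_wpM2l; first exact: ler0n.
  by rewrite normrM !ger0_norm// ?ler_wpM2l// ltW.
Qed.

Lemma diff2_G v : dl <= v ->
  `|diff2 G v| <= 2 * k * `|diff2 Num.sqrt v| + lipG * dl ^+ 2.
Proof.
move=> dv.
have -> : diff2 G v = 2 * k * diff2 Num.sqrt v + diff2 Gam v.
  by rewrite /diff2 /diag_primitive; ring.
apply: le_trans (ler_normD _ _) _; apply: lerD; last exact: diff2_Gam.
by rewrite normrM (ger0_norm (mulr_ge0 _ kappa_ge0)).
Qed.

Lemma sum_diff2_G v n : dl <= v ->
  \sum_(j < n) `|diff2 G (v + j%:R * dl)| <= 2 * k * Num.sqrt dl + n%:R * (lipG * dl ^+ 2).
Proof.
move=> dv.
apply: (@le_trans _ _ (\sum_(j < n) (2 * k * `|diff2 Num.sqrt (v + j%:R * dl)| + lipG * dl ^+ 2))).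
  apply: ler_sum => j _; apply: diff2_G.
  have jd : 0 <= j%:R * dl by rewrite mulr_ge0// ltW.
  by lra.
rewrite big_split/= sumr_const card_ord -[_ *+ n]mulr_natl lerD2r -mulr_sumr.
by rewrite ler_wpM2l ?mulr_ge0 ?kappa_ge0//; exact: sum_diff2_sqrt.
Qed.

Definition conv_cov (s t : R) : R := 2^-1 * (G (t + s) - G `|t - s|).

Context (A1 : R) (N : nat).
Hypothesis A1_gt0 : 0 < A1.
Local Notation t i := (A1 + i%:R * dl).

Definition inc_cov (i j : nat) : R :=
  conv_cov (t i.+1) (t j.+1) - conv_cov (t i.+1) (t j)
  - conv_cov (t i) (t j.+1) + conv_cov (t i) (t j).

Let dist_t i j : `|t j - t i| = `|(j%:Z - i%:Z)|%:~R * dl.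
Proof.
rewrite (_ : t j - t i = (j%:Z - i%:Z)%:~R * dl); last by rewrite intrB -!pmulrn; ring.
by rewrite normrM (ger0_norm (ltW dl_gt0)) intr_norm.
Qed.

(** Second difference of [v |-> G `|v|] at [m * dl]; at [m = 0] the kink of the
    absolute value makes it a first difference. *)
Definition gap_term (m : nat) : R :=
  if m is m'.+1 then diff2 G (m'.+1%:R * dl) else 2 * (G dl - G 0).

(** The covariance is a function of the sum of the times minus a function of their
    distance, so that a double increment reduces to two second differences. *)
Lemma inc_covE i j : inc_cov i j =
  2^-1 * (diff2 G (t i + t j + dl) + gap_term `|i%:Z - j%:Z|).
Proof.
have e1 : t j.+1 + t i.+1 = t i + t j + dl + dl by rewrite -!natr1; ring.
have e2 : t j + t i.+1 = t i + t j + dl by rewrite -!natr1; ring.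
have e3 : t j.+1 + t i = t i + t j + dl by rewrite -!natr1; ring.
have e4 : t j + t i = t i + t j + dl - dl by ring.
rewrite /inc_cov /conv_cov e1 e2 e3 e4 !dist_t.
have -> : j.+1%:Z - i.+1%:Z = j%:Z - i%:Z by lia.
have [ij|ji|->] := ltngtP i j.
- have [m mE] : exists m, j = (i + m.+1)%N by exists (j - i.+1)%N; lia.
  have -> : `|i%:Z - j%:Z|%N = m.+1 by lia.
  have -> : `|j%:Z - i%:Z| = m.+1%:Z by lia.
  have -> : `|j%:Z - i.+1%:Z| = m%:Z by lia.
  have -> : `|j.+1%:Z - i%:Z| = m.+2%:Z by lia.
  rewrite /gap_term /diff2 -!pmulrn.
  have -> : m.+1%:R * dl + dl = m.+2%:R * dl by rewrite -[m.+2%:R]natr1; ring.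
  have -> : m.+1%:R * dl - dl = m%:R * dl by rewrite -[m.+1%:R]natr1; ring.
  by ring.
- have [m mE] : exists m, i = (j + m.+1)%N by exists (i - j.+1)%N; lia.
  have -> : `|i%:Z - j%:Z|%N = m.+1 by lia.
  have -> : `|j%:Z - i%:Z| = m.+1%:Z by lia.
  have -> : `|j%:Z - i.+1%:Z| = m.+2%:Z by lia.
  have -> : `|j.+1%:Z - i%:Z| = m%:Z by lia.
  rewrite /gap_term /diff2 -!pmulrn.
  have -> : m.+1%:R * dl + dl = m.+2%:R * dl by rewrite -[m.+2%:R]natr1; ring.
  have -> : m.+1%:R * dl - dl = m%:R * dl by rewrite -[m.+1%:R]natr1; ring.
  by ring.
- have -> : `|j%:Z - j%:Z|%N = 0%N by lia.
  have -> : `|j%:Z - j%:Z| = 0%:Z by lia.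
  have -> : `|j%:Z - j.+1%:Z| = 1%:Z by lia.
  have -> : `|j.+1%:Z - j%:Z| = 1%:Z by lia.
  by rewrite /gap_term /diff2 -!pmulrn mul0r mul1r; ring.
Qed.

Lemma sum_gap (f : nat -> R) i : (forall m, 0 <= f m) -> (i < N)%N ->
  \sum_(j < N) f `|i%:Z - j%:Z|%N <= f 0%N + 2 * \sum_(j < N) f j.+1.
Proof.
move=> f0 iN; rewrite -(big_mkord xpredT (fun j => f `|i%:Z - j%:Z|%N)).
have sub (n : nat) : (n <= N)%N -> \sum_(0 <= j < n) f j.+1 <= \sum_(j < N) f j.+1.
  move=> nN; rewrite -(big_mkord xpredT (fun j => f j.+1)) [leRHS](big_cat_nat (n := n))//=.
  by rewrite lerDl sumr_ge0.
rewrite (big_cat_nat (leq0n i) (ltnW iN))/= [X in _ + X]big_ltn//.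
have -> : `|i%:Z - i%:Z|%N = 0%N by lia.
have h1 : \sum_(0 <= j < i) f `|i%:Z - j%:Z|%N <= \sum_(j < N) f j.+1.
  rewrite big_nat_rev/= add0n; apply: le_trans (sub i (ltnW iN)).
  rewrite [leLHS]big_nat_cond [leRHS]big_nat_cond; apply: ler_sum => j /andP[ji _].
  by have -> : `|i%:Z - (i - j.+1)%N%:Z|%N = j.+1 by lia.
have h2 : \sum_(i.+1 <= j < N) f `|i%:Z - j%:Z|%N <= \sum_(j < N) f j.+1.
  rewrite -{1}[i.+1]add0n big_addn; apply: le_trans (sub (N - i.+1)%N (leq_subr _ _)).
  by apply: ler_sum => j _; have -> : `|i%:Z - (j + i.+1)%N%:Z|%N = j.+1 by lia.
lra.
Qed.

Definition row_bound : R := 5 * k * Num.sqrt dl + 3 * N%:R * (lipG * dl ^+ 2).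

Lemma inc_cov_row_sum i : (i < N)%N -> \sum_(j < N) `|inc_cov i j| <= row_bound.
Proof.
move=> iN.
have iv : dl <= t i + A1 + dl.
  by rewrite lerDr !addr_ge0 ?mulr_ge0// ltW.
have s1 := sum_diff2_G N iv.
have s2 := sum_diff2_G N (lexx dl).
have := @sum_gap (fun m => `|gap_term m|) i (fun m => normr_ge0 _) iN.
have -> : \sum_(j < N) `|gap_term j.+1| = \sum_(j < N) `|diff2 G (dl + j%:R * dl)|.
  by apply: eq_bigr => j _; rewrite /gap_term -natr1 mulrDl mul1r addrC.
move=> s3.
have g0 : `|gap_term 0| <= 4 * k * Num.sqrt dl + 2 * (lipG * dl ^+ 2).
  rewrite /gap_term /diag_primitive sqrtr0 mulr0 add0r.
  rewrite (_ : 2 * _ = 4 * k * Num.sqrt dl + 2 * (Gam dl - Gam 0)); last by ring.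
  apply: le_trans (ler_normD _ _) _; apply: lerD.
    by rewrite ger0_norm// !mulr_ge0 ?kappa_ge0.
  by rewrite normrM ger0_norm// ler_wpM2l//; exact: Gam_inc0.
have s4 : \sum_(j < N) `|inc_cov i j| <= 2^-1 * (\sum_(j < N) `|diff2 G (t i + A1 + dl + j%:R * dl)|)
    + 2^-1 * (\sum_(j < N) `|gap_term `|i%:Z - j%:Z|%N|).
  rewrite !mulr_sumr -big_split/=; apply: ler_sum => j _.
  rewrite inc_covE mulrDr; apply: le_trans (ler_normD _ _) _.
  rewrite !normrM ger0_norm//.
  by rewrite (_ : t i + t j + dl = t i + A1 + dl + j%:R * dl); last by ring.
have N1 : 1 <= N%:R :> R by rewrite ler1n (leq_ltn_trans _ iN).
have L0 : 0 <= lipG * dl ^+ 2 by rewrite mulr_ge0 ?lipG_ge0// sqr_ge0.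
have NL : lipG * dl ^+ 2 <= N%:R * (lipG * dl ^+ 2) by rewrite ler_peMl.
have K0 : 0 <= k * Num.sqrt dl by rewrite mulr_ge0 ?kappa_ge0.
rewrite /row_bound; lra.
Qed.

(** The kink contributes [2 * k * sqrt dl], everything else being [O(dl)]. *)
Lemma inc_cov_diag i :
  `|inc_cov i i - 2 * k * Num.sqrt dl| <= k * (dl / Num.sqrt A1) + 2 * (lipG * dl ^+ 2).
Proof.
have iv : dl <= t i + t i + dl.
  by rewrite lerDr !addr_ge0 ?mulr_ge0// ltW.
rewrite inc_covE (_ : `|i%:Z - i%:Z|%N = 0%N); last by lia.
rewrite /gap_term {2 3}/diag_primitive sqrtr0 mulr0 add0r.
set D := diff2 G _.
rewrite (_ : _ - _ = 2^-1 * D + (Gam dl - Gam 0)); last by field.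
apply: le_trans (ler_normD _ _) _.
have h1 := Gam_inc0; have h2 := diff2_G iv; rewrite -/D in h2.
have L0 : 0 <= lipG * dl ^+ 2 by rewrite mulr_ge0 ?lipG_ge0// sqr_ge0.
have h3 : `|diff2 Num.sqrt (t i + t i + dl)| <= dl / Num.sqrt A1.
  rewrite diff2_sqrt distrC ger0_norm ?subr_ge0 ?sqrt_inc_decr//.
  apply: (@le_trans _ _ (sqrt_inc (t i + t i + dl))).
    by rewrite gerBl sqrt_inc_ge0.
  rewrite ler_pdivlMr ?sqrtr_gt0// -[leRHS](sqrt_incE iv).
  rewrite ler_wpM2l ?sqrt_inc_ge0// (le_trans (_ : _ <= Num.sqrt (t i + t i + dl)))//.
    apply: ler_wsqrtr; have : 0 <= i%:R * dl by rewrite mulr_ge0// ltW.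
    by have := ltW A1_gt0; have := ltW dl_gt0; lra.
  by rewrite lerDl sqrtr_ge0.
have K0 := kappa_ge0.
have h4 := ler_wpM2l K0 h3.
rewrite normrM ger0_norm//; lra.
Qed.

End increments.

(** * The drift *)

Section bessel.
Context d (T : measurableType d) (R : realType) (mu : {measure set T -> \bar R}).

(** Bessel's inequality for an almost orthogonal family: the Gram matrix of the
    [K i] has operator norm at most [L]. *)
Lemma bessel N (K : 'I_N -> T -> R) (f : T -> R) (c : 'I_N -> 'I_N -> R)
    (a : 'I_N -> R) (F L : R) :
  0 < L -> (forall i j, has_int mu (fun z => K i z * K j z) (c i j)) ->
  (forall i, \sum_j `|c i j| <= L) -> has_int mu (fun z => f z ^+ 2) F ->
  (forall i, has_int mu (fun z => K i z * f z) (a i)) ->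
  \sum_i a i ^+ 2 <= L * F.
Proof.
move=> L0 hc cL hF ha.
have cC i j : c i j = c j i.
  apply: has_int_unique (hc i j) _.
  by under [X in has_int _ X _]funext do rewrite mulrC; exact: hc.
pose g z := \sum_i a i * K i z.
have hg2 : has_int mu (fun z => g z ^+ 2) (qform c a).
  rewrite /qform; under [X in has_int _ X _]funext do rewrite expr2 /g mulr_suml.
  apply: has_int_sum => i _; under [X in has_int _ X _]funext do rewrite mulr_sumr.
  apply: has_int_sum => j _; under [X in has_int _ X _]funext do rewrite mulrACA.
  exact: has_intZ.
have hgf : has_int mu (fun z => g z * f z) (\sum_i a i ^+ 2).
  under [X in has_int _ X _]funext do rewrite /g mulr_suml.
  apply: has_int_sum => i _; under [X in has_int _ X _]funext do rewrite -mulrA.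
  by rewrite expr2; exact: has_intZ.
have := has_intD (has_intD hF (has_intZ (- 2 / L) hgf)) (has_intZ (L^-1 ^+ 2) hg2).
move=> /has_int_ge0 h.
have {}h : 0 <= F + - 2 / L * \sum_i a i ^+ 2 + L^-1 ^+ 2 * qform c a.
  apply: h => z.
  rewrite (_ : _ + _ = (f z - L^-1 * g z) ^+ 2) ?sqr_ge0//.
  by field; rewrite gt_eqF.
have hs := schur_test cC cL a.
have h2 : L^-1 ^+ 2 * qform c a <= L^-1 * \sum_i a i ^+ 2.
  rewrite expr2 -mulrA ler_wpM2l ?invr_ge0 ?(ltW L0)//.
  by rewrite -ler_pdivlMl ?invr_gt0// invrK.
have h3 : 0 <= F - L^-1 * \sum_i a i ^+ 2.
  by apply: le_trans h _; rewrite mulNr mulNr -mulrA; lra.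
by rewrite -ler_pdivrMl//; lra.
Qed.

End bessel.

(** A named copy of the Lebesgue measure of the plane, to carry the
    sigma-finiteness that Tonelli's theorem asks for. *)
Section lebesgue_plane.
Context (R : realType).
Local Notation leb := (@lebesgue_measure R).
Definition lebesgue_plane : set (measurableTypeR R * measurableTypeR R) -> \bar R := lebesgue2 R.
HB.instance Definition _ := Measure.on lebesgue_plane.

Let lebesgue_plane_sigma_finite : sigma_finite setT lebesgue_plane.
Proof.
have /sigma_finiteP[F [TF ndF Foo]] := sigma_finiteT leb.
exists (fun n => F n `*` F n).
  rewrite -setXTT TF predeqE => -[x y]; split.
    move=> [/= [n _ Fnx] [k _ Fky]]; exists (maxn n k) => //; split.
    - by move: x Fnx; exact/subsetPset/ndF/leq_maxl.
    - by move: y Fky; exact/subsetPset/ndF/leq_maxr.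
  by move=> [n _ []/= ? ?]; split; exists n.
move=> k; have [? ?] := Foo k.
split; first exact: measurableX.
by rewrite /lebesgue_plane product_measure1E// lte_mul_pinfty// ge0_fin_numE.
Qed.

HB.instance Definition _ := Measure_isSigmaFinite.Build _ _ _ lebesgue_plane
  lebesgue_plane_sigma_finite.

Lemma lebesgue2_tonelli d (Omega : measurableType d) (P : probability Omega R)
    (h : (R * R) * Omega -> \bar R) : measurable_fun setT h -> (forall z, 0 <= h z)%E ->
  (\int[P]_w (\int[lebesgue2 R]_z h (z, w)) = \int[lebesgue2 R]_z (\int[P]_w h (z, w)))%E.
Proof.
move=> mh h0.
exact/esym/(@fubini_tonelli _ _ _ _ R lebesgue_plane P h mh h0).
Qed.

Lemma measurable_integral_lebesgue2 d (Omega : measurableType d)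
    (h : (R * R) * Omega -> \bar R) : measurable_fun setT h -> (forall z, 0 <= h z)%E ->
  measurable_fun setT (fun w => \int[lebesgue2 R]_z h (z, w))%E.
Proof.
move=> mh h0.
exact: (@measurable_fun_fubini_tonelli_G _ _ _ _ R lebesgue_plane h mh h0).
Qed.

End lebesgue_plane.

Section drift.
Context d (Omega : measurableType d) (R : realType) (P : probability Omega R).
Context (eps T : R).
Hypothesis T_gt0 : 0 < T.
Local Notation S := (space_time T).
Notation leb := (@lebesgue_measure R).
Local Notation leb2 := (lebesgue2 R).
Context (u : R -> R -> Omega -> R).
Hypothesis mu_ : measurable_fun (S `*` [set: Omega])
  (fun z : (R * R) * Omega => u z.1.1 z.1.2 z.2).
Hypothesis u_moments : forall q : R, 2 <= q ->
  (ereal_sup [set 'E_P[fun w => (`|u z.1 z.2 w| `^ q)%R] | z in S] < +oo)%E.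

Let mS : measurable S := measurable_space_time T.

Let reaction (w : Omega) (z : R * R) : R := allen_cahn (u z.1 z.2 w).

Let mreaction : measurable_fun setT
  (fun z : (R * R) * Omega => ((fun z1 => reaction z.2 z1) \_ S) z.1).
Proof.
have mST : measurable (S `*` [set: Omega]) by exact: measurableX.
rewrite (_ : (fun z => _) = (fun z : (R * R) * Omega => reaction z.2 z.1) \_ (S `*` setT)).
  apply/(measurable_restrictT _ mST); apply: measurable_funB => //.
  exact: measurable_funX.
apply/funext => z; rewrite !patchE.
by congr (if _ then _ else _); apply/idP/idP => /set_mem h; apply/mem_set; [split|case: h].
Qed.

Lemma measurable_reaction w : measurable_fun setT ((fun z => reaction w z) \_ S).
Proof.
exact: (measurableT_comp mreaction (@pair2_measurable _ _ _ _ w)).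
Qed.

Let moment_bound (q : nat) : (2 <= q)%N -> exists M : R,
  forall z, S z -> (\int[P]_w (`|u z.1 z.2 w| ^+ q)%:E <= M%:E)%E.
Proof.
move=> q2; have q2' : 2 <= q%:R :> R by rewrite ler_nat.
have := u_moments q2'; set s := ereal_sup _ => sfin.
exists (fine s) => z Sz.
have h : (\int[P]_w (`|u z.1 z.2 w| ^+ q)%:E <= s)%E.
  apply: ereal_sup_ubound; exists z => //; rewrite unlock; apply: eq_integral => w _.
  by rewrite powR_mulrn.
rewrite fineK// ge0_fin_numE// (le_trans _ h)//.
by apply: integral_ge0 => w _; rewrite lee_fin exprn_ge0.
Qed.

(** The second moment of [u - u ^+ 3] is controlled by the second and sixth
    moments of [u], bounded uniformly over space-time; then Tonelli applies. *)
Lemma reaction_square_integrable : {ae P, forall w,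
  exists F, has_int leb2 (fun z => ((fun z1 => reaction w z1) \_ S) z ^+ 2) F}.
Proof.
have [M2 hM2] := moment_bound (leqnn 2).
have [M6 hM6] := moment_bound (isT : (2 <= 6)%N).
pose h (z : (R * R) * Omega) : \bar R := (((fun z1 => reaction z.2 z1) \_ S) z.1 ^+ 2)%:E.
have h0 z : (0 <= h z)%E by rewrite lee_fin sqr_ge0.
have mh : measurable_fun setT h by apply/measurable_EFinP; exact: measurable_funX.
have mST : measurable (S `*` [set: Omega]) by exact: measurableX.
have mu2 z : S z -> measurable_fun setT (fun w => u z.1 z.2 w).
  move=> Sz.
  have muS : measurable_fun setT
      ((fun z : (R * R) * Omega => u z.1.1 z.1.2 z.2) \_ (S `*` setT)).
    by apply/(measurable_restrictT _ mST).
  rewrite (_ : (fun w => _) = (fun w =>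
      ((fun z : (R * R) * Omega => u z.1.1 z.1.2 z.2) \_ (S `*` setT)) (z, w))); last first.
    by apply/funext => w; rewrite patchE mem_set.
  exact: (measurableT_comp muS (@pair1_measurable _ _ _ _ z)).
have mpow z k : S z -> measurable_fun setT (fun w => `|u z.1 z.2 w| ^+ k).
  move=> Sz; apply: measurable_funX.
  exact: (measurableT_comp (@normr_measurable R setT) (mu2 z Sz)).
have inner z : (\int[P]_w h (z, w) <= ((cst (2 * M2 + 2 * M6)%:E) \_ S) z)%E.
  rewrite patchE; case: ifPn => [/set_mem Sz|zS]; last first.
    by rewrite integral0_eq// => w _; rewrite /h/= patchE (negbTE zS) expr0n.
  apply: (@le_trans _ _ (\int[P]_w (2 * `|u z.1 z.2 w| ^+ 2 + 2 * `|u z.1 z.2 w| ^+ 6)%:E)%E).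
    apply: ge0_le_integral => //.
    - exact: (measurableT_comp mh (@pair1_measurable _ _ _ _ z)).
    - apply/measurable_EFinP; apply: measurable_funD.
        by apply: measurable_funM; [exact: measurable_cst|exact: mpow].
      by apply: measurable_funM; [exact: measurable_cst|exact: mpow].
    - move=> w _; rewrite /h/= patchE mem_set// lee_fin /reaction /allen_cahn.
      move: (u _ _ w) => y; rewrite -!normrX !ger0_norm ?exprn_even_ge0//.
      have := sqr_ge0 (y + y ^+ 3); nra.
  under eq_integral do rewrite EFinD.
  have pow0 k w : (0 <= (2 * `|u z.1 z.2 w| ^+ k)%:E)%E.
    by rewrite lee_fin mulr_ge0// exprn_ge0.
  rewrite ge0_integralD//; last 2 first.
  - apply/measurable_EFinP; apply: measurable_funM; [exact: measurable_cst|exact: mpow].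
  - apply/measurable_EFinP; apply: measurable_funM; [exact: measurable_cst|exact: mpow].
  under eq_integral do rewrite EFinM.
  under [X in (_ + X <= _)%E]eq_integral do rewrite EFinM.
  rewrite !ge0_integralZl//; last 2 first.
  - by apply/measurable_EFinP; exact: mpow.
  - by apply/measurable_EFinP; exact: mpow.
  have -> : cst (2 * M2 + 2 * M6)%:E z = (2%:E * M2%:E + 2%:E * M6%:E)%E.
    by rewrite -!EFinM -EFinD.
  apply: leeD; rewrite lee_wpmul2l ?lee_fin//.
    exact: hM2.
  exact: hM6.
have tot : (\int[P]_w (\int[leb2]_z h (z, w)) < +oo)%E.
  have -> : (\int[P]_w (\int[leb2]_z h (z, w)) = \int[leb2]_z (\int[P]_w h (z, w)))%E.
    exact: lebesgue2_tonelli.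
  apply: (@le_lt_trans _ _ (\int[leb2]_z ((cst (2 * M2 + 2 * M6)%:E) \_ S) z)%E).
    apply: ge0_le_integral => //.
    - by move=> z _; apply: integral_ge0 => w _; exact: h0.
    - exact: (measurable_fun_fubini_tonelli_F h mh h0).
    - by apply/(measurable_restrictT _ mS); exact: measurable_cst.
  rewrite -integral_mkcond integral_cst//.
  rewrite [X in (_ * X < _)%E](_ : _ = T%:E); first exact: ltry.
  change (lebesgue2 R S = T%:E).
  transitivity (leb `[0%R, T]%classic * leb (torus R))%E.
    apply: (@product_measure1E _ _ (measurableTypeR R) (measurableTypeR R) R leb leb);
      exact: measurable_itv.
  by rewrite /torus !lebesgue_measure_itv/= !lte_fin T_gt0 ltr01 -!EFinB -!EFinM !subr0 mulr1.
have intH : P.-integrable setT (fun w => \int[leb2]_z h (z, w))%E.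
  apply/integrableP; split; first exact: measurable_integral_lebesgue2.
  under eq_integral do rewrite gee0_abs ?integral_ge0//.
  exact: tot.
have := integrable_ae measurableT intH.
move=> hfin; apply: (ae_imply hfin) => w /(_ I) fw.
exists (fine (\int[leb2]_z h (z, w))%E); apply: ge0_has_int.
- by apply: measurable_funX; exact: measurable_reaction.
- by move=> z; exact: sqr_ge0.
- by rewrite fineK.
Qed.

Context (x : R).

(** The iterated integral of the mild formulation is an inner product in
    [L^2] of space-time. *)
Lemma drift_inner_product (t : R) (f : R * R -> R) (F E : R) :
  t <= T -> measurable_fun setT (f \_ S) ->
  measurable_fun S (conv_kernel eps x t) ->
  has_int leb2 (fun z => (conv_kernel eps x t \_ S) z ^+ 2) E ->
  has_int leb2 (fun z => (f \_ S) z ^+ 2) F ->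
  has_int leb2 (fun z => (conv_kernel eps x t \_ S) z * (f \_ S) z)
    (\int[leb]_(s in `[0%R, t]) (\int[leb]_(y in torus R)
       (heat_kernel (eps * (t - s)) (x - y) * f (s, y)))%R)%R.
Proof.
move=> tT mf mk hE hF.
have mk' : measurable_fun setT (conv_kernel eps x t \_ S) by apply/(measurable_restrictT _ mS).
have [a ha] := @has_int_mul _ _ _ leb2 _ _ _ _ mk' mf hE hF.
suff -> : (\int[leb]_(s in `[0%R, t]) (\int[leb]_(y in torus R)
       (heat_kernel (eps * (t - s)) (x - y) * f (s, y)))%R)%R = a by [].
have [ia av] := ha.
pose g (z : R * R) := ((conv_kernel eps x t \_ S) z * (f \_ S) z)%:E.
pose Fg (s : R) := (\int[leb]_y g (s, y))%E.
have iFg : leb.-integrable setT Fg by exact: (@integrable_fubini_F _ _ _ _ _ leb leb g ia).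
have Fg_out s : s \notin `[0%R, t]%classic -> Fg s = 0%E.
  move=> st; rewrite /Fg integral0_eq// => y _; rewrite /g patchE.
  case: ifPn => _; last by rewrite mul0r.
  by rewrite /conv_kernel/= indicE (negbTE st) !mul0r.
have Fg_in s : s \in `[0%R, t]%classic -> Fg s =
    (\int[leb]_(y in torus R) (heat_kernel (eps * (t - s)) (x - y) * f (s, y))%:E)%E.
  move=> st; rewrite /Fg [RHS]integral_mkcond; apply: eq_integral => y _.
  rewrite /g !patchE.
  have -> : ((s, y) \in S) = (y \in torus R).
    apply/idP/idP => /set_mem h; apply/mem_set; first by case: h.
    split => //=; move/set_mem: st => /=; rewrite !in_itv/= => /andP[-> /=] /le_trans.
    exact.
  case: ifPn => _; last by rewrite mul0r.
  by rewrite /conv_kernel/= indicE st mul1r.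
rewrite /Rintegral -[RHS]/(fine a%:E); congr fine.
rewrite -av -(@integral12_prod_meas1 _ _ _ _ _ leb leb g ia) -/Fg.
rewrite integral_mkcond; apply: ae_eq_integral => //.
- rewrite (_ : _ \_ _ = fun s => (fine (Fg s))%:E).
    apply/measurable_EFinP; apply: (measurableT_comp (@fine_measurable R setT measurableT)).
    exact: measurable_int iFg.
  apply/funext => s; rewrite patchE; case: ifPn => st; last by rewrite Fg_out.
  by rewrite Fg_in.
- exact: measurable_int iFg.
- have := integrable_ae measurableT iFg.
  move=> hfin; apply: (ae_imply hfin) => s /(_ I) fs _.
  rewrite patchE; case: ifPn => st; last by rewrite -[RHS]/(Fg s) Fg_out.
  by rewrite -Fg_in// fineK.
Qed.

End drift.

(** * Limits along the partition *)

Section limits.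
Context (R : realType).
Implicit Types (a b eta l : R).

(** Young's inequality in disguise: whichever of [a], [b] dominates, up to the
    factor [eta], absorbs the cross terms. *)
Lemma quartic_perturbation a b eta : 0 < eta -> eta <= 1 ->
  `|(a + b) ^+ 4 - a ^+ 4| <= 15 * (eta * a ^+ 4 + eta^-1 ^+ 3 * b ^+ 4).
Proof.
move=> e0 e1.
have a4 : `|a| ^+ 4 = a ^+ 4 by rewrite -normrX ger0_norm// exprn_even_ge0.
have b4 : `|b| ^+ 4 = b ^+ 4 by rewrite -normrX ger0_norm// exprn_even_ge0.
have -> : (a + b) ^+ 4 - a ^+ 4 =
  4 * (a ^+ 3 * b) + 6 * (a ^+ 2 * b ^+ 2) + 4 * (a * b ^+ 3) + b ^+ 4 by ring.
have tri : `|4 * (a ^+ 3 * b) + 6 * (a ^+ 2 * b ^+ 2) + 4 * (a * b ^+ 3) + b ^+ 4| <=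
    4 * (`|a| ^+ 3 * `|b|) + 6 * (`|a| ^+ 2 * `|b| ^+ 2) + 4 * (`|a| * `|b| ^+ 3) + `|b| ^+ 4.
  have nt (c x y : R) : 0 <= c -> `|c * (x * y)| = c * (`|x| * `|y|).
    by move=> c0; rewrite normrM (normrM x) ger0_norm.
  apply: le_trans (ler_normD _ _) _; apply: lerD; last by rewrite normrX.
  apply: le_trans (ler_normD _ _) _; apply: lerD; last first.
    by rewrite nt ?ler0n// normrX.
  apply: le_trans (ler_normD _ _) _; apply: lerD; first by rewrite nt ?ler0n// normrX.
  by rewrite nt ?ler0n// !normrX.
apply: le_trans tri _; rewrite -a4 -b4.
move: (normr_ge0 a) (normr_ge0 b); set p := `|a|; set q := `|b|; move=> p0 q0 {a4 b4}.
have [qp|pq] := lerP q (eta * p).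
- have qp1 : q <= p by rewrite (le_trans qp)// ler_piMl.
  have h1 : p ^+ 3 * q <= eta * p ^+ 4.
    have -> : eta * p ^+ 4 = p ^+ 3 * (eta * p) by ring.
    by apply: ler_wpM2l => //; exact: exprn_ge0.
  have h2 : p ^+ 2 * q ^+ 2 <= p ^+ 3 * q.
    have -> : p ^+ 3 * q = p ^+ 2 * q * p by ring.
    have -> : p ^+ 2 * q ^+ 2 = p ^+ 2 * q * q by ring.
    by apply: ler_wpM2l => //; apply: mulr_ge0 => //; exact: sqr_ge0.
  have h3 : p * q ^+ 3 <= p ^+ 2 * q ^+ 2.
    have -> : p * q ^+ 3 = p * q ^+ 2 * q by ring.
    have -> : p ^+ 2 * q ^+ 2 = p * q ^+ 2 * p by ring.
    by apply: ler_wpM2l => //; apply: mulr_ge0 => //; exact: sqr_ge0.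
  have h4 : q ^+ 4 <= p * q ^+ 3.
    by rewrite exprS; apply: ler_wpM2r => //; exact: exprn_ge0.
  have h5 : 0 <= eta^-1 ^+ 3 * q ^+ 4.
    by rewrite mulr_ge0// ?exprn_ge0// invr_ge0 ltW.
  lra.
- have z1 : 1 <= eta^-1 by rewrite invf_ge1.
  have pq' : p <= eta^-1 * q by rewrite ler_pdivlMl// ltW.
  set z := eta^-1 in z1 pq' *.
  have zq : 0 <= z * q by apply: le_trans pq'.
  have z0 : 0 <= z by apply: le_trans z1.
  have zz : z ^+ 2 <= z ^+ 3 by rewrite [leRHS]exprS ler_peMl// sqr_ge0.
  have zz1 : z <= z ^+ 2 by rewrite expr2 ler_peMl.
  have q4 : 0 <= q ^+ 4 by rewrite exprn_ge0.
  have h1 : p ^+ 3 * q <= z ^+ 3 * q ^+ 4.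
    have -> : z ^+ 3 * q ^+ 4 = (z * q) ^+ 3 * q by ring.
    by apply: ler_wpM2r => //; apply: lerXn2r.
  have h2 : p ^+ 2 * q ^+ 2 <= z ^+ 2 * q ^+ 4.
    have -> : z ^+ 2 * q ^+ 4 = (z * q) ^+ 2 * q ^+ 2 by ring.
    by apply: ler_wpM2r; [exact: sqr_ge0|apply: lerXn2r].
  have h3 : p * q ^+ 3 <= z * q ^+ 4.
    have -> : z * q ^+ 4 = z * q * q ^+ 3 by ring.
    by apply: ler_wpM2r => //; exact: exprn_ge0.
  have h4 := ler_wpM2r q4 zz; have h5 := ler_wpM2r q4 zz1.
  have h6 : q ^+ 4 <= z * q ^+ 4 by rewrite ler_peMl.
  have h7 : 0 <= eta * p ^+ 4 by rewrite mulr_ge0// ?exprn_ge0// ltW.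
  lra.
Qed.

Lemma cvg_quartic_perturbation (s : nat -> nat) (a b : forall n, 'I_(s n) -> R) l :
  \sum_i a n i ^+ 4 @[n --> \oo] --> l -> \sum_i b n i ^+ 4 @[n --> \oo] --> 0 ->
  \sum_i (a n i + b n i) ^+ 4 @[n --> \oo] --> l.
Proof.
move=> ha hb.
have p0 n : 0 <= \sum_i a n i ^+ 4 by apply: sumr_ge0 => i _; exact: exprn_even_ge0.
have q0 n : 0 <= \sum_i b n i ^+ 4 by apply: sumr_ge0 => i _; exact: exprn_even_ge0.
suff h : \sum_i (a n i + b n i) ^+ 4 - \sum_i a n i ^+ 4 @[n --> \oo] --> 0.
  rewrite -[l]add0r.
  rewrite (_ : (fun n => \sum_i (a n i + b n i) ^+ 4) = (fun n =>
    \sum_i (a n i + b n i) ^+ 4 - \sum_i a n i ^+ 4 + \sum_i a n i ^+ 4)).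
  2: by apply/funext => n; rewrite subrK.
  exact: cvgD.
apply/cvgrPdist_lt => e e0.
pose M := `|l| + 1; have M0 : 0 < M by rewrite ltr_wpDl.
pose eta := Num.min 1 (e / (30 * M)).
have eta0 : 0 < eta by rewrite lt_min ltr01 divr_gt0// mulr_gt0.
have eta1 : eta <= 1 by rewrite ge_min lexx.
have etaM : 15 * eta * M <= e / 2.
  have : eta <= e / (30 * M) by rewrite ge_min lexx orbT.
  rewrite ler_pdivlMr ?mulr_gt0//; lra.
pose C := 15 * eta^-1 ^+ 3; have C0 : 0 < C by rewrite mulr_gt0// exprn_gt0// invr_gt0.
near=> n.
have h1 : \sum_i a n i ^+ 4 <= M.
  near: n; apply: cvgr_le ha _ _; rewrite /M.
  by rewrite (le_lt_trans (ler_norm l))// ltrDl.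
have h2 : \sum_i b n i ^+ 4 < e / (2 * C).
  by near: n; apply: cvgr_lt hb _ _; rewrite divr_gt0// mulr_gt0.
rewrite sub0r normrN -sumrB.
have h3 : `|\sum_i ((a n i + b n i) ^+ 4 - a n i ^+ 4)| <=
    15 * eta * (\sum_i a n i ^+ 4) + C * \sum_i b n i ^+ 4.
  apply: le_trans (ler_norm_sum _ _ _) _; rewrite !mulr_sumr -big_split/=.
  apply: ler_sum => i _; apply: le_trans (quartic_perturbation (a n i) (b n i) eta0 eta1) _.
  by rewrite /C mulrDr !mulrA.
apply: le_lt_trans h3 _.
have h4 : C * \sum_i b n i ^+ 4 < e / 2.
  have -> : e / 2 = C * (e / (2 * C)) by field; rewrite gt_eqF.
  by rewrite ltr_pM2l.
have h5 : 15 * eta * \sum_i a n i ^+ 4 <= 15 * eta * M.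
  by rewrite ler_wpM2l// mulr_ge0// ltW.
lra.
Unshelve. all: by end_near. Qed.

Lemma sum_inv_square_le n : \sum_(k < n) (k.+1%:R^-1 : R) ^+ 2 <= 2.
Proof.
suff : \sum_(k < n) (k.+1%:R^-1 : R) ^+ 2 <= 2 * (1 - n.+1%:R^-1).
  by move=> /le_trans; apply; rewrite mulrBr mulr1 gerBl mulr_ge0.
elim: n => [|n ih]; first by rewrite big_ord0 invr1 subrr mulr0.
rewrite big_ord_recr/=.
apply: le_trans (lerD ih (lexx _)) _.
have n0 : 0 < n.+1%:R :> R by rewrite ltr0n.
have n1 : 1 <= n.+1%:R :> R by rewrite ler1n.
rewrite -[n.+2%:R]natr1; set y := n.+1%:R in n0 n1 *.
rewrite -subr_ge0.
rewrite (_ : _ - _ = (y - 1) / (y ^+ 2 * (y + 1))); last by field; lra.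
by rewrite divr_ge0 ?subr_ge0// mulr_ge0 ?sqr_ge0//; lra.
Qed.

Lemma sumr_sqr_le n (z : 'I_n -> R) : (forall i, 0 <= z i) ->
  \sum_i z i ^+ 2 <= (\sum_i z i) ^+ 2.
Proof.
move=> z0; rewrite [leRHS]expr2 mulr_suml; apply: ler_sum => i _.
by rewrite expr2 ler_wpM2l// (bigD1 i)//= lerDl sumr_ge0.
Qed.

End limits.

(** * Variances along a refining partition *)

Section partition.
Context (R : realType) (eps A1 A2 : R).
Hypothesis eps_gt0 : 0 < eps.
Hypothesis A1_gt0 : 0 < A1.
Hypothesis A12 : A1 < A2.
Context (Gam : R -> R).
Hypothesis dGam : forall v : R, -1 < v -> is_derive v 1 Gam (diag_remainder (eps * v)).
Local Notation k := (kappa eps).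

(** The index [n] stands for [n.+1] subintervals. *)
Definition mesh (n : nat) : R := (A2 - A1) / n.+1%:R.

Let Dl_gt0 : 0 < A2 - A1. Proof. by rewrite subr_gt0. Qed.

Lemma mesh_gt0 n : 0 < mesh n. Proof. by rewrite divr_gt0. Qed.

Lemma mesh_total n : n.+1%:R * mesh n = A2 - A1.
Proof. by rewrite /mesh mulrC divfK// pnatr_eq0. Qed.

Lemma mesh_le n : mesh n <= Num.sqrt (A2 - A1) * Num.sqrt (mesh n).
Proof.
rewrite -{1}[mesh n]sqr_sqrtr ?(ltW (mesh_gt0 n))// expr2 ler_wpM2r// ler_wsqrtr//.
by rewrite ler_pdivrMr// ler_peMr ?ler1n// ltW.
Qed.

Lemma cvg_sqrt_mesh : Num.sqrt (mesh n) @[n --> \oo] --> (0 : R).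
Proof.
have h : mesh n @[n --> \oo] --> (A2 - A1) * 0.
  by apply: cvgM; [exact: cvg_cst|exact: cvg_harmonic].
rewrite mulr0 in h; rewrite -(sqrtr0 R).
by apply: (@cvg_comp _ _ _ mesh Num.sqrt _ _ _ h); exact: sqrt_continuous.
Qed.

Lemma cvg0_sqrt_mesh (f : nat -> R) (C : R) :
  (forall n, `|f n| <= C * Num.sqrt (mesh n)) -> f n @[n --> \oo] --> 0.
Proof.
move=> fC; apply: norm_cvg0.
apply: (@squeeze_cvgr _ _ _ _ (cst 0) (fun n => C * Num.sqrt (mesh n))).
- by near=> n; rewrite normr_ge0 fC.
- exact: cvg_cst.
- by rewrite -(mulr0 C); apply: cvgM; [exact: cvg_cst|exact: cvg_sqrt_mesh].
Unshelve. all: by end_near. Qed.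

Lemma kappa_gt0 : 0 < k.
Proof. by rewrite invr_gt0 sqrtr_gt0 !mulr_gt0// pi_gt0. Qed.

(** The rows of the Gram matrix of the increments sum to at most
    [gram_const * sqrt mesh]. *)
Definition gram_const : R := 5 * k + 3 * (A2 - A1) * lipG eps * Num.sqrt (A2 - A1).

Lemma gram_const_gt0 : 0 < gram_const.
Proof.
rewrite /gram_const ltr_pwDl ?mulr_gt0 ?kappa_gt0//.
by apply: mulr_ge0 => //; apply: mulr_ge0; [apply: mulr_ge0 => //; exact: ltW|exact: lipG_ge0].
Qed.

Lemma row_bound_mesh n : row_bound eps (mesh n) n.+1 <= gram_const * Num.sqrt (mesh n).
Proof.
rewrite /row_bound /gram_const [leRHS]mulrDl lerD2l.
rewrite (_ : 3 * n.+1%:R * _ = 3 * (A2 - A1) * lipG eps * mesh n); last first.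
  by rewrite -(mesh_total n); ring.
rewrite -[leRHS]mulrA ler_wpM2l ?mesh_le//.
by apply: mulr_ge0; [apply: mulr_ge0 => //; exact: ltW|exact: lipG_ge0].
Qed.

(** The increments have variance [2 k sqrt dl] up to [O(dl)], hence a fourth moment
    of [12 k^2 dl] to leading order, and the steps [dl] add up to [A2 - A1]. *)
Lemma cvg_sum_inc_cov :
  \sum_(i < n.+1) 3 * inc_cov eps Gam (mesh n) A1 i i ^+ 2 @[n --> \oo] -->
    3 / pi * eps^-1 * (A2 - A1).
Proof.
have k2 : 12 * k ^+ 2 = 3 / pi * eps^-1.
  have p0 := pi_gt0 R; rewrite /kappa exprVn sqr_sqrtr ?mulr_ge0 ?(ltW p0) ?(ltW eps_gt0)//.
  by move: p0; generalize (pi : R) => p p0; field; rewrite !gt_eqF.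
pose B := k / Num.sqrt A1 + 2 * lipG eps * (A2 - A1).
have k0 := kappa_ge0 eps; have l0 := lipG_ge0 eps_gt0.
have B0 : 0 <= B.
  apply: addr_ge0; first by apply: divr_ge0 => //; exact: sqrtr_ge0.
  by apply: mulr_ge0; [apply: mulr_ge0 => //; exact: ler0n|exact: ltW].
pose C := 3 * (A2 - A1) * B * (4 * k + B * Num.sqrt (A2 - A1)).
apply/subr_cvg0; apply: (@cvg0_sqrt_mesh _ C) => n.
pose dl := mesh n; have dl0 : 0 < dl by exact: mesh_gt0.
have dlD : dl <= A2 - A1 by rewrite ler_pdivrMr// ler_peMr ?ler1n// ltW.
rewrite -/dl; set s := Num.sqrt dl; have s0 : 0 <= s by exact: sqrtr_ge0.
have s2 : s ^+ 2 = dl by rewrite sqr_sqrtr// ltW.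
have -> : 3 / pi * eps^-1 * (A2 - A1) = \sum_(i < n.+1) 3 * (4 * k ^+ 2 * dl).
  by rewrite sumr_const card_ord -[RHS]mulr_natl -k2 -(mesh_total n) -/dl; ring.
rewrite -sumrB; apply: le_trans (ler_norm_sum _ _ _) _.
have -> : C * s = \sum_(i < n.+1) 3 * (B * dl * ((4 * k + B * Num.sqrt (A2 - A1)) * s)).
  by rewrite sumr_const card_ord -[RHS]mulr_natl /C;
    set q := Num.sqrt (A2 - A1); rewrite -(mesh_total n) -/dl; ring.
apply: ler_sum => i _.
rewrite -mulrBr normrM (ger0_norm (ler0n _ 3)); apply: ler_wpM2l; first exact: ler0n.
have := inc_cov_diag eps_gt0 dGam dl0 A1_gt0 i; rewrite -/s.
set c := inc_cov _ _ _ _ _ _; set r := c - _ => hr.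
have hB : `|r| <= B * dl.
  apply: le_trans hr _; rewrite /B [leRHS]mulrDl; apply: lerD; first by rewrite mulrA mulrAC.
  have -> : 2 * lipG eps * (A2 - A1) * dl = 2 * (lipG eps * ((A2 - A1) * dl)) by ring.
  apply: ler_wpM2l; first exact: ler0n.
  by apply: (ler_wpM2l l0); rewrite expr2; apply: (ler_wpM2r (ltW dl0)).
have -> : c ^+ 2 - 4 * k ^+ 2 * dl = r * (4 * k * s + r) by rewrite -s2 /r; ring.
rewrite normrM; apply: ler_pM => //.
apply: le_trans (ler_normD _ _) _; rewrite [leRHS]mulrDl; apply: lerD.
  by rewrite ger0_norm// !mulr_ge0.
apply: le_trans hB _; rewrite -mulrA ler_wpM2l//; exact: mesh_le.
Qed.

End partition.

(** * The quartic variation of the solution *)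

Section quartic_variation.
Context d (Omega : measurableType d) (R : realType) (P : probability Omega R).
Context (T eps A1 A2 x : R).
Hypotheses (eps_gt0 : 0 < eps) (A1_gt0 : 0 < A1) (A12 : A1 < A2) (A2T : A2 <= T).
Local Notation S := (space_time T).
Local Notation leb2 := (lebesgue2 R).
Local Notation t n i := (A1 + i%:R * mesh A1 A2 n).
Context (Gam : R -> R).
Hypothesis dGam : forall v : R, -1 < v -> is_derive v 1 Gam (diag_remainder (eps * v)).
Hypothesis mK : forall s, 0 < s -> s <= T -> measurable_fun S (conv_kernel eps x s).
Local Notation K s := (conv_kernel eps x s \_ S).

Lemma grid_gt0 n i : 0 < t n i.
Proof. by rewrite ltr_pwDl// mulr_ge0// ltW// mesh_gt0. Qed.

Lemma grid_leT n i : (i <= n.+1)%N -> t n i <= T.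
Proof.
move=> iN; apply: le_trans A2T; rewrite -lerBrDl -(mesh_total A1 A2 n).
by rewrite ler_wpM2r ?ler_nat// ltW// mesh_gt0.
Qed.

Let has_int_conv_cov s r : 0 < s -> s <= T -> 0 < r -> r <= T ->
  has_int leb2 (fun z => K s z * K r z) (conv_cov eps Gam s r).
Proof.
move=> s0 sT r0 rT; rewrite /conv_cov; have [sr|rs] := leP s r.
  by rewrite ger0_norm ?subr_ge0//; apply: conv_kernel_covariance => //; exact: mK.
rewrite distrC ger0_norm ?subr_ge0 ?(ltW rs)// [r + s]addrC.
under [X in has_int _ X _]funext do rewrite mulrC.
by apply: conv_kernel_covariance => //; [exact: ltW|exact: mK|exact: mK].
Qed.

Let dK n i z := K (t n i.+1) z - K (t n i) z.

Let has_int_inc_cov n (i j : 'I_n.+1) :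
  has_int leb2 (fun z => dK n i z * dK n j z) (inc_cov eps Gam (mesh A1 A2 n) A1 i j).
Proof.
have h a b : (a <= n.+1)%N -> (b <= n.+1)%N ->
    has_int leb2 (fun z => K (t n a) z * K (t n b) z) (conv_cov eps Gam (t n a) (t n b)).
  by move=> an bn; apply: has_int_conv_cov; rewrite ?grid_gt0 ?grid_leT.
have iN := ltn_ord i; have jN := ltn_ord j.
have := has_intD (has_intD (has_intD (h _ _ iN jN) (has_intZ (-1) (h _ _ iN (ltnW jN))))
  (has_intZ (-1) (h _ _ (ltnW iN) jN))) (h _ _ (ltnW iN) (ltnW jN)).
rewrite !mulN1r -/(inc_cov eps Gam (mesh A1 A2 n) A1 i j).
have e (a b c e : R) : a * c + -1 * (a * e) + -1 * (b * c) + b * e = (a - b) * (c - e) by ring.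
by under [X in has_int _ X _]funext do rewrite e.
Qed.

Let L n := gram_const eps A1 A2 * Num.sqrt (mesh A1 A2 n).

Let L_gt0 n : 0 < L n.
Proof. by rewrite mulr_gt0 ?gram_const_gt0// sqrtr_gt0 mesh_gt0. Qed.

Let gram_row n (i : 'I_n.+1) :
  \sum_(j < n.+1) `|inc_cov eps Gam (mesh A1 A2 n) A1 i j| <= L n.
Proof.
apply: le_trans (row_bound_mesh eps_gt0 A12 n); apply: inc_cov_row_sum => //.
exact: mesh_gt0.
Qed.

Section noise.
Context (W : set (R * R) -> {RV P >-> R}) (I : R -> Omega -> R).
Hypothesis hW : white_noise T W.
Hypothesis hI : forall s, 0 < s -> s <= T -> wiener T W (I s) (K s).

(** With row sums and variances of order [sqrt mesh], the concentration bound is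
    of order [N ^+ 2 * mesh ^+ 4], that is [N^-2], which is summable. *)
Lemma noise_quartic_variation : {ae P, forall w,
  \sum_(i < n.+1) (I (t n i.+1) w - I (t n i) w) ^+ 4 @[n --> \oo] -->
    3 / pi * eps^-1 * (A2 - A1)}.
Proof.
pose D n (i : 'I_n.+1) w := I (t n i.+1) w - I (t n i) w.
pose m n := \sum_(i < n.+1) 3 * inc_cov eps Gam (mesh A1 A2 n) A1 i i ^+ 2.
have conc n : exists v, has_int P (fun w => (\sum_i D n i w ^+ 4 - m n) ^+ 4) v /\
    v <= 768 * gauss_moment R 12 * ((2 * L n) ^+ 2 * n.+1%:R ^+ 2 * (2 * L n) ^+ 6).
  have [||i|i j|i|i|v hv vle] := @wiener_concentration _ _ R P T W hW n.+1 (D n)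
    (fun i => dK n i) (inc_cov eps Gam (mesh A1 A2 n) A1) (L n) (L n).
  - exact: L_gt0.
  - exact: L_gt0.
  - by apply: wienerB => //; apply: hI; rewrite ?grid_gt0 ?grid_leT// ltnW.
  - exact: has_int_inc_cov.
  - exact: gram_row.
  - apply: le_trans (gram_row i); rewrite (bigD1 i)//= (le_trans (ler_norm _))//.
    by rewrite lerDl sumr_ge0.
  - by exists v.
have [v hv] := choice conc.
pose C := 768 * gauss_moment R 12 * (2 ^+ 8 * gram_const eps A1 A2 ^+ 8 * (A2 - A1) ^+ 4).
have vC n : v n <= C * (n.+1%:R^-1) ^+ 2.
  have [_ /le_trans] := hv n; apply; rewrite le_eqVlt; apply/orP; left; apply/eqP.
  rewrite /C -[RHS]mulrA; congr (_ * _).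
  rewrite /L; set s := Num.sqrt _; set g := gram_const _ _ _.
  have s8 : s ^+ 8 = mesh A1 A2 n ^+ 4.
    by rewrite (exprM s 2 4) sqr_sqrtr// ltW// mesh_gt0.
  transitivity (2 ^+ 8 * (g ^+ 8 * (s ^+ 8 * n.+1%:R ^+ 2))); first by ring.
  by rewrite s8 /mesh; field; rewrite nat1r pnatr_eq0.
have C0 : 0 <= C.
  have g0 k : 0 <= gauss_moment R k.*2.
    elim: k => [|k ih]; first exact: ler01.
    by rewrite doubleS; apply: mulr_ge0 ih; exact: ler0n.
  apply: mulr_ge0; first by apply: mulr_ge0 (g0 6); exact: ler0n.
  apply: mulr_ge0; last by apply: exprn_ge0; rewrite subr_ge0 ltW.
  by apply: mulr_ge0; apply: exprn_ge0 => //; exact/ltW/gram_const_gt0.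
have ae0 : {ae P, forall w, (\sum_i D n i w ^+ 4 - m n) ^+ 4 @[n --> \oo] --> 0}.
  apply: (@ae_cvg0_summable _ _ _ P _ v (C * 2)) => [n w|n|n].
  - exact: exprn_even_ge0.
  - by have [] := hv n.
  - apply: le_trans (ler_wpM2l C0 (sum_inv_square_le R n)); rewrite mulr_sumr.
    by apply: ler_sum => k _; exact: vC.
apply: (ae_imply ae0) => w hw.
have h0 : \sum_i D n i w ^+ 4 - m n @[n --> \oo] --> 0.
  apply: norm_cvg0.
  have e4 (y : R) : `|y| = Num.sqrt (Num.sqrt (y ^+ 4)).
    by rewrite (exprM y 2 2) sqrtr_sqr (ger0_norm (sqr_ge0 y)) sqrtr_sqr.
  have h1 : Num.sqrt ((\sum_i D n i w ^+ 4 - m n) ^+ 4) @[n --> \oo] --> Num.sqrt 0.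
    by apply: (@cvg_comp _ _ _ _ Num.sqrt _ _ _ hw); exact: sqrt_continuous.
  have h2 : Num.sqrt (Num.sqrt ((\sum_i D n i w ^+ 4 - m n) ^+ 4)) @[n --> \oo] -->
      Num.sqrt (Num.sqrt 0).
    by apply: (@cvg_comp _ _ _ _ Num.sqrt _ _ _ h1); exact: sqrt_continuous.
  by rewrite !sqrtr0 in h2; under eq_fun do rewrite e4.
have h3 := cvgD h0 (cvg_sum_inc_cov eps_gt0 A1_gt0 A12 dGam); rewrite add0r in h3.
rewrite (_ : (fun n => \sum_(i < n.+1) (I (t n i.+1) w - I (t n i) w) ^+ 4) =
  (fun n => \sum_i D n i w ^+ 4 - m n + m n)); first exact: h3.
by apply/funext => n; rewrite subrK.
Qed.

End noise.

(** The drift has finite energy, so its increments are square summable with sum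
    [O(sqrt mesh)]. *)
Lemma drift_quartic_variation (f : R * R -> R) (F : R) (Y : R -> R) :
  has_int leb2 (fun z => f z ^+ 2) F ->
  (forall s, 0 < s -> s <= T -> has_int leb2 (fun z => K s z * f z) (Y s)) ->
  \sum_(i < n.+1) (Y (t n i.+1) - Y (t n i)) ^+ 4 @[n --> \oo] --> 0.
Proof.
move=> hF hY.
pose C := gram_const eps A1 A2 ^+ 2 * Num.sqrt (A2 - A1) * F ^+ 2.
apply: (@cvg0_sqrt_mesh _ A1 A2 _ C) => n.
have b : \sum_(i < n.+1) (Y (t n i.+1) - Y (t n i)) ^+ 2 <= L n * F.
  apply: (@bessel _ _ _ leb2 n.+1 (fun i => dK n i) f (inc_cov eps Gam (mesh A1 A2 n) A1)) => //.
  move=> i; have iN := ltn_ord i.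
    have h a : (a <= n.+1)%N -> has_int leb2 (fun z => K (t n a) z * f z) (Y (t n a)).
      by move=> an; apply: hY; rewrite ?grid_gt0 ?grid_leT.
    have := has_intD (h _ iN) (has_intZ (-1) (h _ (ltnW iN))).
    rewrite mulN1r; under [X in has_int _ X _]funext do rewrite mulN1r -mulrBl.
    exact.
rewrite ger0_norm; last by apply: sumr_ge0 => i _; exact: exprn_even_ge0.
apply: (@le_trans _ _ ((L n * F) ^+ 2)).
  under eq_bigr do rewrite (exprM _ 2 2).
  apply: le_trans (sumr_sqr_le _) _; first by move=> i; exact: sqr_ge0.
  rewrite lerXn2r// nnegrE; first by apply: sumr_ge0 => i _; exact: sqr_ge0.
  by apply: le_trans b; apply: sumr_ge0 => i _; exact: sqr_ge0.
rewrite /L; set s := Num.sqrt (mesh _ _ _).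
have s2 : s ^+ 2 <= Num.sqrt (A2 - A1) * s.
  by rewrite sqr_sqrtr ?mesh_le// ltW// mesh_gt0.
have -> : (gram_const eps A1 A2 * s * F) ^+ 2 = gram_const eps A1 A2 ^+ 2 * F ^+ 2 * s ^+ 2 by ring.
have -> : C * s = gram_const eps A1 A2 ^+ 2 * F ^+ 2 * (Num.sqrt (A2 - A1) * s) by rewrite /C; ring.
by apply: ler_wpM2l => //; rewrite mulr_ge0 ?sqr_ge0.
Qed.

End quartic_variation.

Theorem proposition4p9 (d : measure_display) (Omega : measurableType d)
    (R : realType) (P : probability Omega R) (T : R) (hT : 0 < T)
    (W : set (R * R) -> {RV P >-> R}) (hW : white_noise T W)
    (eps : R) (heps : 0 < eps)
    (u : R -> R -> Omega -> R)
    (hu : is_mild_solution eps T (@allen_cahn R) W u)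
    (A1 A2 : R) (hA1 : 0 < A1) (hA12 : A1 < A2) (hA2 : A2 <= T)
    (x : R) (hx : x \in torus R) :
  {ae P, forall w,
     quartic_variation A1 A2 N x (fun t y => u t y w) @[N --> \oo] -->
       3 / pi * eps^-1 * (A2 - A1)}.
Proof.
have [mu umom mild] := hu.
pose drift t w := \int[@lebesgue_measure R]_(s in `[0, t])
  (\int[@lebesgue_measure R]_(y in torus R)
    (heat_kernel (eps * (t - s)) (x - y) * allen_cahn (u s y w))).
have exI t : exists J : {RV P >-> R}, t \in `[0, T] ->
    is_wiener_integral T W (conv_kernel eps x t) J /\
    {ae P, forall w, u t x w = drift t w + J w}.
  have [tT|_] := boolP (t \in `[0, T]); last by exists (W set0).
  by have [J hJ] := mild t x tT hx; exists J.
have [I hI] := choice exI.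
have in0T t : 0 < t -> t <= T -> t \in `[0, T].
  by move=> t0 tT; rewrite in_itv/= (ltW t0).
have mK t : 0 < t -> t <= T -> measurable_fun (space_time T) (conv_kernel eps x t).
  by move=> t0 tT; have [[]] := hI t (in0T t t0 tT).
have wI t : 0 < t -> t <= T -> wiener T W (I t) (conv_kernel eps x t \_ (space_time T)).
  by move=> t0 tT; apply: wiener_integral_wiener => //; have [] := hI t (in0T t t0 tT).
have [Gam dGam] : exists G : R -> R,
    forall v : R, -1 < v -> is_derive v 1 G (diag_remainder (eps * v)).
  apply: (@antiderivative R (fun v => diag_remainder (eps * v))) => v.
  apply: (@continuous_comp _ _ _ (fun v => eps * v) (@diag_remainder R)).
    by apply: cvgM; [exact: cvg_cst|exact: cvg_id].
  exact: continuous_diag_remainder.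
pose tt n i := A1 + i%:R * mesh A1 A2 n.
have gt0 n i : 0 < tt n i by exact: grid_gt0.
have gT n i : (i <= n.+1)%N -> tt n i <= T by exact: grid_leT.
have ae_mild : {ae P, forall w, forall n i, (i <= n.+1)%N ->
    u (tt n i) x w = drift (tt n i) w + I (tt n i) w}.
  apply/ae_foralln => n; apply/ae_foralln => i.
  have [iN|iN] := boolP (i <= n.+1)%N; last by apply: nearW.
  have [_ h] := hI _ (in0T _ (gt0 n i) (gT n i iN)).
  by apply: (ae_imply h) => w hw _.
have ae_noise := noise_quartic_variation heps hA1 hA12 hA2 dGam mK hW wI.
have ae_reaction := reaction_square_integrable hT mu umom.
have ae_drift : {ae P, forall w, \sum_(i < n.+1) (drift (tt n i.+1) w - drift (tt n i) w) ^+ 4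
    @[n --> \oo] --> (0 : R)}.
  apply: (ae_imply ae_reaction) => w [F hF].
  apply: (@drift_quartic_variation R T eps A1 A2 x heps hA1 hA12 hA2 Gam dGam mK _ F
    (fun t => drift t w) hF) => t t0 tT.
  have [E hE] : exists E, has_int (lebesgue2 R)
      (fun z => (conv_kernel eps x t \_ (space_time T)) z ^+ 2) E.
    have hcov := conv_kernel_covariance heps dGam t0 (lexx t) tT (mK t t0 tT) (mK t t0 tT).
    by eexists; exact: hcov.
  exact: (drift_inner_product tT (measurable_reaction mu w) (mK t t0 tT) hE hF).
have ae_all := ae_imply2 ae_noise ae_drift (fun w h1 h2 => conj h1 h2).
apply: (ae_imply2 ae_mild ae_all) => w hmild [hnoise hdrift].
rewrite -(cvg_shiftS (fun N => quartic_variation A1 A2 N x (fun t y => u t y w))).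
have hq := @cvg_quartic_perturbation R S
  (fun n i => I (tt n i.+1) w - I (tt n i) w)
  (fun n i => drift (tt n i.+1) w - drift (tt n i) w) _ hnoise hdrift.
rewrite (_ : (fun n => quartic_variation A1 A2 n.+1 x (fun t y => u t y w)) =
  (fun n => \sum_(i < n.+1) (I (tt n i.+1) w - I (tt n i) w +
    (drift (tt n i.+1) w - drift (tt n i) w)) ^+ 4)); first exact: hq.
apply/funext => n; apply: eq_bigr => i _; congr (_ ^+ 4).
have e a : (a <= n.+1)%N -> u (grid A1 A2 n.+1 a) x w = drift (tt n a) w + I (tt n a) w.
  exact: hmild.
rewrite (e _ (ltn_ord i)) (e _ (ltnW (ltn_ord i))).
by rewrite opprD addrACA addrC.
Qed.
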